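(* Let $(M,\omega)$ be a symplectic manifold of dimension $2n\ge 8$. Assume $(M,\omega)$ is endowed with a symplectic connection $\nabla$ and with a smooth $\nabla$-parallel field $A$ of endomorphisms of the tangent bundle such that $A^2=\lambda\,\mathrm{Id}$ with $\lambda$ a real constant and, for all $y\in M$, $A_y\in\mathfrak{sp}(T_yM,\omega_y)$. Assume that the rank of $A$ is at least $3$. Assume that, for any point $y\in M$ and any symplectic $A_y$-stable subspace $V$ of $T_yM$, there exists a totally geodesic submanifold $S$ of $M$ such that $y\in S$ and $T_yS=V$. Then $(M,\omega,\nabla)$ is locally symmetric (i.e. $\nabla R^\nabla=0$) and the connection $\nabla$ is of Ricci-type.
   Context: A symplectic connection on $(M,\omega)$ is a torsion-free linear connection $\nabla$ with $\nabla\omega=0$. $\mathfrak{sp}(T_yM,\omega_y)$ is the set of endomorphisms $B$ of $T_yM$ with $\omega_y(BX,Y)+\omega_y(X,BY)=0$ for all $X,Y$. A subspace $V\subset T_yM$ is symplectic if $\omega_y|_V$ is nondegenerate. A connected submanifold $S$ of a manifold with connection $(M,\nabla)$ is totally geodesic if each geodesic of $M$ which is tangent to $S$ at a point lies entirely in $S$. Let $R^\nabla$ be the curvature tensor of $\nabla$. The Ricci tensor is $r^\nabla(X,Y):=\mathrm{Tr}[Z\mapsto R^\nabla(X,Z)Y]$ (it is symmetric), and the Ricci endomorphism $\rho^\nabla$ is defined by $\omega(X,\rho^\nabla Y)=r^\nabla(X,Y)$. The connection is of Ricci-type (in dimension $2n\geq 4$) if $$R^\nabla(X,Y)Z=\tfrac{1}{2n+2}\bigl(2\omega(X,Y)\rho^\nabla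 Z+\omega(X,Z)\rho^\nabla Y-\omega(Y,Z)\rho^\nabla X+\omega(X,\rho^\nabla Z)Y-\omega(Y,\rho^\nabla Z)X\bigr)$$ for all vector fields $X,Y,Z$. *)

(* Defs.v *)
From HB Require Import structures.
From mathcomp Require Import all_boot all_order all_algebra.
From mathcomp Require Import boolp classical_sets reals topology normedtype derive.

Set Implicit Arguments.
Unset Strict Implicit.
Unset Printing Implicit Defensive.

Import Order.TTheory GRing.Theory Num.Theory.
Import numFieldNormedType.Exports.

Local Open Scope classical_set_scope.
Local Open Scope ring_scope.

(* Differential geometry in the classical chart-wise style.  A point of the
   model space R^m is a row vector.  Tensor fields and linear connections on a
   manifold are families of components, one for each chart of the atlas, that
   obey the usual transformation laws.  A vector field on a chart domain is its
   smooth component function on the chart image. *)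

Section Smooth.
Context {R : realType} {m : nat} {W : normedModType R}.

(* On an open set of the finite-dimensional space R^m, being C^k.+1 is the
   same as having all directional derivatives, and having them C^k. *)
Fixpoint Ck_on (k : nat) (U : set 'rV[R]_m) (f : 'rV[R]_m -> W) : Prop :=
  (forall x, U x -> {for x, continuous f}) /\
  if k is k'.+1 then
    forall v, (forall x, U x -> derivable f x v) /\
              Ck_on k' U (fun x => 'D_v f x)
  else True.

Definition smooth_on (U : set 'rV[R]_m) (f : 'rV[R]_m -> W) : Prop :=
  forall k, Ck_on k U f.

End Smooth.

(* [cmap] and [cinv] are total functions, meaningful on [cdom] and [cimg]. *)
Record chart (R : realType) (m : nat) (T : topologicalType) := Chart {
  cdom : set T;
  cimg : set 'rV[R]_m;
  cmap : T -> 'rV[R]_m;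
  cinv : 'rV[R]_m -> T;
  cdom_open : open cdom;
  cimg_open : open cimg;
  cmap_img : forall y, cdom y -> cimg (cmap y);
  cinv_dom : forall x, cimg x -> cdom (cinv x);
  cmapK : forall y, cdom y -> cinv (cmap y) = y;
  cinvK : forall x, cimg x -> cmap (cinv x) = x;
  cmap_continuous : forall y, cdom y -> {for y, continuous cmap};
  cinv_continuous : forall x, cimg x -> {for x, continuous cinv} }.

Definition overlap (R : realType) (m : nat) (T : topologicalType)
  (c d : chart R m T) : set 'rV[R]_m := cmap c @` (cdom c `&` cdom d).

Definition transition (R : realType) (m : nat) (T : topologicalType)
  (c d : chart R m T) (x : 'rV[R]_m) : 'rV[R]_m := cmap d (cinv c x).

Record manifold (R : realType) (m : nat) := Manifold {
  mspace :> topologicalType;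
  mhausdorff : hausdorff_space mspace;
  msecond_countable : @second_countable mspace;
  atlas : set (chart R m mspace);
  atlas_cover : forall y : mspace, exists2 c, atlas c & cdom c y;
  atlas_smooth : forall c d, atlas c -> atlas d ->
    smooth_on (overlap c d) (transition c d) }.

Arguments atlas {R m} M _ : rename.

Section Tensors.
Context {R : realType} {m : nat} (M : manifold R m).
Local Notation E := 'rV[R]_m.

Definition bil (B : 'M[R]_m) (u v : E) : R := (u *m B *m v^T) 0 0.

Definition vector_field (c : chart R m M) (X : E -> E) : Prop :=
  smooth_on (cimg c) X.

(* Components of a field of bilinear forms (values [bil (om c x) u v]) or of a
   field of endomorphisms (values [u *m A c x]). *)
Definition mx_field := chart R m M -> E -> 'M[R]_m.

Definition two_tensor (om : mx_field) : Prop :=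
  (forall c, atlas M c -> smooth_on (cimg c) (om c)) /\
  (forall c d, atlas M c -> atlas M d -> forall x, overlap c d x -> forall u v,
     bil (om d (transition c d x))
         ('D_u (transition c d) x) ('D_v (transition c d) x)
     = bil (om c x) u v).

Definition endo_field (A : mx_field) : Prop :=
  (forall c, atlas M c -> smooth_on (cimg c) (A c)) /\
  (forall c d, atlas M c -> atlas M d -> forall x, overlap c d x -> forall u,
     'D_u (transition c d) x *m A d (transition c d x)
     = 'D_(u *m A c x) (transition c d) x).

Definition nondegenerate_on (B V : 'M[R]_m) : Prop :=
  forall u : E, (u <= V)%MS ->
    (forall v : E, (v <= V)%MS -> bil B u v = 0) -> u = 0.

Definition symplectic_form (om : mx_field) : Prop :=
  [/\ two_tensor om,
      forall c, atlas M c -> forall x, cimg c x -> forall u,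
        bil (om c x) u u = 0,
      forall c, atlas M c -> forall x, cimg c x ->
        nondegenerate_on (om c x) 1%:M
    & forall c, atlas M c -> forall x, cimg c x -> forall u v w,
        'D_u (fun z => bil (om c z) v w) x + 'D_v (fun z => bil (om c z) w u) x
        + 'D_w (fun z => bil (om c z) u v) x = 0].

(* [G c x u v] is the vector of components u^i v^j Gamma_ij^k(x); the last
   clause is the transformation law of Christoffel symbols, which says that the
   local operators [covd] below agree on chart overlaps. *)
Definition christoffel := chart R m M -> E -> E -> E -> E.

Definition linear_connection (G : christoffel) : Prop :=
  [/\ forall c, atlas M c -> forall x, cimg c x ->
        bilinear_for *:%R *:%R (G c x : E -> E -> E),
      forall c, atlas M c -> forall u v, smooth_on (cimg c) (fun x => G c x u v)
    & forall c d, atlas M c -> atlas M d -> forall x, overlap c d x ->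
        forall u v,
        'D_(G c x u v) (transition c d) x =
        'D_u (fun z => 'D_v (transition c d) z) x
        + G d (transition c d x)
            ('D_u (transition c d) x) ('D_v (transition c d) x)].

Definition covd (G : christoffel) (c : chart R m M) (X Y : E -> E) : E -> E :=
  fun x => 'D_(X x) Y x + G c x (X x) (Y x).

Definition lie (X Y : E -> E) : E -> E :=
  fun x => 'D_(X x) Y x - 'D_(Y x) X x.

Definition torsion_free (G : christoffel) : Prop :=
  forall c, atlas M c -> forall X Y, vector_field c X -> vector_field c Y ->
  forall x, cimg c x -> covd G c X Y x - covd G c Y X x = lie X Y x.

Definition parallel_form (G : christoffel) (om : mx_field) : Prop :=
  forall c, atlas M c -> forall X Y Z,
  vector_field c X -> vector_field c Y -> vector_field c Z ->
  forall x, cimg c x ->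
    'D_(X x) (fun z => bil (om c z) (Y z) (Z z)) x =
    bil (om c x) (covd G c X Y x) (Z x) + bil (om c x) (Y x) (covd G c X Z x).

Definition parallel_endo (G : christoffel) (A : mx_field) : Prop :=
  forall c, atlas M c -> forall X Y, vector_field c X -> vector_field c Y ->
  forall x, cimg c x ->
    covd G c X (fun z => Y z *m A c z) x = covd G c X Y x *m A c x.

Definition symplectic_connection (om : mx_field) (G : christoffel) : Prop :=
  [/\ linear_connection G, torsion_free G & parallel_form G om].

Definition curvature (G : christoffel) (c : chart R m M) (X Y Z : E -> E) :
    E -> E :=
  fun x => covd G c X (covd G c Y Z) x - covd G c Y (covd G c X Z) x
           - covd G c (lie X Y) Z x.

Definition locally_symmetric (G : christoffel) : Prop :=
  forall c, atlas M c -> forall W X Y Z,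
  vector_field c W -> vector_field c X -> vector_field c Y ->
  vector_field c Z -> forall x, cimg c x ->
    covd G c W (curvature G c X Y Z) x
    - curvature G c (covd G c W X) Y Z x
    - curvature G c X (covd G c W Y) Z x
    - curvature G c X Y (covd G c W Z) x = 0.

(* Trace of w |-> R(u, w) v; tangent vectors are extended to constant
   component fields, which is harmless since the curvature is a tensor. *)
Definition ricci (G : christoffel) (c : chart R m M) (x u v : E) : R :=
  \tr (lin1_mx (fun w : E => curvature G c (fun=> u) (fun=> w) (fun=> v) x)).

Definition ricci_endo (om : mx_field) (G : christoffel) (rho : mx_field) :
    Prop :=
  forall c, atlas M c -> forall x, cimg c x -> forall u v,
    bil (om c x) u (v *m rho c x) = ricci G c x u v.

(* [rho] is unique on chart images, [om] being nondegenerate; [m] is the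
   dimension 2n of the manifold. *)
Definition ricci_type (om : mx_field) (G : christoffel) : Prop :=
  exists2 rho : mx_field, ricci_endo om G rho &
  forall c, atlas M c -> forall X Y Z,
  vector_field c X -> vector_field c Y -> vector_field c Z ->
  forall x, cimg c x ->
    let w := bil (om c x) in
    let r (u : E) := u *m rho c x in
    curvature G c X Y Z x =
    (m%:R + 2)^-1 *: ((2 * w (X x) (Y x)) *: r (Z x)
                      + w (X x) (Z x) *: r (Y x)
                      - w (Y x) (Z x) *: r (X x)
                      + w (X x) (r (Z x)) *: Y x
                      - w (Y x) (r (Z x)) *: X x).

(* Solutions of the geodesic equation are automatically smooth. *)
Definition geodesic (G : christoffel) (J : set R) (g : R -> M) : Prop :=
  [/\ open J, is_interval J, forall t, J t -> {for t, continuous g}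
    & forall c, atlas M c -> forall t, J t -> cdom c (g t) ->
        let x : R -> E := cmap c \o g in
        [/\ derivable x t 1, derivable (derive1 x) t 1
          & derive1 (derive1 x) t + G c (x t) (derive1 x t) (derive1 x t) = 0] ].

End Tensors.

Section Submanifolds.
Context {R : realType} {k m : nat} (S : manifold R k) (M : manifold R m).

Definition local_rep (i : S -> M) (d : chart R k S) (c : chart R m M) :
    'rV[R]_k -> 'rV[R]_m :=
  fun x => cmap c (i (cinv d x)).

Definition local_dom (i : S -> M) (d : chart R k S) (c : chart R m M) :
    set 'rV[R]_k :=
  cmap d @` (cdom d `&` i @^-1` cdom c).

(* Immersed submanifold with its own topology, given by its inclusion map;
   embedded submanifolds are a special case. *)
Definition submanifold (i : S -> M) : Prop :=
  [/\ injective i, continuous i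
    & forall d c, atlas S d -> atlas M c ->
        smooth_on (local_dom i d c) (local_rep i d c) /\
        forall x, local_dom i d c x ->
          forall w, 'D_w (local_rep i d c) x = 0 -> w = 0].

(* The tangent space at [i q], in the coordinates of [c]. *)
Definition tangent_space (i : S -> M) (q : S) (c : chart R m M) :
    set 'rV[R]_m :=
  [set u | exists2 d, atlas S d /\ cdom d q
           & exists w, 'D_w (local_rep i d c) (cmap d q) = u].

(* That the geodesic lies in [S] means that it is a continuous curve of [S];
   for an embedded [S] this is just inclusion of its image. *)
Definition totally_geodesic (G : christoffel M) (i : S -> M) : Prop :=
  connected [set: S] /\
  forall (J : set R) (g : R -> M), geodesic G J g ->
  forall t0 q, J t0 -> g t0 = i q ->
  (exists c, [/\ atlas M c, cdom c (g t0)
               & tangent_space i q c (derive1 (cmap c \o g) t0)]) ->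
  exists h : R -> S, (forall t, J t -> {for t, continuous h}) /\
                     (forall t, J t -> i (h t) = g t).

End Submanifolds.

(* Main.v *)
From HB Require Import structures.
Require Import Defs.
From mathcomp Require Import all_boot all_order all_algebra.
From mathcomp Require Import boolp classical_sets functions reals topology normedtype derive landau.
From mathcomp Require Import sequences measure lebesgue_measure lebesgue_integral ftc.
From mathcomp Require Import ring lra.

Set Implicit Arguments.
Unset Strict Implicit.
Unset Printing Implicit Defensive.

Import Order.TTheory GRing.Theory Num.Theory.
Import numFieldNormedType.Exports.
Local Open Scope classical_set_scope.
Local Open Scope ring_scope.

(* A totally geodesic submanifold has vanishing second fundamental form, since
   it contains the geodesics issued from its tangent vectors; hence its tangent
   spaces are stable under the curvature [R].  Apply this to the span of [X],
   [A X], [Y], [A Y] for [Y] orthogonal to [X] and [A X], with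
   [g X = omega(X, A X)] and [g Y] nonzero: [R(X,Y)X] and [R(X,AX)X] are then
   orthogonal to every [T] orthogonal to that span.  Polarizing these relations
   and using that [R] commutes with [A], is [sp]-valued and satisfies the first
   Bianchi identity, one finds [R = kappa K], where [K] is the parallel tensor
   built from [omega] and [A] by the Ricci-type formula.  The second Bianchi
   identity becomes [d kappa /\ K = 0], so [d kappa = 0] and [R] is parallel; the
   trace of [K] gives [rho = (2n + 2) kappa A]. *)

(** * Algebraic curvature tensors commuting with an endomorphism *)

(** Since [lambda = 0] is allowed, the symmetric form [w a (A b)] may be degenerate: its kernel is
    that of [A]. What survives is that a vector with [g X != 0] spans with [A X] an [A]-stable
    symplectic plane, which splits off. The totally geodesic submanifolds therefore give relations
    between nonnull vectors only, and each relation has to be carried over to null vectors by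
    expressing these through nonnull ones. The proportionality to the model is proved as a vanishing
    statement: after subtraction of a multiple of the model, a single vanishing coefficient
    [D X Y X (A Y)] must force the whole tensor to be zero. This uses three mutually orthogonal
    nonnull vectors, which the rank and the dimension provide. On the analytic side, a geodesic
    inside [S] is only given as a continuous curve of [S], and [kappa] arises from a choice at each
    point. Neither is differentiable by construction: the first obstacle is met by a second order
    estimate, the second by writing [kappa] locally as a quotient of smooth functions. *)

Section CurvatureAlgebra.
Variables (R : realFieldType) (V : lmodType R).
Variables (w : V -> V -> R) (A : V -> V) (lambda : R).
Hypothesis wDl : forall a b c, w (a + b) c = w a c + w b c.
Hypothesis wZl : forall k a c, w (k *: a) c = k * w a c.
Hypothesis wC : forall a b, w a b = - w b a.
Hypothesis AD : forall a b, A (a + b) = A a + A b.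
Hypothesis AZ : forall k a, A (k *: a) = k *: A a.
Hypothesis AA : forall a, A (A a) = lambda *: a.
Hypothesis wA : forall a b, w (A a) b = - w a (A b).

Let wDr a b c : w a (b + c) = w a b + w a c.
Proof. by rewrite wC wDl opprD -!wC. Qed.
Let wZr k a b : w a (k *: b) = k * w a b.
Proof. by rewrite wC wZl -mulrN -wC. Qed.
Let NV (a : V) : - a = (-1) *: a.
Proof. by rewrite scaleN1r. Qed.
Let w0 a : w a a = 0.
Proof. by have := wC a a; lra. Qed.

Let g a := w a (A a).
(** [b] is [w]-orthogonal to the [A]-stable span of [a] and [A a]. As [A] is skew for [w] and
    squares to a scalar, the relation is symmetric and preserved by [A] on either side. *)
Definition Aorth a b := w a b = 0 /\ w (A a) b = 0.
Local Notation "a # b" := (Aorth a b) (at level 60).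

Lemma AorthC a b : a # b -> b # a.
Proof.
move=> [h1 h2]; split; first by rewrite wC h1 oppr0.
by rewrite wA -wC.
Qed.
Lemma AorthDr a b c : a # b -> a # c -> a # (b + c).
Proof. by move=> [h1 h2] [h3 h4]; split; rewrite wDr ?h1 ?h2 ?h3 ?h4 addr0. Qed.
Lemma AorthZr k a b : a # b -> a # (k *: b).
Proof. by move=> [h1 h2]; split; rewrite wZr ?h1 ?h2 mulr0. Qed.
Lemma AorthAr a b : a # b -> a # A b.
Proof.
move=> [h1 h2]; have h3 : w a (A b) = 0 by have := wA a b; lra.
by split=> //; rewrite wA AA wZr h1 mulr0 oppr0.
Qed.
Lemma AorthDl a b c : a # c -> b # c -> (a + b) # c.
Proof. by move=> h1 h2; apply/AorthC/AorthDr; apply/AorthC. Qed.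
Lemma AorthZl k a c : a # c -> (k *: a) # c.
Proof. by move=> h1; apply/AorthC/AorthZr/AorthC. Qed.
Lemma AorthAl a b : a # b -> A a # b.
Proof. by move=> h; apply/AorthC/AorthAr/AorthC. Qed.
Lemma AorthBr a b c : a # b -> a # c -> a # (b - c).
Proof. by move=> h1 h2; rewrite NV; apply: AorthDr => //; apply: AorthZr. Qed.
Lemma AorthNl a b : a # b -> (- a) # b.
Proof. by move=> h1; rewrite NV; apply: AorthZl. Qed.

Let orthw a b : a # b -> [/\ w a b = 0, w a (A b) = 0, w (A a) b = 0 & w b a = 0].
Proof.
move=> h; have [h1 h2] := h; have [h3 _] := AorthAr h; split=> //.
by have [] := AorthC h.
Qed.

Let gadd a b : a # b -> g (a + b) = g a + g b.
Proof.
move=> h; have [_ h1 _ _] := orthw h; have [_ h2 _ _] := orthw (AorthC h).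
by rewrite /g AD !wDl !wDr h1 h2 addr0 add0r.
Qed.
Let gscale k a : g (k *: a) = k ^+ 2 * g a.
Proof. by rewrite /g AZ wZl wZr; ring. Qed.

(** The [w]-orthogonal projection of [T] onto the plane of [X] and [A X]. The only product on that
    plane is [w X (A X) = g X], hence the denominators. *)
Definition Aproj X T := (- w (A X) T / g X) *: X + (w X T / g X) *: A X.

Lemma Aproj_orth X T : g X != 0 -> X # (T - Aproj X T).
Proof.
move=> gX; split.
  rewrite wDr NV wZr /Aproj wDr !wZr w0 -/(g X); field; exact: gX.
rewrite wDr NV wZr /Aproj wDr !wZr w0 (wA X X) -/(g X); field; exact: gX.
Qed.

Lemma Aproj_orthr X Y T : X # Y -> Aproj X T # Y.
Proof. by move=> h; apply: AorthDl; apply: AorthZl => //; apply: AorthAl. Qed.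

(* [s = 1] or [s = 2] works. *)
Let ex_scale (a b : R) : b != 0 -> exists s : R, s != 0 /\ a + s ^+ 2 * b != 0.
Proof.
move=> b0; have [ab|ab] := eqVneq (a + b) 0.
  exists 2; split; first by rewrite pnatr_eq0.
  have -> : a = - b by lra.
  have -> : - b + 2 ^+ 2 * b = 3 * b by ring.
  by rewrite mulf_neq0 // pnatr_eq0.
by exists 1; rewrite oner_eq0 expr1n mul1r.
Qed.

Hypothesis ex_nonnull : exists X, g X != 0.
Hypothesis ex_third : forall X Y, g X != 0 -> (Y = 0 \/ g Y != 0) -> X # Y ->
  exists Z, [/\ g Z != 0, X # Z & Y # Z].

(* [D x y z t] stands for [w (R x y z) t].  The last clause is what a totally
   geodesic submanifold tangent to the span of [X], [A X], [Y], [A Y] yields. *)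
Record Acurvature (D : V -> V -> V -> V -> R) : Prop := ACurvature {
  curvDl : forall a b y z t, D (a + b) y z t = D a y z t + D b y z t;
  curvZl : forall k a y z t, D (k *: a) y z t = k * D a y z t;
  curvDm : forall x y a b t, D x y (a + b) t = D x y a t + D x y b t;
  curvZm : forall k x y a t, D x y (k *: a) t = k * D x y a t;
  curvN : forall x y z t, D x y z t = - D y x z t;
  curvC : forall x y z t, D x y z t = D x y t z;
  curvB : forall x y z t, D x y z t + D y z x t + D z x y t = 0;
  curvA : forall x y z t, D x y (A z) t = - D x y z (A t);
  curvS : forall X Y T, X # Y -> g X != 0 -> g Y != 0 -> X # T -> Y # T ->
    D X Y X T = 0 /\ D X (A X) X T = 0 }.

(** This is [w (K x y z) t], where [K] is the Ricci-type expression with [A] for the Ricci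
    endomorphism and without the scalar in front. [A] is moved onto [t], which changes the signs of
    the first three terms. *)
Definition model_curvature x y z t :=
  - 2 * w x y * w z (A t) - w x z * w y (A t) + w y z * w x (A t)
  + w x (A z) * w y t - w y (A z) * w x t.

(** The conditions of [Acurvature] are linear in [D], so this is what permits subtracting a multiple
    of the model from a given [D]. *)
Lemma model_Acurvature : Acurvature model_curvature.
Proof.
have gC a b : w a (A b) = w b (A a) by have := wA a b; have := wC (A a) b; lra.
rewrite /model_curvature; split=> [a b y z t|k a y z t|x y a b t|k x y a t|x y z t|x y z t|x y z t|x y z t|X Y T XY _ _ XT YT];
  rewrite ?AD ?AZ ?wDl ?wDr ?wZl ?wZr ?wDl ?wZl; try ring.
- by rewrite (wC y x); ring.
- by rewrite (gC t z); ring.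
- rewrite (wC z y) (wC x z) (wC y x) (gC z x) (gC z y) (gC y x); ring.
- rewrite !AA !wZr !(wA z) !AA !wZr (gC y z) (gC x z); ring.
have [_ XAY _ YX] := orthw XY; have [XT1 XAT AXT _] := orthw XT.
have [YT1 YAT _ _] := orthw YT; have [XY1 _] := XY.
rewrite !w0 (gC Y X) XAY XAT XT1 YAT YT1 XY1 ?AXT; split; ring.
Qed.

(** On the span of [X] and [Y] the form [w a (A b)] is diagonal, and the second vector is the
    conjugate of [X + s *: Y] for it. Applying [curvS] to such pairs and varying [s] is how
    relations are polarized below. *)
Lemma rotation_orth X Y s : X # Y -> (X + s *: Y) # ((s * g Y) *: X - g X *: Y).
Proof.
move=> XY; have [XY1 XAY AXY YX] := orthw XY; have [_ YAX AYX _] := orthw (AorthC XY).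
split; rewrite ?AD ?AZ !wDl !wDr !NV !wZr !wZl ?wZr ?w0.
  by rewrite XY1 YX; ring.
by rewrite AXY AYX (wA X X) (wA Y Y) -/(g X) -/(g Y); ring.
Qed.

(** * Vanishing of an algebraic curvature tensor from one coefficient *)

Section Acurvature_vanishing.
Variable D : V -> V -> V -> V -> R.
Hypothesis HD : Acurvature D.

Let DDl := curvDl HD.
Let DZl := curvZl HD.
Let DDm := curvDm HD.
Let DZm := curvZm HD.
Let DN := curvN HD.
Let DC := curvC HD.
Let DB := curvB HD.
Let DA := curvA HD.
Let DS := curvS HD.

Let DDr x y z a b : D x y z (a + b) = D x y z a + D x y z b.
Proof. by rewrite DC DDm !(DC _ _ z). Qed.
Let DZr k x y z a : D x y z (k *: a) = k * D x y z a.
Proof. by rewrite DC DZm (DC _ _ z). Qed.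
Let DD2 x a b z t : D x (a + b) z t = D x a z t + D x b z t.
Proof. by rewrite DN DDl opprD -!DN. Qed.
Let DZ2 k x a z t : D x (k *: a) z t = k * D x a z t.
Proof. by rewrite DN DZl -mulrN -DN. Qed.
Let Dxx x z t : D x x z t = 0.
Proof. by have := DN x x z t; lra. Qed.
Let DAA x y z : D x y z (A z) = 0.
Proof. by have := DA x y z z; rewrite (DC _ _ (A z)); lra. Qed.

Let DS1 X Y T : X # Y -> g X != 0 -> g Y != 0 -> X # T -> Y # T -> D X Y X T = 0.
Proof. by move=> XY gX gY XT YT; case: (DS XY gX gY XT YT). Qed.

Let tau_sym X Y : D X Y X (A Y) = D Y X Y (A X).
Proof. by rewrite -[RHS]opprK -DA DC -DN DC. Qed.

(** [curvS] kills [D X Y' X T] for the conjugate pair [Y'], [T] in the span of [Y] and [Z]. It also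
    kills the cross terms of the expansion, so only the two diagonal terms remain, with opposite
    signs. Replacing [T] by [A T] gives the second equality. *)
Lemma tau_const X Y Z : g X != 0 -> g Y != 0 -> g Z != 0 ->
  X # Y -> X # Z -> Y # Z ->
  g Z * D X Y X Y = g Y * D X Z X Z /\
  g Z * D X Y X (A Y) = g Y * D X Z X (A Z).
Proof.
move=> gX gY gZ XY XZ YZ; have [s [s0 gs]] := ex_scale (g Y) gZ.
set Y' := Y + s *: Z; set T := (s * g Z) *: Y - g Y *: Z.
have Y'T : Y' # T := rotation_orth s YZ.
have XY' : X # Y' by apply: AorthDr => //; apply: AorthZr.
have XT : X # T by apply: AorthBr; apply: AorthZr.
have gY' : g Y' != 0 by rewrite gadd ?gscale //; apply: AorthZr.
have YZ0 := DS1 XY gX gY XZ YZ; have ZY0 := DS1 XZ gX gZ XY (AorthC YZ).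
have YAZ0 := DS1 XY gX gY (AorthAr XZ) (AorthAr YZ).
have ZAY0 := DS1 XZ gX gZ (AorthAr XY) (AorthAr (AorthC YZ)).
have E1 := DS1 XY' gX gY' XT Y'T.
have E2 := DS1 XY' gX gY' (AorthAr XT) (AorthAr Y'T).
split; apply: (mulfI s0).
  move: E1; rewrite /Y' /T NV !(DD2, DZ2, DDr, DZr) YZ0 ZY0; lra.
move: E2; rewrite /Y' /T NV !(AD, AZ) !(DD2, DZ2, DDr, DZr) YAZ0 ZAY0; lra.
Qed.

(** Divided by the two values of [g], [D X Y X Y] is the same for neighbouring pairs by [tau_const],
    yet it changes sign when [X] and [Y] are exchanged; going around the triangle [X], [Y], [Z]
    makes it its own opposite. By contrast [D X Y X (A Y)] is symmetric ([tau_sym]): it is the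
    coefficient that carries the scalar factor. *)
Lemma sigma_zero X Y Z : g X != 0 -> g Y != 0 -> g Z != 0 ->
  X # Y -> X # Z -> Y # Z -> D X Y X Y = 0.
Proof.
move=> gX gY gZ XY XZ YZ; apply: (mulfI gZ).
have [E1 _] := tau_const gX gY gZ XY XZ YZ.
have [E2 _] := tau_const gY gX gZ (AorthC XY) YZ XZ.
have [E3 _] := tau_const gZ gX gY (AorthC XZ) (AorthC YZ) XY.
have sw a b : D a b a b = - D b a b a by rewrite DN DC.
move: E2 E3; rewrite (sw Y X) (sw Z X) (sw Z Y); lra.
Qed.

(* The parallelogram law [g (a + b) + g (a - b) = 2 g a + 2 g b]. *)
Let nonnull_shift a b : g a = 0 -> g b != 0 -> g (a + b) != 0 \/ g (a - b) != 0.
Proof.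
move=> ga gb; have [h|] := eqVneq (g (a + b)) 0; last by left.
right; apply: contra_neq gb => h2.
by move: h h2 ga; rewrite /g NV !(AD, AZ) !(wDl, wZl) !(wDr, wZr); lra.
Qed.

(** Once [D X Y1 X (A Y1)] vanishes, [tau_const] and [sigma_zero] leave no component of [D X Y X] in
    the plane of a nonnull [Y], and [curvS] none outside it. The second vector [Y2] serves to reach
    every [Y]. *)
Lemma orth_vanishing X Y1 Y2 : g X != 0 -> g Y1 != 0 -> g Y2 != 0 ->
  X # Y1 -> X # Y2 -> Y1 # Y2 -> D X Y1 X (A Y1) = 0 ->
  forall Y T, X # Y -> X # T -> D X Y X T = 0.
Proof.
move=> gX g1 g2 X1 X2 Y12 t1.
have t2 : D X Y2 X (A Y2) = 0.
  have [_] := tau_const gX g1 g2 X1 X2 Y12; rewrite t1 mulr0 => /esym/eqP.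
  by rewrite mulf_eq0 (negPf g1) => /eqP.
have step Z : g Z != 0 -> X # Z -> D X Z X (A Z) = 0 ->
    forall Y T, g Y != 0 -> Y # Z -> X # Y -> X # T -> D X Y X T = 0.
  move=> gZ XZ tZ Y T gY YZ XY XT.
  have [_] := tau_const gX gY gZ XY XZ YZ; rewrite tZ mulr0 => /eqP.
  rewrite mulf_eq0 (negPf gZ) /= => /eqP tY.
  have sY := sigma_zero gX gY gZ XY XZ YZ.
  have -> : T = Aproj Y T + (T - Aproj Y T) by rewrite addrC subrK.
  have Yt := Aproj_orth T gY; have Xt : X # (T - Aproj Y T).
    by apply: AorthBr => //; apply/AorthC/Aproj_orthr/AorthC.
  by rewrite DDr (DS1 XY gX gY Xt Yt) /Aproj DDr !DZr sY tY; ring.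
(* A null [Y] is reached through [Y + Z'] or [Y - Z'], one of which is nonnull. *)
have step2 Z Z' : g Z != 0 -> g Z' != 0 -> X # Z -> X # Z' -> Z # Z' ->
    D X Z X (A Z) = 0 ->
    forall Y T, Y # Z -> X # Y -> X # T -> D X Y X T = 0.
  move=> gZ gZ' XZ XZ' ZZ' tZ Y T YZ XY XT.
  have [gY|gY] := eqVneq (g Y) 0; last exact: (step Z).
  have h0 : D X Z' X T = 0 by apply: (step Z) => //; apply: AorthC.
  have [h|h] := nonnull_shift gY gZ'.
    have : D X (Y + Z') X T = 0.
      by apply: (step Z) => //; [apply: AorthDl => //; apply: AorthC | apply: AorthDr].
    by rewrite DD2 h0 addr0.
  have : D X (Y - Z') X T = 0.
    apply: (step Z) => //; last exact: AorthBr.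
    by apply/AorthDl=> //; apply/AorthNl/AorthC.
  by rewrite DD2 NV DZ2 h0 mulr0 addr0.
(* The part of [Y] in the plane of [Y1] is orthogonal to [Y2], and the rest is orthogonal to
   [Y1]. *)
move=> Y T XY XT; have -> : Y = Aproj Y1 Y + (Y - Aproj Y1 Y) by rewrite addrC subrK.
have XpY : X # Aproj Y1 Y by apply/AorthC/Aproj_orthr/AorthC.
rewrite DD2 (step2 Y2 Y1 _ _ _ _ _ t2) ?(step2 Y1 Y2 _ _ _ _ _ t1) ?addr0 //.
- by apply/AorthC/Aproj_orth.
- exact: AorthBr.
- exact/AorthC.
- exact: Aproj_orthr.
Qed.

(** [curvS] is applied to [X + k *: Y] and its conjugate for [k = s] and [k = - s]. The difference
    keeps the terms odd in [k]; by [h2], [h3] and [h4] the only one left is a nonzero multiple of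
    [D X Z X X]. *)
Let DXZXX_nonnull X Z : X # Z -> g X != 0 -> g Z != 0 -> D X Z X X = 0.
Proof.
move=> XZ gX gZ; have [Y [gY XY ZY]] := ex_third gX (or_intror gZ) XZ.
have [s [s0 gs]] := ex_scale (g X) gY.
have E k : k ^+ 2 = s ^+ 2 ->
    D (X + k *: Y) Z (X + k *: Y) ((k * g Y) *: X - g X *: Y) = 0.
  move=> kE; apply: DS1 => //.
  - by apply: AorthDl => //; apply: AorthZl; apply: AorthC.
  - by rewrite gadd ?gscale ?kE //; apply: AorthZr.
  - exact: rotation_orth.
  - by apply: AorthBr; apply: AorthZr => //; apply: AorthC.
have h1 := DS1 XZ gX gZ XY ZY; have h2 := DS1 (AorthC ZY) gY gZ (AorthC XY) (AorthC XZ).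
have h3 : D Y Z X Y = 0 by rewrite DC.
have h4 : D X Z Y Y = 0.
  have := DB X Z Y Y; rewrite (DN Z Y) h3 (DC Y X).
  by rewrite (DS1 (AorthC XY) gY gX (AorthC ZY) XZ); lra.
have := E s erefl; have := E (- s) (sqrrN s).
rewrite !NV !(DDl, DZl, DDm, DZm, DDr, DZr) h1 h2 h3 h4 => e1 e2.
by apply: (mulfI gY); apply: (mulfI s0); lra.
Qed.

Let DXZXX X Z : X # Z -> g X != 0 -> D X Z X X = 0.
Proof.
move=> XZ gX; have [gZ|] := eqVneq (g Z) 0; last exact: DXZXX_nonnull.
have X0 : X # 0 by split; rewrite -(scale0r 0) wZr mul0r.
have [Y [gY XY _]] := ex_third gX (or_introl erefl) X0.
have h0 := DXZXX_nonnull XY gX gY.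
have [h|h] := nonnull_shift gZ gY.
  by have := DXZXX_nonnull (AorthDr XZ XY) gX h; rewrite DD2 h0 addr0.
have := DXZXX_nonnull (AorthBr XZ XY) gX h.
by rewrite DD2 NV DZ2 h0 mulr0 addr0.
Qed.

(** The second clause of [curvS] wants [T] orthogonal to an auxiliary vector as well. [T] is split
    along the plane of [Y]: the part in it is handled with [Z], the rest with [Y]. *)
Let DXAXXT X T : X # T -> g X != 0 -> D X (A X) X T = 0.
Proof.
move=> XT gX; have X0 : X # 0 by split; rewrite -(scale0r 0) wZr mul0r.
have [Y [gY XY _]] := ex_third gX (or_introl erefl) X0.
have [Z [gZ XZ YZ]] := ex_third gX (or_intror gY) XY.
have XpT : X # Aproj Y T by apply/AorthC/Aproj_orthr/AorthC.
have -> : T = Aproj Y T + (T - Aproj Y T) by rewrite addrC subrK.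
rewrite DDr.
have [_ ->] := DS XZ gX gZ XpT (AorthC (Aproj_orthr _ YZ)).
by have [_ ->] := DS XY gX gY (AorthBr XT XpT) (Aproj_orth _ gY); rewrite addr0.
Qed.

(** Flatness of [X] follows from one vanishing coefficient ([flatP]) and passes to every nonnull
    vector orthogonal to [X] ([flat_chain], by [tau_sym]); this is how the vanishing spreads. *)
Let flat X := g X != 0 /\ forall Y T, X # Y -> X # T -> D X Y X T = 0.

Let flatP X Y : g X != 0 -> g Y != 0 -> X # Y -> D X Y X (A Y) = 0 -> flat X.
Proof.
move=> gX gY XY t; have [Z [gZ XZ YZ]] := ex_third gX (or_intror gY) XY.
by split=> //; apply: (orth_vanishing gX gY gZ).
Qed.

Let flat_chain X Y : flat X -> X # Y -> g Y != 0 -> flat Y.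
Proof.
move=> [gX fX] XY gY; apply: (flatP gY gX (AorthC XY)).
by rewrite tau_sym; apply: fX => //; apply: AorthAr.
Qed.

Let flat_diag X Y T : flat X -> X # Y -> X # T -> D Y T X X = 0.
Proof.
move=> [gX fX] XY XT; have := DB Y T X X.
rewrite (DN T X) (DC X T) (DC X Y) !fX //; lra.
Qed.

(** Both vectors of a conjugate pair [X'], [T] are flat, so [D X' (A X') T] vanishes on [T] by
    [flat_diag] and on [X'] by [DXAXXT]. [X] is a combination of the two, and the part of the
    resulting relation odd in [k] isolates [D X (A X) X X]. *)
Let DXAXXX X : flat X -> D X (A X) X X = 0.
Proof.
move=> fX; have [gX fX'] := fX; have X0 : X # 0 by split; rewrite -(scale0r 0) wZr mul0r.
have [Y [gY XY _]] := ex_third gX (or_introl erefl) X0.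
have fY := flat_chain fX XY gY; have [_ fY'] := fY; have YX := AorthC XY.
have [Z [gZ XZ YZ]] := ex_third gX (or_intror gY) XY.
have fZ := flat_chain fX XZ gZ.
have [s [s0 gs]] := ex_scale (g X) gY.
have E k : k ^+ 2 = s ^+ 2 ->
    D (X + k *: Y) (A (X + k *: Y)) ((k * g Y) *: X - g X *: Y) X = 0.
  move=> kE; set X' := X + _; set T := _ - _.
  have X'T : X' # T := rotation_orth k XY.
  have gX' : g X' != 0 by rewrite gadd ?gscale ?kE //; apply: AorthZr.
  have gT : g T != 0.
    rewrite /T -scaleNr gadd ?gscale; last by apply/AorthZr/AorthZl.
    have -> : (k * g Y) ^+ 2 * g X + (- g X) ^+ 2 * g Y =
              g X * g Y * (g X + k ^+ 2 * g Y) by ring.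
    by rewrite kE !mulf_neq0.
  have fX1 : flat X'.
    apply: (flat_chain fZ) => //; apply: AorthDr; first exact: AorthC.
    exact/AorthZr/AorthC.
  have fT := flat_chain fX1 X'T gT.
  have E1 := flat_diag fT (AorthC X'T) (AorthAr (AorthC X'T)).
  have E2 := DXAXXT X'T gX'.
  apply: (mulfI gs); rewrite mulr0 -DZr.
  have -> : (g X + s ^+ 2 * g Y) *: X = g X *: X' + k *: T.
    rewrite /X' /T !scalerDr !scalerA !scalerN scalerA -kE.
    by rewrite [g X * k]mulrC addrACA subrr addr0 -scalerDl expr2 mulrA.
  by rewrite DDr !DZr E1 DC E2 !mulr0 addr0.
have h1 := DXAXXT XY gX; have h2 := DXAXXT YX gY.
have h3 := flat_diag fX XY (AorthAr XY).
have h4 : D X (A Y) Y X = 0 by rewrite DC; apply: fX' => //; apply: AorthAr.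
have h5 : D Y (A X) Y X = 0 by apply: fY' => //; apply: AorthAr.
have := E s erefl; have := E (- s) (sqrrN s).
rewrite !(AD, AZ) !NV !(DDl, DZl, DD2, DZ2, DDm, DZm, DDr, DZr).
rewrite (DC X (A X) Y) h1 h2 h3 h4 h5 => e1 e2.
by apply: (mulfI gY); apply: (mulfI s0); lra.
Qed.

Let flat_all X : flat X -> forall Z T, D X Z X T = 0.
Proof.
move=> fX Z T; have [gX fX'] := fX.
have -> : Z = Aproj X Z + (Z - Aproj X Z) by rewrite addrC subrK.
have -> : T = Aproj X T + (T - Aproj X T) by rewrite addrC subrK.
move: (Aproj_orth Z gX) (Aproj_orth T gX); move: (Z - Aproj X Z) (T - Aproj X T) => z t Xz Xt.
rewrite /Aproj !(DD2, DZ2, DDr, DZr) !Dxx !DAA (DXAXXX fX) (DXAXXT Xt gX).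
by rewrite (DXZXX Xz gX) (fX' _ _ Xz Xt); ring.
Qed.

(** The aim is [D x z x t = 0] for all [x]. Then [D] is skew in its first and third arguments, as it
    is in the first two, so the three terms of the Bianchi identity coincide and each is zero. *)
Lemma Acurvature_eq0 X Y Z : g X != 0 -> g Y != 0 -> g Z != 0 ->
  X # Y -> X # Z -> Y # Z -> D X Y X (A Y) = 0 ->
  forall x y z t, D x y z t = 0.
Proof.
move=> gX gY gZ XY XZ YZ tXY.
have fX : flat X by apply: (flatP gX gY).
have fY := flat_chain fX XY gY; have fZ := flat_chain fX XZ gZ.
have Q0 a b x z t : flat a -> flat b -> a # b -> a # x -> D x z x t = 0.
  move=> fa fb ab ax; have [gx|gx] := eqVneq (g x) 0; last first.
    by apply: flat_all; apply: (flat_chain fa).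
  have [gb _] := fb.
  (* As [x] is null, [g (x + k *: b)] is [k] times [2 * w x (A b) + k * g b]; if [k = 1] fails for
     one of the two signs, [k = 2] works for both. *)
  have [k [k1 k2]] : exists k : R, g (x + k *: b) != 0 /\ g (x - k *: b) != 0.
    have gE k : g (x + k *: b) = k * (2 * w x (A b) + k * g b).
      rewrite /g !(AD, AZ) !(wDl, wZl) !(wDr, wZr).
      have -> : w b (A x) = w x (A b) by have := wA b x; have := wC (A b) x; lra.
      by move: gx; rewrite /g => ->; ring.
    have gN k : g (x - k *: b) = k * (- (2 * w x (A b)) + k * g b).
      by rewrite -scaleNr gE; ring.
    have ne1 : (1 : R) != 0 by rewrite oner_eq0.
    have ne2 : (2 : R) != 0 by rewrite pnatr_eq0.
    have [h|h] := boolP ((2 * w x (A b) + g b == 0) || (- (2 * w x (A b)) + g b == 0)).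
      exists 2; rewrite gE gN !mulf_neq0 //; case/orP: h => /eqP h.
      - by apply: contra_neq gb => h'; lra.
      - by apply: contra_neq gb => h'; lra.
      - by apply: contra_neq gb => h'; lra.
      - by apply: contra_neq gb => h'; lra.
    by exists 1; move: h; rewrite negb_or gE gN !mul1r => /andP[].
  have ab' k' : a # (k' *: b) by apply: AorthZr.
  have e1 := flat_all (flat_chain fa (AorthDr ax (ab' k)) k1) z t.
  have e2 := flat_all (flat_chain fa (AorthBr ax (ab' k)) k2) z t.
  have e3 := flat_all fb z t.
  move: e1 e2; rewrite NV !(DDl, DZl, DDm, DZm) e3; lra.
have S0 a b x y z t : flat a -> flat b -> a # b -> a # x -> a # y ->
    D x z y t + D y z x t = 0.
  move=> fa fb ab ax ay; have := Q0 _ _ _ z t fa fb ab (AorthDr ax ay).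
  rewrite !(DDl, DDm) (Q0 _ _ _ _ _ fa fb ab ax) (Q0 _ _ _ _ _ fa fb ab ay); lra.
(* [x] has components in the plane of [X], in the plane of [Y], and a remainder. The first is
   orthogonal to [Y], the sum of the other two to [X]; of the cross terms with the first, one is
   settled by [Z] and one by [Y]. *)
have Qa x z t : D x z x t = 0.
  have -> : x = Aproj X x + (x - Aproj X x) by rewrite addrC subrK.
  have X1 := Aproj_orth x gX; set p := Aproj X x; set r := x - p in X1 *.
  have -> : r = Aproj Y r + (r - Aproj Y r) by rewrite addrC subrK.
  have Y1 := Aproj_orth r gY; set p' := Aproj Y r; set r' := r - p' in Y1 *.
  have Yp : Y # p by apply/AorthC/Aproj_orthr.
  have Zp : Z # p by apply/AorthC/Aproj_orthr.
  have Zp' : Z # p' by apply/AorthC/Aproj_orthr.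
  have Xr : X # (p' + r') by rewrite /r' addrC subrK.
  clearbody r'; clear X1; clearbody r; clearbody p' p.
  have e1 := Q0 _ _ _ z t fY fX (AorthC XY) Yp.
  have e2 := Q0 _ _ _ z t fX fY XY Xr.
  have e3 := S0 _ _ _ _ z t fZ fX (AorthC XZ) Zp Zp'.
  have e4 := S0 _ _ _ _ z t fY fX (AorthC XY) Yp Y1.
  by move: e1 e2 e3 e4; rewrite !(DDl, DDm); lra.
have Sa x y z t : D x z y t + D y z x t = 0.
  by have := Qa (x + y) z t; rewrite !(DDl, DDm) !Qa; lra.
move=> x y z t.
have := DB x y z t; have := Sa x z y t; have := Sa y z x t.
rewrite (DN z y) (DN y x) (DN z x); lra.
Qed.

End Acurvature_vanishing.

Theorem Acurvature_model D : Acurvature D ->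
  exists c, forall x y z t, D x y z t = c * model_curvature x y z t.
Proof.
move=> HD; have [X gX] := ex_nonnull.
have X0 : X # 0 by split; rewrite -(scale0r 0) wZr mul0r.
have [Y [gY XY _]] := ex_third gX (or_introl erefl) X0.
have [Z [gZ XZ YZ]] := ex_third gX (or_intror gY) XY.
(* The model takes the value [g X * g Y] at these arguments, so this is the only possible factor. *)
pose c := D X Y X (A Y) / (g X * g Y); exists c.
have HK := model_Acurvature.
pose D' x y z t := D x y z t - c * model_curvature x y z t.
have HD' : Acurvature D'.
  rewrite /D'; split=> [a b y z t|k a y z t|x y a b t|k x y a t|x y z t|x y z t|x y z t|x y z t|x y T h1 h2 h3 h4 h5].
  - by rewrite (curvDl HD) (curvDl HK); ring.
  - by rewrite (curvZl HD) (curvZl HK); ring.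
  - by rewrite (curvDm HD) (curvDm HK); ring.
  - by rewrite (curvZm HD) (curvZm HK); ring.
  - by rewrite (curvN HD) (curvN HK); ring.
  - by rewrite (curvC HD) (curvC HK); ring.
  - rewrite [LHS](_ : _ = (D x y z t + D y z x t + D z x y t) -
      c * (model_curvature x y z t + model_curvature y z x t + model_curvature z x y t));
      last by rewrite /=; ring.
    by rewrite (curvB HD) (curvB HK) mulr0 subr0.
  - by rewrite (curvA HD) (curvA HK); ring.
  - have [] := curvS HD h1 h2 h3 h4 h5; have [] := curvS HK h1 h2 h3 h4 h5.
    by move=> -> -> -> ->; split; ring.
move=> x y z t; apply/eqP; rewrite -subr_eq0; apply/eqP.
apply: (Acurvature_eq0 HD' gX gY gZ XY XZ YZ).
have [XY1 XAY AXY YX] := orthw XY; have [_ YAX AYX _] := orthw (AorthC XY).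
have gXE : w X (A X) = g X by []. have gYE : w Y (A Y) = g Y by [].
rewrite /D' /model_curvature AA !wZr XY1 YAX w0 YX gXE gYE /c; field.
by rewrite gX gY.
Qed.

End CurvatureAlgebra.

(** * Symplectic linear algebra with matrices *)

Section bil_theory.
Variables (R : realType) (m : nat).
Implicit Types (B : 'M[R]_m) (u v : 'rV[R]_m).

Lemma bilDl B u u' v : bil B (u + u') v = bil B u v + bil B u' v.
Proof. by rewrite /bil !mulmxDl mxE. Qed.
Lemma bilZl B k u v : bil B (k *: u) v = k * bil B u v.
Proof. by rewrite /bil -!scalemxAl mxE. Qed.
Lemma bilDr B u v v' : bil B u (v + v') = bil B u v + bil B u v'.
Proof. by rewrite /bil linearD mulmxDr mxE. Qed.
Lemma bilZr B k u v : bil B u (k *: v) = k * bil B u v.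
Proof. by rewrite /bil linearZ -scalemxAr mxE. Qed.
Lemma bilBl B u u' v : bil B (u - u') v = bil B u v - bil B u' v.
Proof. by rewrite -scaleN1r bilDl bilZl mulN1r. Qed.
Lemma bilBr B u v v' : bil B u (v - v') = bil B u v - bil B u v'.
Proof. by rewrite -scaleN1r bilDr bilZr mulN1r. Qed.

Lemma bil_skew B : (forall u, bil B u u = 0) -> forall u v, bil B u v = - bil B v u.
Proof.
by move=> alt u v; have := alt (u + v); rewrite !(bilDl, bilDr) !alt; lra.
Qed.

End bil_theory.

Section nonnull_vectors.
Variables (R : realType) (m : nat) (B A : 'M[R]_m) (lambda : R).
Hypothesis alt : forall u, bil B u u = 0.
Hypothesis ndg : nondegenerate_on B 1%:M.
Hypothesis AA : A *m A = lambda%:M.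
Hypothesis Asp : forall u v, bil B (u *m A) v + bil B u (v *m A) = 0.
Hypothesis rkA : (3 <= \rank A)%N.
Hypothesis dimm : (5 <= m)%N.

Let f (u : 'rV[R]_m) := u *m A.
Let g u := bil B u (f u).
Local Notation orth := (Aorth (bil B) f).
Let wC := bil_skew alt.
Let fD a b : f (a + b) = f a + f b. Proof. exact: mulmxDl. Qed.
Let fZ k a : f (k *: a) = k *: f a. Proof. by rewrite /f scalemxAl. Qed.
Let ff a : f (f a) = lambda *: a.
Proof. by rewrite /f -mulmxA AA mul_mx_scalar. Qed.
Let wA a b : bil B (f a) b = - bil B a (f b).
Proof. by have := Asp a b; rewrite /f; lra. Qed.
Let gC a b : bil B a (f b) = bil B b (f a).
Proof. by have := wA a b; have := wC (f a) b; lra. Qed.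

Let ndg' u : (forall v, bil B v u = 0) -> u = 0.
Proof.
move=> h; apply: ndg => [|v _]; first exact: submx1.
by rewrite wC h oppr0.
Qed.

Let f0_neq : ~ (forall u, f u = 0).
Proof.
move=> h; have A0 : A = 0.
  by apply/row_matrixP => i; rewrite rowE -[LHS]/(f _) h linear0.
by move: rkA; rewrite A0 mxrank0.
Qed.

(** If [g] vanished identically, so would its polar form [bil B v (f u)], and then [A] itself by
    nondegeneracy. *)
Lemma exists_nonnull : exists X, g X != 0.
Proof.
apply: contrapT => h; have {}h X : g X = 0.
  by apply/eqP; apply: contrapT => h'; apply: h; exists X; apply/negP.
apply: f0_neq => u; apply: ndg' => v.
have := h (v + u); rewrite /g fD !(bilDl, bilDr) (gC u v).
by have := h v; have := h u; rewrite /g; lra.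
Qed.

(** Otherwise [g] vanishes on the orthogonal of the two planes, and [A] is zero there. If
    [lambda = 0], the image of [A] is spanned by [f X] and [f Y], against the rank; if not, the
    orthogonal is zero and four vectors span the space, against the dimension. The case [Y = 0] lets
    the same statement produce a second vector as well as a third. *)
Lemma exists_third_nonnull X Y : g X != 0 -> (Y = 0 \/ g Y != 0) -> orth X Y ->
  exists Z, [/\ g Z != 0, orth X Z & orth Y Z].
Proof.
move=> gX gY XY; apply: contrapT => h.
have {}h Z : orth X Z -> orth Y Z -> g Z = 0.
  move=> XZ YZ; apply/eqP; apply: contrapT => h'; apply: h; exists Z; split=> //.
  exact/negP.
pose p Z T := Aproj (bil B) f Z T.
have [pX pY] : (forall T, orth X (T - p X T)) /\ (forall T, orth Y (T - p Y T)).
  split=> T; first by apply: Aproj_orth => //; [exact: bilDl|exact: bilZl].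
  case: gY => [->|gY]; last by apply: Aproj_orth => //; [exact: bilDl|exact: bilZl].
  have b0 u : bil B 0 u = 0 by rewrite -(scale0r 0) bilZl mul0r.
  by split; rewrite ?b0 // /f mul0mx b0.
have dec T : exists a b c d Z, [/\ T = a *: X + b *: f X + (c *: Y + d *: f Y) + Z,
    orth X Z & orth Y Z].
  exists (- bil B (f X) T / bil B X (f X)), (bil B X T / bil B X (f X)).
  set r := T - p X T.
  exists (- bil B (f Y) r / bil B Y (f Y)), (bil B Y r / bil B Y (f Y)).
  exists (r - p Y r); split; last exact: pY.
    rewrite -[X in X + _ + _]/(p X T) -[X in _ + X + _]/(p Y r) -addrA.
    by rewrite (addrC (p Y r)) subrK /r addrC subrK.
  apply: AorthBr; [exact: bilDl|exact: bilZl|exact: wC|exact: pX|].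
  apply: AorthDr; [exact: bilDl|exact: wC| |]; apply: AorthZr => //; try exact: bilZl.
  by apply: AorthAr => //; exact: bilZl.
(* [f Z] is orthogonal to both planes because [Z] is, and to their orthogonal because the polar form
   of [g] vanishes on it. *)
have h0 Z : orth X Z -> orth Y Z -> f Z = 0.
  move=> XZ YZ; apply: ndg' => T; have [a [b [c [d [Z' [-> XZ' YZ']]]]]] := dec T.
  have [XfZ fXfZ] : orth X (f Z) by apply: (@AorthAr _ _ _ _ lambda) => //; exact: bilZl.
  have [YfZ fYfZ] : orth Y (f Z) by apply: (@AorthAr _ _ _ _ lambda) => //; exact: bilZl.
  rewrite !bilDl !bilZl XfZ fXfZ YfZ fYfZ.
  have := h (Z + Z'); rewrite /g fD !(bilDl, bilDr) -!/(g _) !h // (gC Z Z').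
  have XZZ : orth X (Z + Z') by apply: AorthDr => //; exact: bilDl.
  have YZZ : orth Y (Z + Z') by apply: AorthDr => //; exact: bilDl.
  by move=> /(_ XZZ YZZ); lra.
have [l0|l0] := eqVneq lambda 0.
  suff /mxrankS : (A <= f X + f Y)%MS.
    have := leq_trans (mxrank_adds_leqif (f X) (f Y)) (leq_add (rank_leq_row _) (rank_leq_row _)).
    by move=> h1 h2; have := leq_trans rkA (leq_trans h2 h1).
  apply/row_subP => i; rewrite rowE -/(f _).
  have [a [b [c [d [Z [-> XZ YZ]]]]]] := dec (delta_mx 0 i).
  rewrite !(fD, fZ) !ff l0 !scale0r !scaler0 !addr0 (h0 Z) // addr0.
  by apply: addmx_sub_adds; apply: scalemx_sub.
suff /mxrankS : ((1%:M : 'M[R]_m) <= (X + f X) + (Y + f Y))%MS.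
  rewrite mxrank1 => h1; have := leq_trans dimm h1; apply/negP; rewrite -leqNgt.
  apply: leq_trans (mxrank_adds_leqif _ _) _; rewrite -[4%N]/(2 + 2)%N.
  by apply: leq_add; apply: leq_trans (mxrank_adds_leqif _ _) _;
     rewrite -[2%N]/(1 + 1)%N; apply: leq_add; apply: rank_leq_row.
apply/row_subP => i; have [a [b [c [d [Z [-> XZ YZ]]]]]] := dec (row i 1%:M).
have -> : Z = 0.
  by apply: (scalerI l0); rewrite scaler0 -ff (h0 Z) // /f mul0mx.
rewrite addr0; apply: addmx_sub_adds; apply: addmx_sub_adds; exact: scalemx_sub.
Qed.

End nonnull_vectors.

(** * Differential calculus on spaces of matrices *)

Section directional.
Variables (R : realType) (V W : normedModType R).
Implicit Types (f : V -> W) (x v : V).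

Lemma derive_line f x v t :
  'D_1 (fun h : R => f (h *: v + x)) t = 'D_v f (t *: v + x).
Proof.
rewrite /derive; set p := (fun h => _); set q := (fun h : R => _).
suff -> : p = q by []; apply/funext => h; rewrite /p /q /=.
by rewrite [h%:A]mulr1 scalerDl addrA.
Qed.

Lemma derivable_line f x v t :
  derivable (fun h : R => f (h *: v + x)) t 1 <-> derivable f (t *: v + x) v.
Proof.
rewrite /derivable; set p := (fun h => _); set q := (fun h : R => _).
suff -> : p = q by []; apply/funext => h; rewrite /p /q /=.
by rewrite [h%:A]mulr1 scalerDl addrA.
Qed.

(** Homogeneity in the direction needs only derivability along the line, by reparametrizing it; it
    is used where full differentiability is not yet available. *)
Lemma is_derive_scale f x v k : derivable f x v ->
  is_derive x (k *: v) f (k *: 'D_v f x).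
Proof.
move=> df; pose p h := f (h *: v + x).
have dp : derivable p (k * 0) 1 by apply/derivable_line; rewrite mulr0 scale0r add0r.
have e0 : (fun h : R => f (h *: (k *: v) + x)) = p \o ( *%R k).
  by apply/funext => h; rewrite /p /= scalerA mulrC.
have d1 : differentiable ( *%R k) (0 : R) by apply/derivable1_diffP; exact: derivableM.
move/derivable1_diffP: dp => dp.
have d2 : differentiable (p \o ( *%R k)) 0 by exact: differentiable_comp.
split.
  have -> : x = 0 *: (k *: v) + x by rewrite scale0r add0r.
  by apply/derivable_line; rewrite e0; apply/derivable1_diffP.
have -> : 'D_(k *: v) f x = 'D_1 (p \o ( *%R k)) 0.
  by rewrite -e0 derive_line scale0r add0r.
rewrite deriveE // diff_comp //= -!deriveE //.
have -> : 'D_1 ( *%R k) 0 = k.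
  by rewrite (_ : *%R k = (fun h => k * h)) // deriveMl // derive_id mulr1.
rewrite deriveE // -[X in 'd p _ X](mulr1 k) linearZ -deriveE //.
by rewrite derive_line mulr0 scale0r add0r.
Qed.

End directional.

Lemma MVT_line (R : realType) (V : normedModType R) (f : V -> R) (a v : V) :
  (forall t, 0 <= t <= 1 -> derivable f (t *: v + a) v) ->
  exists2 t, 0 <= t <= 1 & f (v + a) - f a = 'D_v f (t *: v + a).
Proof.
move=> df; pose p (t : R) := f (t *: v + a).
have [|//|t] := @MVT_segment R p (fun t => 'D_v f (t *: v + a)) 0 1 ler01.
- move=> t; rewrite in_itv /= => /andP[t0 t1]; split.
    by apply/derivable_line; apply: df; rewrite !ltW.
  by rewrite derive_line.
- apply: derivable_within_continuous => t; rewrite in_itv /= => tt.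
  by apply/derivable_line; apply: df.
- rewrite in_itv /= => tt; rewrite /p scale1r scale0r add0r subr0 mulr1 => e.
  by exists t.
Qed.

Section matrix_norm.
Variables (R : realType) (p q : nat).

Lemma normr_coord_le (M : 'M[R]_(p, q)) i j : `|M i j| <= `|M|.
Proof. by rewrite [leRHS]/Num.norm /= mx_normrE (le_bigmax _ _ (i, j)). Qed.

Lemma normr_mx_le (M : 'M[R]_(p, q)) c :
  0 <= c -> (forall i j, `|M i j| <= c) -> `|M| <= c.
Proof.
by move=> c0 h; rewrite [leLHS]/Num.norm /= mx_normrE; apply: bigmax_le.
Qed.

Lemma linear_mx_differentiable (W : normedModType R)
  (f : {linear 'M[R]_(p, q) -> W}) M : differentiable f M.
Proof.
pose F := \sum_(i < p) \sum_(j < q) (fun N : 'M[R]_(p, q) => N i j *: f (delta_mx i j)).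
have -> : (f : 'M_(p, q) -> W) = F.
  apply/funext => N; rewrite /F [in LHS](matrix_sum_delta N) linear_sum fct_sumE.
  apply: eq_bigr => i _; rewrite linear_sum fct_sumE; apply: eq_bigr => j _.
  by rewrite linearZ.
apply: differentiable_sum => i; apply: differentiable_sum => j.
by apply: differentiableZl; exact: differentiable_coord.
Qed.

Lemma linear_mx_continuous (W : normedModType R)
  (f : {linear 'M[R]_(p, q) -> W}) : continuous f.
Proof. by move=> M; apply/differentiable_continuous/linear_mx_differentiable. Qed.

End matrix_norm.

Section differentiable_eps.
Variables (R : realType) (V W : normedModType R).

Lemma is_diff_intro (f : V -> W) (df : {linear V -> W}) x : continuous df ->
  (forall e : R, 0 < e -> \forall h \near (0 : V),
     `|f (h + x) - f x - df h| <= e * `|h|) ->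
  differentiable f x /\ 'd f x = df :> (V -> W).
Proof.
move=> cdf h.
have E : f \o shift x = cst (f x) + df +o_ (0 : V) id.
  apply/eqaddoP => e e0; near=> y; rewrite /= !fctE opprD addrA.
  by near: y; exact: h.
have dE := diff_unique cdf E.
by split=> //; apply/diff_locallyP; rewrite dE.
Unshelve. all: by end_near. Qed.

Lemma differentiable_eps (f : V -> W) x : differentiable f x ->
  forall e : R, 0 < e -> \forall h \near (0 : V),
     `|f (h + x) - f x - 'D_h f x| <= e * `|h|.
Proof.
move=> df e e0; have /eqaddoP /(_ e e0) := diff_locally df.
apply: filterS => y; rewrite /= !fctE opprD addrA deriveE //.
Qed.

End differentiable_eps.

(** * Continuous directional derivatives imply differentiability *)

Section C1.
Variables (R : realType) (m : nat).
Local Notation E := 'rV[R]_m.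

Let trunc (h : E) (k : nat) : E := \row_j (if (j < k)%N then h 0 j else 0).

Let truncS h (k : 'I_m) : trunc h k.+1 = h 0 k *: delta_mx 0 k + trunc h k.
Proof.
apply/rowP => j; rewrite !mxE eqxx /= ltnS leq_eqVlt.
have [->|jk] := eqVneq j k; first by rewrite eqxx ltnn mulr1 addr0.
by rewrite mulr0 add0r (negPf (_ : (j : nat) != k)).
Qed.

Let trunc0 h : trunc h 0 = 0.
Proof. by apply/rowP => j; rewrite !mxE ltn0. Qed.

Let truncm h : trunc h m = h.
Proof. by apply/rowP => j; rewrite !mxE ltn_ord. Qed.

Let trunc_le (h : E) (t : R) (j : 'I_m) : 0 <= t <= 1 ->
  `|t *: (h 0 j *: delta_mx 0 j) + trunc h j| <= `|h|.
Proof.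
move=> /andP[t0 t1]; apply: normr_mx_le => // i l; rewrite (ord1 i) !mxE eqxx /=.
have [->|lj] := eqVneq l j.
  rewrite ltnn addr0 mulr1 normrM ger0_norm // (le_trans _ (normr_coord_le h 0 j)) //.
  by rewrite ler_piMl.
rewrite !mulr0 add0r; case: ifP => _; first exact: normr_coord_le.
by rewrite normr0.
Qed.

(** The increment telescopes along the edges [trunc h j], each parallel to an axis, where the mean
    value theorem applies. In the sup norm no point of an edge is farther from the origin than
    [h]. *)
Lemma C1_differentiable (f : E -> R) x :
  (\forall y \near x, forall v, derivable f y v) ->
  (forall v, {for x, continuous (fun y => 'D_v f y)}) ->
  differentiable f x.
Proof.
move=> df cf; pose a j := 'D_(delta_mx 0 j) f x.
pose L0 (h : E) := \sum_j h 0 j * a j.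
have linL : linear L0.
  move=> k u v; rewrite /L0 scaler_sumr -big_split; apply: eq_bigr => j _.
  by rewrite !mxE mulrDl -mulrA.
pose LM := GRing.isLinear.Build _ _ _ _ L0 linL.
pose L : {linear E -> R} := HB.pack L0 LM.
suff : differentiable f x /\ 'd f x = L :> (E -> R) by case.
apply: is_diff_intro; first exact: linear_mx_continuous.
(* One share of the error per coordinate; [m.+1] avoids dividing by zero when [m = 0]. *)
move=> e e0; pose e' := e / m.+1%:R.
have e'0 : 0 < e' by rewrite divr_gt0.
have near0 : \forall y \near x, (forall v, derivable f y v) /\
    forall j : 'I_m, `|a j - 'D_(delta_mx 0 j) f y| <= e'.
  near=> y; split; first by near: y.
  near: y; apply: filter_forall => j /=.
  by move/cvgrPdist_le: (cf (delta_mx 0 j)) => /(_ e' e'0).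
have [r /= r0 hr] := (@nbhs_ballP _ _ _ _).1 near0.
apply/nbhs_ballP; exists r => //= h; rewrite -ball_normE /ball_ /= sub0r normrN => hr'.
have inb y : `|y| <= `|h| -> (forall v, derivable f (y + x) v) /\
    forall j : 'I_m, `|a j - 'D_(delta_mx 0 j) f (y + x)| <= e'.
  move=> yh; apply: hr; rewrite -ball_normE /ball_ /= opprD addrC subrK normrN.
  exact: le_lt_trans hr'.
have -> : f (h + x) - f x = \sum_(j < m) (f (trunc h j.+1 + x) - f (trunc h j + x)).
  rewrite -(big_mkord xpredT (fun j => f (trunc h j.+1 + x) - f (trunc h j + x))).
  by rewrite (telescope_sumr (fun j => f (trunc h j + x))) // truncm trunc0 add0r.
rewrite /= /L0 -sumrB (le_trans (ler_norm_sum _ _ _)) //.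
apply: (@le_trans _ _ (\sum_(j < m) (e' * `|h|))); last first.
  rewrite sumr_const card_ord -mulr_natl mulrA ler_wpM2r // /e' mulrCA ler_piMr //.
    exact: ltW.
  by rewrite ler_pdivrMr // mul1r ler_nat.
apply: ler_sum => j _; rewrite truncS -(addrA (h 0 j *: _)).
have [|t tt ->] := @MVT_line R _ f (trunc h j + x) (h 0 j *: delta_mx 0 j).
  move=> t tt; rewrite addrA; apply: (inb _ _).1; exact: trunc_le.
rewrite addrA; have [dd ee] := inb _ (trunc_le h j tt).
have [_ ->] := is_derive_scale (h 0 j) (dd (delta_mx 0 j)).
rewrite -[_ *: _]/(_ * _) -mulrBr normrM mulrC distrC ler_pM //.
exact: normr_coord_le.
Unshelve. all: by end_near. Qed.

End C1.

Section matrix_valued.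
Variables (R : realType) (V : normedModType R) (p q : nat).
Implicit Types (f g : V -> 'M[R]_(p, q)) (x v : V).

Lemma derive_mxE f x v i j : derivable f x v ->
  'D_v (fun y => f y i j) x = 'D_v f x i j.
Proof. by move=> df; rewrite derive_mx // mxE. Qed.

Lemma is_derive_scale_mx (a : V -> R) g x v :
  derivable a x v -> derivable g x v ->
  is_derive x v (fun y => a y *: g y) ('D_v a x *: g x + a x *: 'D_v g x).
Proof.
move=> da dg; have dij i j : derivable (fun y => g y i j) x v.
  by move: i j; apply/derivable_mxP.
have e i j : (fun y => (a y *: g y) i j) = a * (fun y => g y i j).
  by apply/funext => y; rewrite !mxE.
have d : derivable (fun y => a y *: g y) x v.
  by apply/derivable_mxP => i j; rewrite e; apply: derivableM.
split=> //; apply/matrixP => i j; rewrite -derive_mxE // e deriveM // derive_mxE // !mxE.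
by rewrite -![_ *: _]/(_ * _); ring.
Qed.

Lemma differentiable_mx f x :
  (forall i j, differentiable (fun y => f y i j) x) -> differentiable f x.
Proof.
move=> df; pose F := \sum_(i < p) \sum_(j < q) (fun y => f y i j *: (delta_mx i j : 'M[R]_(p, q))).
have -> : f = F.
  apply/funext => y; rewrite /F [LHS]matrix_sum_delta fct_sumE.
  by apply: eq_bigr => i _; rewrite fct_sumE.
apply: differentiable_sum => i; apply: differentiable_sum => j.
exact: differentiableZl.
Qed.

Lemma continuous_mx f x :
  (forall i j, {for x, continuous (fun y => f y i j)}) -> {for x, continuous f}.
Proof.
move=> cf; apply/cvgrPdist_le => e e0; near=> y.
apply: normr_mx_le => [|i j]; first exact: ltW.
rewrite !mxE; move: i j; near: y.
apply: filter_forall => i; apply: filter_forall => j.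
by move/cvgrPdist_le: (cf i j); apply.
Unshelve. all: by end_near. Qed.

Lemma continuous_mx_coord f x i j :
  {for x, continuous f} -> {for x, continuous (fun y => f y i j)}.
Proof.
move=> cf; apply: (@continuous_comp _ _ _ f (fun M : 'M[R]_(p, q) => M i j)) => //.
exact: coord_continuous.
Qed.

End matrix_valued.

Lemma derive_linear (R : realType) (V W : normedModType R) (f : V -> W) x :
  differentiable f x -> linear (fun v => 'D_v f x).
Proof. by move=> df k u v; rewrite !deriveE // linearP. Qed.

Lemma derive_chain (R : realType) (U V W : normedModType R) (f : U -> V) (g : V -> W)
  x v : differentiable f x -> differentiable g (f x) ->
  'D_v (g \o f) x = 'D_('D_v f x) g (f x).
Proof.
move=> df dg; rewrite !deriveE //; last exact: differentiable_comp.
by rewrite diff_comp.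
Qed.

Lemma near_eq_continuous (T U : topologicalType) (f g : T -> U) x :
  {near x, f =1 g} -> {for x, continuous f} -> {for x, continuous g}.
Proof.
move=> fg cf; have fgx := nbhs_singleton fg; rewrite /prop_for /continuous_at -fgx.
by apply: cvg_trans cf; apply: near_eq_cvg.
Qed.

(** * Functions of class C^k and symmetry of second derivatives *)

Section Ck_theory.
Variables (R : realType) (m : nat).
Local Notation E := 'rV[R]_m.

Lemma Ck_ext (W : normedModType R) k (U : set E) (f g : E -> W) : open U ->
  (forall x, U x -> f x = g x) -> Ck_on k U f -> Ck_on k U g.
Proof.
move=> oU; elim: k f g => [|k IH] f g fg [cf df].
  split=> // x Ux; have nfg : {near x, f =1 g}.
    by near=> y; apply: fg; near: y; exact: open_nbhs_nbhs.
  exact: near_eq_continuous nfg (cf x Ux).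
have nfg x : U x -> {near x, f =1 g}.
  by move=> Ux; near=> y; apply: fg; near: y; exact: open_nbhs_nbhs.
split=> [x Ux|v]; first exact: near_eq_continuous (nfg x Ux) (cf x Ux).
have [d1 d2] := df v; split=> [x Ux|].
  exact: near_eq_derivable (nfg x Ux) (d1 x Ux).
by apply: IH d2 => x Ux; apply: near_eq_derive; exact: nfg.
Unshelve. all: by end_near. Qed.

Lemma Ck_onW (W : normedModType R) k (U : set E) (f : E -> W) :
  Ck_on k.+1 U f -> Ck_on k U f.
Proof.
elim: k f => [|k IH] f [cf df]; first by [].
by split=> // v; have [d1 d2] := df v; split=> //; exact: IH.
Qed.

Lemma Ck_onP (W : normedModType R) k (U : set E) (f : E -> W) :
  Ck_on k U f -> forall x, U x -> {for x, continuous f}.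
Proof. by case: k => [|k] []. Qed.

Lemma Ck_on_mxP k (U : set E) p q (f : E -> 'M[R]_(p, q)) : open U ->
  Ck_on k U f <-> forall i j, Ck_on k U (fun x => f x i j).
Proof.
move=> oU; elim: k f => [|k IH] f; split.
- by move=> [cf _] i j; split=> // x Ux; apply: continuous_mx_coord; exact: cf.
- move=> h; split=> // x Ux; apply: continuous_mx => i j.
  by have [cf _] := h i j; exact: cf.
- move=> [cf df] i j; split=> [x Ux|v].
    by apply: continuous_mx_coord; exact: cf.
  have [d1 d2] := df v; split=> [x Ux|].
    by move: (d1 x Ux) => /derivable_mxP; exact.
  apply: (@Ck_ext _ _ _ (fun x => 'D_v f x i j)) => // [x Ux|].
    by rewrite derive_mxE //; exact: d1.
  by move/IH: d2.
- move=> h; split=> [x Ux|v].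
    by apply: continuous_mx => i j; have [cf _] := h i j; exact: cf.
  have d1 x : U x -> derivable f x v.
    by move=> Ux; apply/derivable_mxP => i j; have [_ /(_ v)[+ _]] := h i j; exact.
  split=> //; apply/IH => i j; have [_ /(_ v)[_ d2]] := h i j.
  by apply: Ck_ext d2 => // x Ux; rewrite derive_mxE //; exact: d1.
Qed.

Lemma Ck_cst (W : normedModType R) k (U : set E) (c : W) : Ck_on k U (fun=> c).
Proof.
elim: k c => [|k IH] c; split=> //; try by move=> *; exact: cst_continuous.
move=> v; split=> [x _|]; first exact: derivable_cst.
suff -> : (fun x => 'D_v (fun=> c) x) = (fun=> 0 : W) by [].
by apply/funext => x; exact: derive_cst.
Qed.

Lemma Ck_add (W : normedModType R) k (U : set E) (f g : E -> W) : open U ->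
  Ck_on k U f -> Ck_on k U g -> Ck_on k U (fun x => f x + g x).
Proof.
move=> oU; elim: k f g => [|k IH] f g [cf df] [cg dg].
  by split=> // x Ux; apply: continuousD; [exact: cf|exact: cg].
split=> [x Ux|v]; first by apply: continuousD; [exact: cf|exact: cg].
have [f1 f2] := df v; have [g1 g2] := dg v; split=> [x Ux|].
  by apply: derivableD; [exact: f1|exact: g1].
apply: (@Ck_ext _ _ _ (fun x => 'D_v f x + 'D_v g x)) => // [x Ux|]; last exact: IH.
by rewrite -deriveD //; [exact: f1|exact: g1].
Qed.

Lemma Ck_mul k (U : set E) (f g : E -> R) : open U ->
  Ck_on k U f -> Ck_on k U g -> Ck_on k U (fun x => f x * g x).
Proof.
move=> oU; elim: k f g => [|k IH] f g hf hg.
  have [cf _] := hf; have [cg _] := hg.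
  by split=> // x Ux; apply: continuousM; [exact: cf|exact: cg].
have [cf df] := hf; have [cg dg] := hg.
split=> [x Ux|v]; first by apply: continuousM; [exact: cf|exact: cg].
have [f1 f2] := df v; have [g1 g2] := dg v; split=> [x Ux|].
  by apply: derivableM; [exact: f1|exact: g1].
apply: (@Ck_ext _ _ _ (fun x => f x * 'D_v g x + g x * 'D_v f x)) => // [x Ux|].
  by rewrite -[RHS]/('D_v (f * g) x) deriveM //; [exact: f1|exact: g1].
by apply: Ck_add => //; apply: IH => //; exact: Ck_onW.
Qed.

Lemma Ck_scale_mx k (U : set E) p q (a : E -> R) (f : E -> 'M[R]_(p, q)) : open U ->
  Ck_on k U a -> Ck_on k U f -> Ck_on k U (fun x => a x *: f x).
Proof.
move=> oU ha hf; apply/Ck_on_mxP => // i j.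
apply: (@Ck_ext _ _ _ (fun x => a x * f x i j)) => // [x _|]; first by rewrite mxE.
by apply: Ck_mul => //; move/Ck_on_mxP: hf; exact.
Qed.

Lemma Ck_sum (W : normedModType R) k (U : set E) (I : Type) (r : seq I) (P : pred I)
  (f : I -> E -> W) : open U ->
  (forall i, P i -> Ck_on k U (f i)) -> Ck_on k U (fun x => \sum_(i <- r | P i) f i x).
Proof.
move=> oU h; elim: r => [|i r IH].
  by apply: (@Ck_ext _ _ _ (fun=> 0)) => // [x _|]; [rewrite big_nil|exact: Ck_cst].
case Pi : (P i).
  apply: (@Ck_ext _ _ _ (fun x => f i x + \sum_(i <- r | P i) f i x)) => // [x _|].
    by rewrite big_cons Pi.
  by apply: Ck_add => //; exact: h.
by apply: Ck_ext IH => // x _; rewrite big_cons Pi.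
Qed.

(** [Ck_on] only mentions directional derivatives; differentiability is what gives their additivity
    in the direction and the chain rule. *)
Lemma Ck_differentiableR (U : set E) (f : E -> R) x : open U ->
  Ck_on 1 U f -> U x -> differentiable f x.
Proof.
move=> oU [cf df] Ux; apply: C1_differentiable.
  by near=> y => v; apply: (df v).1; near: y; exact: open_nbhs_nbhs.
by move=> v; have [_ [h2 _]] := df v; exact: h2.
Unshelve. all: by end_near. Qed.

Lemma Ck_differentiable (U : set E) p q (f : E -> 'M[R]_(p, q)) x : open U ->
  Ck_on 1 U f -> U x -> differentiable f x.
Proof.
move=> oU /Ck_on_mxP -/(_ oU) h Ux; apply: differentiable_mx => i j.
exact: (Ck_differentiableR oU (h i j)).
Qed.

Lemma derive_delta (W : normedModType R) (f : E -> W) x h : differentiable f x ->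
  'D_h f x = \sum_i h 0 i *: 'D_(delta_mx 0 i) f x.
Proof.
move=> df; rewrite deriveE // {1}(row_sum_delta h) linear_sum.
by apply: eq_bigr => i _; rewrite linearZ deriveE.
Qed.

(** The mean value theorem is applied along [u] to a difference of two values of [f], then along [v]
    to ['D_u f]. The intermediate point stays in the ball where the mixed derivative is within [e]
    of its value at [x]. *)
Let second_difference (U : set E) (f : E -> R) x u v : open U -> Ck_on 2 U f -> U x ->
  forall e, 0 < e -> exists2 d : R, 0 < d & forall t, 0 < t < d ->
    `|f (t *: u + (t *: v + x)) - f (t *: u + x) - f (t *: v + x) + f x
      - t ^+ 2 * 'D_v (fun y => 'D_u f y) x| <= e * t ^+ 2.
Proof.
move=> oU hf Ux e e0; have [cf df] := hf; have [du [cdu ddu]] := df u.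
have [dvu [cvu _]] := ddu v.
have near0 : \forall y \near x, U y /\
    `|'D_v (fun y => 'D_u f y) x - 'D_v (fun y => 'D_u f y) y| <= e.
  apply: filterI; first exact: open_nbhs_nbhs.
  by move/cvgrPdist_le: (cvu x Ux); exact.
have [r /= r0 hr] := (@nbhs_ballP _ _ _ _).1 near0.
have n0 : 0 < `|u| + `|v| + 1 by rewrite ltr_wpDl // addr_ge0.
exists (r / (`|u| + `|v| + 1)); first by rewrite divr_gt0.
move=> t /andP[t0 td].
have inb (a b : R) : 0 <= a <= 1 -> 0 <= b <= 1 ->
    U (a *: (t *: u) + (b *: (t *: v) + x)) /\
    `|'D_v (fun y => 'D_u f y) x
      - 'D_v (fun y => 'D_u f y) (a *: (t *: u) + (b *: (t *: v) + x))| <= e.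
  move=> /andP[a0 a1] /andP[b0 b1]; apply: hr; rewrite -ball_normE /ball_ /=.
  rewrite addrA opprD addrCA subrr addr0 normrN.
  apply: (@le_lt_trans _ _ (t * (`|u| + `|v| + 1))); last by rewrite -ltr_pdivlMr.
  rewrite (le_trans (ler_normD _ _)) // !normrZ (ger0_norm a0) (ger0_norm b0) (gtr0_norm t0).
  rewrite -addrA 2!mulrDr; apply: lerD; first by rewrite ler_piMl // mulr_ge0 // ltW.
  rewrite -[leLHS]addr0 lerD //; first by rewrite ler_piMl // mulr_ge0 // ltW.
  by rewrite mulr1 ltW.
have I01 : 0 <= (1 : R) <= 1 by rewrite ler01 lexx.
have I00 : 0 <= (0 : R) <= 1 by rewrite ler01 lexx.
pose p (s : R) := f (s *: (t *: u) + (t *: v + x)) - f (s *: (t *: u) + x).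
pose dp (s : R) := t * ('D_u f (s *: (t *: u) + (t *: v + x)) - 'D_u f (s *: (t *: u) + x)).
have ip (s : R) : 0 <= s <= 1 -> is_derive s 1 p (dp s).
  move=> s01.
  have [Us1 _] := inb s 1 s01 I01; have [Us0 _] := inb s 0 s01 I00.
  rewrite scale1r in Us1; rewrite scale0r add0r in Us0.
  have [d1 e1] := is_derive_scale t (du _ Us1); have [d0 e2] := is_derive_scale t (du _ Us0).
  have D1 := (derivable_line f _ _ _).2 d1; have D0 := (derivable_line f _ _ _).2 d0.
  split; first exact: derivableB.
  by rewrite (deriveB D1 D0) !derive_line e1 e2 -mulrBr.
have [| |s] := @MVT_segment R p dp 0 1 ler01.
- by move=> s; rewrite in_itv /= => /andP[s0 s1]; apply: ip; rewrite !ltW.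
- apply: derivable_within_continuous => s; rewrite in_itv /= => s01.
  by have [] := ip s s01.
rewrite in_itv /= subr0 mulr1 => s01 E1.
have [|s' s'01 E2] := @MVT_line R _ (fun y => 'D_u f y) (s *: (t *: u) + x) (t *: v).
  move=> s' s'01; have [Us _] := inb s s' s01 s'01.
  have [d1 _] := is_derive_scale t (dvu _ Us).
  by rewrite addrCA.
have [Us close] := inb s s' s01 s'01.
have [_ e3] := is_derive_scale t (dvu _ Us).
move: E1; rewrite /p /dp !scale1r !scale0r !add0r => E1.
have -> : f (t *: u + (t *: v + x)) - f (t *: u + x) - f (t *: v + x) + f x =
    t * (t * 'D_v (fun y => 'D_u f y) (s *: (t *: u) + (s' *: (t *: v) + x))).
  rewrite -[t * 'D_v _ _]/(t *: 'D_v _ _) -e3 -(addrCA (s' *: (t *: v))) -E2 (addrCA (t *: v)) -E1.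
  by have <- : forall a b c d : R, a - b - c + d = a - b - (c - d) by move=> *; ring.
rewrite mulrA -expr2 -mulrBr normrM distrC mulrC ler_pM //.
by rewrite ger0_norm // sqr_ge0.
Qed.

(** The second difference over the parallelogram of sides [t *: u] and [t *: v] is symmetric in [u]
    and [v], and approximates [t ^+ 2] times either mixed derivative. *)
Lemma schwarzR (U : set E) (f : E -> R) x u v : open U -> Ck_on 2 U f -> U x ->
  'D_u (fun y => 'D_v f y) x = 'D_v (fun y => 'D_u f y) x.
Proof.
move=> oU hf Ux; apply/eqP; rewrite -subr_eq0 -normr_le0; apply/ler_addgt0Pr => e e0.
have e20 : 0 < e / 2 by rewrite divr_gt0.
have [d d0 hd] := second_difference v u oU hf Ux e20.
have [d' d'0 hd'] := second_difference u v oU hf Ux e20.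
pose t := Num.min d d' / 2.
have t0 : 0 < t by rewrite divr_gt0 // lt_min d0 d'0.
have tm : t < Num.min d d' by rewrite ltr_pdivrMr // ltr_pMr ?ltr1n // lt_min d0 d'0.
have /hd h1 : 0 < t < d by rewrite t0 (lt_le_trans tm) // ge_min lexx.
have /hd' h2 : 0 < t < d' by rewrite t0 (lt_le_trans tm) // ge_min lexx orbT.
rewrite add0r -(ler_pM2r (exprn_gt0 2 t0)) -[t ^+ 2 in leLHS]gtr0_norm ?exprn_gt0 // -normrM.
apply: le_trans (le_trans (lerD h2 h1) _); last by rewrite -mulrDl -splitr.
apply: le_trans (ler_normB _ _); rewrite le_eqVlt; apply/orP; left; apply/eqP.
rewrite (addrCA (t *: v) (t *: u) x); congr (`| _ |).
have -> : forall a b c d p q : R, (a - c - b + d - p) - (a - b - c + d - q) = q - p.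
  by move=> *; ring.
by rewrite -mulrBr mulrC.
Qed.

End Ck_theory.

Section smooth_theory.
Variables (R : realType) (m : nat) (U : set 'rV[R]_m).
Hypothesis oU : open U.
Local Notation E := 'rV[R]_m.

Lemma smooth_derive (W : normedModType R) (f : E -> W) v :
  smooth_on U f -> smooth_on U (fun x => 'D_v f x).
Proof. by move=> sf k; have [_ /(_ v)[_]] := sf k.+1. Qed.

Lemma smooth_derivable (W : normedModType R) (f : E -> W) v x :
  smooth_on U f -> U x -> derivable f x v.
Proof. by move=> sf Ux; have [_ /(_ v)[+ _]] := sf 1%N; exact. Qed.

Lemma smooth_continuous (W : normedModType R) (f : E -> W) x :
  smooth_on U f -> U x -> {for x, continuous f}.
Proof. by move=> sf; exact: (Ck_onP (sf 0%N)). Qed.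

Lemma smooth_ext (W : normedModType R) (f g : E -> W) :
  (forall x, U x -> f x = g x) -> smooth_on U f -> smooth_on U g.
Proof. by move=> fg sf k; apply: Ck_ext fg _. Qed.

Lemma smooth_cst (W : normedModType R) (c : W) : smooth_on U (fun=> c).
Proof. by move=> k; exact: Ck_cst. Qed.

Lemma smooth_add (W : normedModType R) (f g : E -> W) :
  smooth_on U f -> smooth_on U g -> smooth_on U (fun x => f x + g x).
Proof. by move=> sf sg k; exact: Ck_add. Qed.

Lemma smooth_mul (f g : E -> R) :
  smooth_on U f -> smooth_on U g -> smooth_on U (fun x => f x * g x).
Proof. by move=> sf sg k; exact: Ck_mul. Qed.

Lemma smooth_sum (W : normedModType R) (I : Type) (r : seq I) (P : pred I)
  (f : I -> E -> W) :
  (forall i, P i -> smooth_on U (f i)) -> smooth_on U (fun x => \sum_(i <- r | P i) f i x).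
Proof. by move=> sf k; apply: Ck_sum => // i Pi; exact: sf. Qed.

Section mx.
Variables p q : nat.
Implicit Type f : E -> 'M[R]_(p, q).

Lemma smooth_scale (a : E -> R) f :
  smooth_on U a -> smooth_on U f -> smooth_on U (fun x => a x *: f x).
Proof. by move=> sa sf k; exact: Ck_scale_mx. Qed.

Lemma smooth_mxP f : smooth_on U f <-> forall i j, smooth_on U (fun x => f x i j).
Proof.
split=> [sf i j k|sf k]; last by apply/Ck_on_mxP => // i j; exact: sf.
by move/Ck_on_mxP: (sf k); exact.
Qed.

Lemma smooth_differentiable f x : smooth_on U f -> U x -> differentiable f x.
Proof. by move=> sf; exact: (Ck_differentiable oU (sf 1%N)). Qed.

Lemma smooth_differentiableR (f : E -> R) x : smooth_on U f -> U x -> differentiable f x.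
Proof. by move=> sf; exact: (Ck_differentiableR oU (sf 1%N)). Qed.

Lemma smooth_schwarzR (f : E -> R) x u v : smooth_on U f -> U x ->
  'D_u (fun y => 'D_v f y) x = 'D_v (fun y => 'D_u f y) x.
Proof. by move=> sf; exact: (schwarzR _ _ oU (sf 2%N)). Qed.

Lemma smooth_schwarz f x u v : smooth_on U f -> U x ->
  'D_u (fun y => 'D_v f y) x = 'D_v (fun y => 'D_u f y) x.
Proof.
move=> sf Ux; apply/matrixP => i j.
have h a b : 'D_a (fun y => 'D_b f y) x i j = 'D_a (fun y => 'D_b (fun z => f z i j) y) x.
  rewrite -derive_mxE; last exact: smooth_derivable (smooth_derive _ sf) Ux.
  apply: near_eq_derive; near=> y; rewrite derive_mxE //; apply: smooth_derivable => //.
  by near: y; exact: open_nbhs_nbhs.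
have sij : smooth_on U (fun z => f z i j) by move: i j {h}; apply/smooth_mxP.
apply: (etrans (h u v)); apply: (etrans _ (esym (h v u))).
exact: (smooth_schwarzR u v sij Ux).
Unshelve. all: by end_near. Qed.

End mx.

Lemma smooth_mulmx p q r (f : E -> 'M[R]_(p, q)) (g : E -> 'M[R]_(q, r)) :
  smooth_on U f -> smooth_on U g -> smooth_on U (fun x => f x *m g x).
Proof.
move=> /smooth_mxP sf /smooth_mxP sg; apply/smooth_mxP => i j.
apply: (@smooth_ext _ (fun x => \sum_k f x i k * g x k j)) => [x _|]; first by rewrite mxE.
by apply: smooth_sum => k _; exact: (smooth_mul (sf i k) (sg k j)).
Qed.

Lemma smooth_trmx p q (f : E -> 'M[R]_(p, q)) :
  smooth_on U f -> smooth_on U (fun x => (f x)^T).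
Proof.
move=> /smooth_mxP sf; apply/smooth_mxP => i j.
by apply: smooth_ext (sf j i) => x _; rewrite mxE.
Qed.

Lemma smooth_bil (B : E -> 'M[R]_m) (X Y : E -> E) :
  smooth_on U B -> smooth_on U X -> smooth_on U Y ->
  smooth_on U (fun x => bil (B x) (X x) (Y x)).
Proof.
move=> sB sX sY.
by have /smooth_mxP := smooth_mulmx (smooth_mulmx sX sB) (smooth_trmx sY); exact.
Qed.

End smooth_theory.

(** * Families of bilinear maps depending on a point *)

Section bilinear_families.
Variables (R : realType) (m p q : nat).
Local Notation E := 'rV[R]_m.
Local Notation W := 'M[R]_(p, q).

Definition bilin (H : E -> E -> W) := bilinear_for *:%R *:%R H.

Lemma bilin_sum (H : E -> E -> W) a b : bilin H ->
  H a b = \sum_i \sum_j (a 0 i * b 0 j) *: H (delta_mx 0 i) (delta_mx 0 j).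
Proof.
move=> [Hl Hr].
pose L b : {linear E -> W} := HB.pack (H^~ b) (GRing.isLinear.Build _ _ _ _ (H^~ b) (Hl b)).
pose L' a : {linear E -> W} := HB.pack (H a) (GRing.isLinear.Build _ _ _ _ (H a) (Hr a)).
rewrite -[LHS]/(L b a) {1}(row_sum_delta a) linear_sum; apply: eq_bigr => i _.
rewrite linearZ /= -[H _ _]/(L' (delta_mx 0 i) b) {1}(row_sum_delta b) linear_sum.
by rewrite scaler_sumr; apply: eq_bigr => j _; rewrite linearZ /= scalerA.
Qed.

Lemma bilinPl H k a a' b : bilin H -> H (k *: a + a') b = k *: H a b + H a' b.
Proof. by move=> [h _]; exact: h. Qed.
Lemma bilinPr H k a b b' : bilin H -> H a (k *: b + b') = k *: H a b + H a b'.
Proof. by move=> [_ h]; exact: h. Qed.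
Lemma bilinDl H a a' b : bilin H -> H (a + a') b = H a b + H a' b.
Proof. by move=> h; rewrite -[a]scale1r bilinPl // !scale1r. Qed.
Lemma bilinDr H a b b' : bilin H -> H a (b + b') = H a b + H a b'.
Proof. by move=> h; rewrite -[b]scale1r bilinPr // !scale1r. Qed.
Lemma bilin0l H b : bilin H -> H 0 b = 0.
Proof. by move=> h; rewrite -[0 in LHS](addNr 0) -scaleN1r bilinPl // scaleN1r addNr. Qed.
Lemma bilin0r H a : bilin H -> H a 0 = 0.
Proof. by move=> h; rewrite -[0 in LHS](addNr 0) -scaleN1r bilinPr // scaleN1r addNr. Qed.
Lemma bilinZl H k a b : bilin H -> H (k *: a) b = k *: H a b.
Proof. by move=> h; rewrite -[k *: a]addr0 bilinPl // bilin0l // addr0. Qed.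
Lemma bilinZr H k a b : bilin H -> H a (k *: b) = k *: H a b.
Proof. by move=> h; rewrite -[k *: b]addr0 bilinPr // bilin0r // addr0. Qed.

Lemma is_derive_bilin (V : normedModType R) (H : V -> E -> E -> W) (Y Z : V -> E) x u :
  (\forall y \near x, bilin (H y)) ->
  (forall a b, derivable (fun y => H y a b) x u) ->
  derivable Y x u -> derivable Z x u ->
  is_derive x u (fun y => H y (Y y) (Z y))
   ('D_u (fun y => H y (Y x) (Z x)) x + H x ('D_u Y x) (Z x) + H x (Y x) ('D_u Z x)).
Proof.
move=> bH dH dY dZ; have bHx := nbhs_singleton bH.
pose F (P Q : V -> E) i j (y : V) := (P y 0 i * Q y 0 j) *: H y (delta_mx 0 i) (delta_mx 0 j).
have main P Q : derivable P x u -> derivable Q x u ->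
    is_derive x u (fun y => H y (P y) (Q y))
     (\sum_i \sum_j ((('D_u P x) 0 i * Q x 0 j + P x 0 i * ('D_u Q x) 0 j) *:
        H x (delta_mx 0 i) (delta_mx 0 j) +
        (P x 0 i * Q x 0 j) *: 'D_u (fun y => H y (delta_mx 0 i) (delta_mx 0 j)) x)).
  move=> dP dQ; have dPi i : derivable (fun y => P y 0 i) x u.
    by move/derivable_mxP: dP; exact.
  have dQi i : derivable (fun y => Q y 0 i) x u by move/derivable_mxP: dQ; exact.
  apply: (@near_eq_is_derive _ _ _ (\sum_i \sum_j F P Q i j)).
    near=> y; rewrite fct_sumE bilin_sum; last by near: y.
    by apply: eq_bigr => i _; rewrite fct_sumE.
  apply: is_derive_sum => i; apply: is_derive_sum => j.
  have dPQ : derivable (fun y => P y 0 i * Q y 0 j) x u by exact: derivableM.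
  apply: is_derive_eq; first exact: is_derive_scale_mx.
  have -> : 'D_u (fun y => P y 0 i * Q y 0 j) x = ('D_u P x) 0 i * Q x 0 j + P x 0 i * ('D_u Q x) 0 j.
    apply: (etrans (deriveM (dPi i) (dQi j))); rewrite !derive_mxE // addrC.
    by congr (_ + _); exact: mulrC.
  by [].
apply: is_derive_eq; first exact: main.
(* The same expansion with both arguments frozen identifies the term that differentiates [H]
   alone. *)
have [_ ->] := main (fun=> Y x) (fun=> Z x) (derivable_cst _ _ _) (derivable_cst _ _ _).
rewrite (bilin_sum ('D_u Y x) _ bHx) (bilin_sum _ ('D_u Z x) bHx) -!big_split /=.
apply: eq_bigr => i _; rewrite -!big_split /=; apply: eq_bigr => j _.
rewrite !derive_cst !mxE mul0r mulr0 addr0 scale0r add0r scalerDl.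
by rewrite -[RHS]addrA addrC.
Unshelve. all: by end_near. Qed.

Lemma smooth_bilin n (U : set 'rV[R]_n) (H : 'rV[R]_n -> E -> E -> W)
  (Y Z : 'rV[R]_n -> E) : open U -> (forall x, U x -> bilin (H x)) ->
  (forall a b, smooth_on U (fun x => H x a b)) -> smooth_on U Y -> smooth_on U Z ->
  smooth_on U (fun x => H x (Y x) (Z x)).
Proof.
move=> oU bH sH sY sZ; pose F i j x := (Y x 0 i * Z x 0 j) *: H x (delta_mx 0 i) (delta_mx 0 j).
apply: (@smooth_ext _ _ _ oU _ (fun x => \sum_i \sum_j F i j x)) => [x Ux|].
  by rewrite [RHS]bilin_sum //; exact: bH.
apply: smooth_sum => // i _; apply: smooth_sum => // j _; apply: smooth_scale => //.
by apply: smooth_mul => //; [move/(smooth_mxP oU): sY|move/(smooth_mxP oU): sZ]; exact.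
Qed.

End bilinear_families.

Lemma derivable_eps (R : realType) (W : normedModType R) (f : R -> W) x :
  derivable f x 1 -> forall e : R, 0 < e -> \forall h \near (0 : R),
     `|f (h + x) - f x - h *: 'D_1 f x| <= e * `|h|.
Proof.
move=> /derivable1_diffP df e e0; have := differentiable_eps df e0.
apply: filterS => h; suff -> : 'D_h f x = h *: 'D_1 f x by [].
by rewrite !deriveE // -linearZ /= [h *: 1]mulr1.
Qed.

Lemma linear_mx_bound (R : realType) (p q : nat) (W : normedModType R)
  (f : {linear 'M[R]_(p, q) -> W}) :
  exists2 K : R, 0 < K & forall v, `|f v| <= K * `|v|.
Proof.
have [_ /(_ (@linear_mx_continuous _ _ _ _ f)) bf] := linear_bounded_continuous f.
have [h _] := linear_boundedP f; have [K [_ hK]] := h bf.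
exists (`|K| + 1) => [|v]; first by rewrite ltr_wpDl.
by apply: hK; rewrite (le_lt_trans (ler_norm K)) // ltrDl.
Qed.

(** Peano form: the second derivative exists at [0] only, so the mean value theorem is applied once,
    to the remainder [p], whose derivative is the first order error of ['D_1 g]. *)
Lemma taylor2_line (R : realType) (g : R -> R) :
  (\forall t \near (0 : R), derivable g t 1) -> derivable (fun t => 'D_1 g t) 0 1 ->
  forall e, 0 < e -> \forall t \near (0 : R), 0 <= t ->
    `|g t - g 0 - t * 'D_1 g 0 - t ^+ 2 / 2 * 'D_1 (fun t => 'D_1 g t) 0| <= e * t ^+ 2.
Proof.
move=> dg ddg e e0; pose b := 'D_1 g 0; pose c := 'D_1 (fun t => 'D_1 g t) 0.
have near0 : \forall t \near (0 : R), derivable g t 1 /\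
    `|'D_1 g t - b - t * c| <= e * `|t|.
  apply: filterI => //; apply: filterS (derivable_eps ddg e0) => t.
  by rewrite addr0.
rewrite -/b -/c; clearbody b c.
have [r /= r0 hr] := (@nbhs_ballP _ _ _ _).1 near0.
apply/nbhs_ballP; exists r => //= t; rewrite -ball_normE /ball_ /= sub0r normrN => tr t0.
have inb s : 0 <= s <= t -> derivable g s 1 /\ `|'D_1 g s - b - s * c| <= e * `|s|.
  move=> /andP[s0 st]; apply: hr; rewrite -ball_normE /ball_ /= sub0r normrN.
  by rewrite ger0_norm // (le_lt_trans st) // -(ger0_norm t0).
pose p s := g s - s * b - s ^+ 2 / 2 * c.
have ip s : 0 <= s <= t -> is_derive s 1 p ('D_1 g s - b - s * c).
  move=> st; have [ds _] := inb s st; have ids := derivableP ds.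
  have i1 k : is_derive s 1 (fun s => s * k) k.
    have := is_deriveM (is_derive_id s 1) (is_derive_cst k s 1).
    by rewrite scaler0 add0r /GRing.scale /= mulr1.
  have i2 : is_derive s 1 (fun s => s ^+ 2 / 2 * c) (s * c).
    apply: is_derive_eq; rewrite !scaler0 !add0r /GRing.scale /= !mulr1.
    by rewrite -mulr2n -[s *+ 2]mulr_natl mulKf ?pnatr_eq0 // mulrC.
  exact: (is_deriveB (is_deriveB ids (i1 b)) i2).
have [| |s] := @MVT_segment R p (fun s => 'D_1 g s - b - s * c) 0 t t0.
- by move=> s; rewrite in_itv /= => /andP[s0 st]; apply: ip; rewrite !ltW.
- apply: derivable_within_continuous => s; rewrite in_itv /= => st.
  by have [] := ip s st.
rewrite in_itv /= subr0 => st E; have [_ hs] := inb s st; have /andP[s0 s1] := st.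
have -> : g t - g 0 - t * b - t ^+ 2 / 2 * c = ('D_1 g s - b - s * c) * t.
  by rewrite -E /p mul0r expr0n /= !mul0r !subr0; move: (g t) (g 0) => ? ?; ring.
rewrite normrM expr2 mulrA ler_pM // ?(le_trans hs) // ?ger0_norm //.
by rewrite ler_wpM2l // ltW.
Qed.

(** * Second order contact with an immersed submanifold *)

Lemma is_derive_linear (R : realType) (V W W' : normedModType R) (l : {linear W -> W'})
  (f : V -> W) x v : continuous l -> derivable f x v ->
  is_derive x v (fun y => l (f y)) (l ('D_v f x)).
Proof.
move=> cl df.
have c : (fun h : R => h^-1 *: (l (f (h *: v + x)) - l (f x))) @ 0^' --> l ('D_v f x).
  rewrite (_ : (fun _ => _) = l \o (fun h : R => h^-1 *: (f (h *: v + x) - f x))).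
    exact: (cvg_comp _ _ df (cl _)).
  by apply/funext => h /=; rewrite -linearB -linearZ.
by split; [apply/cvg_ex; exists (l ('D_v f x)) | exact: cvg_lim c].
Qed.

Lemma second_order_contact_eq (R : realType) (c q : R -> R) :
  (\forall t \near (0 : R), derivable c t 1) -> derivable (fun t => 'D_1 c t) 0 1 ->
  (\forall t \near (0 : R), derivable q t 1) -> derivable (fun t => 'D_1 q t) 0 1 ->
  c 0 = q 0 -> 'D_1 c 0 = 0 -> 'D_1 q 0 = 0 ->
  (forall e, 0 < e -> \forall t \near (0 : R), 0 <= t -> `|c t - q t| <= e * t ^+ 2) ->
  'D_1 (fun t => 'D_1 q t) 0 = 'D_1 (fun t => 'D_1 c t) 0.
Proof.
move=> dc ddc dq ddq cq0 c1 q1 cq.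
apply/eqP; rewrite -subr_eq0 -normr_le0; apply/ler_addgt0Pr => e e0.
(* The difference of the second derivatives times [t ^+ 2] is twice a combination of three errors:
   two Taylor remainders and the contact error. *)
rewrite add0r; have e60 : 0 < e / 6 by rewrite divr_gt0.
have n1 := taylor2_line dc ddc e60; have n2 := taylor2_line dq ddq e60.
have {cq} n3 := cq _ e60.
rewrite -cq0 q1 in n2; rewrite c1 in n1.
move: ('D_1 (fun t => 'D_1 c t) 0) ('D_1 (fun t => 'D_1 q t) 0) n1 n2 => b a n1 n2.
have : \forall t \near (0 : R), 0 <= t ->
   [/\ `|c t - c 0 - t * 0 - t ^+ 2 / 2 * b| <= e / 6 * t ^+ 2,
       `|q t - c 0 - t * 0 - t ^+ 2 / 2 * a| <= e / 6 * t ^+ 2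
     & `|c t - q t| <= e / 6 * t ^+ 2].
  near=> t => t0; split; move: t0; near: t; [exact: n1|exact: n2|exact: n3].
move=> /nbhs_ballP[r /= r0 hr].
have t0 : 0 < r / 2 by rewrite divr_gt0.
have [||h1 h2 h3] := hr (r / 2).
- rewrite -ball_normE /ball_ /= sub0r normrN gtr0_norm //.
  by rewrite ltr_pdivrMr // ltr_pMr // ltr1n.
- exact: ltW.
move: h1 h2 h3; rewrite !mulr0 !subr0; move: (c _) (q _) (c 0) => u v d.
have : 0 < (r / 2) ^+ 2 by rewrite exprn_gt0.
move: ((r / 2) ^+ 2) => s s0 h1 h2 h3.
rewrite -(ler_pM2r s0) -[s in leLHS](gtr0_norm s0) -normrM.
have -> : (a - b) * s = 2 * ((u - d - s / 2 * b) - (v - d - s / 2 * a) - (u - v)) by field.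
rewrite normrM ger0_norm //.
have := ler_normB (u - d - s / 2 * b - (v - d - s / 2 * a)) (u - v).
have := ler_normB (u - d - s / 2 * b) (v - d - s / 2 * a).
move: h1 h2 h3; lra.
Unshelve. all: by end_near. Qed.

Section contact.
Variables (R : realType) (k : nat).

(** A left inverse [P] of the differential bounds [z t - x0 - t *: w] by a small multiple of [|t|]
    plus [|z t - x0|]. Continuity of [z] is enough to start, and the unknown term is then absorbed
    on the left. *)
Lemma immersion_first_order m (phi : 'rV[R]_k -> 'rV[R]_m) x0 w (z : R -> 'rV[R]_k) :
  differentiable phi x0 -> (forall v, 'D_v phi x0 = 0 -> v = 0) ->
  {for 0, continuous z} -> z 0 = x0 ->
  derivable (phi \o z) 0 1 -> 'D_1 (phi \o z) 0 = 'D_w phi x0 ->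
  forall e, 0 < e -> \forall t \near (0 : R), `|z t - x0 - t *: w| <= e * `|t|.
Proof.
move=> dphi inj cz z0 dpz Dpz e e0; pose J := jacobian phi x0.
have DJ v : 'D_v phi x0 = v *m J by exact: deriveEjacobian.
have fJ : row_free J by apply: inj_row_free => v; rewrite -DJ; exact: inj.
pose P := pinvmx J; have JP : J *m P = 1%:M by exact: mulmxVp.
have [K K0 hK] := linear_mx_bound (mulmxr P : {linear 'rV[R]_m -> 'rV[R]_k}).
(* The first bound makes the factor [K * e1] at most one half, for the absorption; the second brings
   what remains below [e]. *)
pose e1 := Num.min (1 / (2 * K)) (e / (2 * K * (1 + `|w|))).
have w0 : 0 < 1 + `|w| by rewrite ltr_wpDr.
have K20 : 0 < 2 * K by rewrite mulr_gt0.
have e10 : 0 < e1 by rewrite lt_min !divr_gt0 // mulr_gt0.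
have e1a : K * e1 <= 2^-1.
  have : e1 <= 1 / (2 * K) by rewrite ge_min lexx.
  by rewrite ler_pdivlMr //; move: (e1) => c; lra.
have e1b : 2 * (K * e1 * (1 + `|w|)) <= e.
  have : e1 <= e / (2 * K * (1 + `|w|)) by rewrite ge_min lexx orbT.
  by rewrite ler_pdivlMr ?mulr_gt0 //; move: (e1) (`|w|) => c a; lra.
have cz0 : (fun t => z t - x0) @ (0 : R) --> (0 : 'rV[R]_k).
  by rewrite -[X in _ --> X](subrr x0); apply: cvgB; [rewrite -z0; exact: cz|exact: cvg_cst].
have n1 := cz0 _ (differentiable_eps dphi e10).
have n2 := derivable_eps dpz e10.
near=> t.
have a1 : `|phi (z t) - phi x0 - (z t - x0) *m J| <= e1 * `|z t - x0|.
  by rewrite -DJ -{1}(subrK x0 (z t)); near: t; exact: n1.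
have a2 : `|phi (z t) - phi x0 - t *: (w *m J)| <= e1 * `|t|.
  rewrite -DJ -Dpz; have -> : phi x0 = (phi \o z) 0 by rewrite /= z0.
  have -> : phi (z t) = (phi \o z) (t + 0) by rewrite addr0.
  by near: t; exact: n2.
set h := z t - x0 in a1 *.
have hE : h - t *: w = (phi (z t) - phi x0 - t *: (w *m J)) *m P
                       - (phi (z t) - phi x0 - h *m J) *m P.
  have e2 (c a b : 'rV[R]_m) : c - a - (c - b) = b - a by rewrite opprB addrC addrA subrK.
  rewrite -mulmxBl e2 mulmxBl -scalemxAl.
  by rewrite -!mulmxA JP !mulmx1.
have b1 : `|h - t *: w| <= K * e1 * (`|t| + `|h|).
  rewrite {1}hE (le_trans (ler_normB _ _)) // mulrDr; apply: lerD.
    by rewrite (le_trans (hK _)) // -mulrA ler_wpM2l // ltW.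
  by rewrite (le_trans (hK _)) // -mulrA ler_wpM2l // ltW.
have b2 : `|h| <= `|h - t *: w| + `|t| * `|w|.
  by rewrite -normrZ -[X in `|X| <= _](subrK (t *: w)) ler_normD.
set y := `|h - t *: w| in b1 b2 *.
have y0 : 0 <= y by exact: normr_ge0.
have b3 : y <= K * e1 * (`|t| + (y + `|t| * `|w|)).
  apply: (le_trans b1); apply: ler_wpM2l; first by rewrite mulr_ge0 // ltW.
  by rewrite lerD2l.
have b4 : K * e1 * y <= 2^-1 * y by rewrite ler_wpM2r.
apply: (@le_trans _ _ (2 * (K * e1 * (1 + `|w|)) * `|t|)); last by rewrite ler_wpM2r.
move: b3 b4; move: (K * e1) => c; nra.
Unshelve. all: by end_near. Qed.

Variables (U : set 'rV[R]_k) (oU : open U).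

(** At a critical point the derivative of [f] is [O(t)] at distance [O(t)], while [z t] is within
    [o(t)] of the line; the product of the two is [o(t^2)]. *)
Let flat_difference (f : 'rV[R]_k -> R) x0 w (z : R -> 'rV[R]_k) :
  smooth_on U f -> U x0 -> (forall v, 'D_v f x0 = 0) ->
  (forall e, 0 < e -> \forall t \near (0 : R), `|z t - x0 - t *: w| <= e * `|t|) ->
  forall e, 0 < e -> \forall t \near (0 : R), 0 <= t ->
     `|f (z t) - f (t *: w + x0)| <= e * t ^+ 2.
Proof.
move=> sf Ux0 f0 hz e e0.
pose F y : 'rV[R]_k := \row_i 'D_(delta_mx 0 i) f y.
have sF : smooth_on U F.
  apply/(smooth_mxP oU) => i j; rewrite (ord1 i).
  apply: (@smooth_ext _ _ _ oU _ (fun y => 'D_(delta_mx 0 j) f y)) => [x _|].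
    by rewrite mxE.
  exact: smooth_derive.
have F0 : F x0 = 0 by apply/rowP => j; rewrite !mxE f0.
have dF := smooth_differentiable oU sF Ux0.
have [K K0 hK] := linear_mx_bound ('d F x0 : {linear 'rV[R]_k -> 'rV[R]_k}).
have nF : \forall h \near (0 : 'rV[R]_k), U (h + x0) /\ `|F (h + x0)| <= (K + 1) * `|h|.
  apply: filterI.
    have ch : (fun h => h + x0) @ (0 : 'rV[R]_k) --> (0 + x0).
      exact: (cvgD cvg_id (cvg_cst x0)).
    by apply: ch; rewrite add0r; exact: open_nbhs_nbhs.
  apply: filterS (differentiable_eps dF ltr01) => h; rewrite F0 subr0 mul1r => hh.
  rewrite -[F _](subrK ('D_h F x0)) (le_trans (ler_normD _ _)) // addrC mulrDl mul1r lerD //.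
  by rewrite deriveE //; exact: hK.
have [r /= r0 hr] := (@nbhs_ballP _ _ _ _).1 nF.
pose C := k%:R * (K + 1) * (1 + `|w|).
have K1 : 0 <= K + 1 by rewrite addr_ge0 // ltW.
have C0 : 0 <= C by rewrite !mulr_ge0 // addr_ge0.
pose e' := Num.min 1 (e / (C + 1)).
have C1 : 0 < C + 1 by rewrite ltr_wpDl.
have e'0 : 0 < e' by rewrite lt_min ltr01 divr_gt0.
have e'C : C * e' <= e.
  have : e' <= e / (C + 1) by rewrite ge_min lexx orbT.
  rewrite ler_pdivlMr // => h; apply: le_trans h.
  by rewrite mulrC mulrDr mulr1 lerDl ltW.
have w0 : 0 < 1 + `|w| by rewrite ltr_wpDr.
have tr : \forall t \near (0 : R), `|t| * (1 + `|w|) < r.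
  have r'0 : 0 < r / (1 + `|w|) by rewrite divr_gt0.
  apply/nbhs_ballP; exists (r / (1 + `|w|)) => // t.
  by rewrite -ball_normE /ball_ /= sub0r normrN -ltr_pdivlMr.
near=> t => t0; set y := t *: w + x0; pose v := z t - y.
have vt : `|v| <= e' * `|t|.
  by rewrite /v /y opprD addrA addrAC; near: t; exact: hz.
have vt1 : `|v| <= `|t|.
  by rewrite (le_trans vt) // ler_piMl // ge_min lexx.
have inb s : 0 <= s <= 1 -> U (s *: v + y) /\ `|F (s *: v + y)| <= (K + 1) * (`|t| * (1 + `|w|)).
  move=> /andP[s0 s1].
  have le : `|s *: v + t *: w| <= `|t| * (1 + `|w|).
    rewrite (le_trans (ler_normD _ _)) // !normrZ mulrDr mulr1 lerD //.
    by rewrite (le_trans _ vt1) // ger0_norm // ler_piMl.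
  have [|h1 h2] := hr (s *: v + t *: w).
    rewrite -ball_normE /ball_ /= sub0r normrN (le_lt_trans le) //.
    by near: t; exact: tr.
  split; first by rewrite /y addrA.
  by rewrite /y addrA (le_trans h2) // ler_wpM2l.
have [|s s01 E] := @MVT_line R _ f y v.
  by move=> s s01; apply: smooth_derivable sf _; exact: (inb s s01).1.
have -> : f (z t) - f y = 'D_v f (s *: v + y) by rewrite -E /v subrK.
have [Us Fs] := inb s s01.
rewrite derive_delta; last exact: smooth_differentiableR sf Us.
apply: le_trans (ler_norm_sum _ _ _) _.
apply: (@le_trans _ _ (\sum_(i < k) (e' * `|t| * ((K + 1) * (`|t| * (1 + `|w|)))))).
  apply: ler_sum => i _; rewrite normrZ ler_pM //.
    exact: le_trans (normr_coord_le _ _ _) vt.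
  apply: le_trans Fs; have -> : 'D_(delta_mx 0 i) f (s *: v + y) = F (s *: v + y) 0 i by rewrite mxE.
  exact: normr_coord_le.
rewrite sumr_const card_ord -mulr_natl ger0_norm //.
apply: (@le_trans _ _ (C * e' * t ^+ 2)); last by rewrite ler_wpM2r // sqr_ge0.
by rewrite le_eqVlt; apply/orP; left; apply/eqP; rewrite /C; ring.
Unshelve. all: by end_near. Qed.

(* The lift [z] is only continuous, but [phi] being an immersion makes it
   tangent to the line through [x0] along [w].  A linear form [l] that kills
   the tangent space gives [l \o phi] a critical point at [x0], so that its
   values along [z] and along that line agree up to [o(t^2)]. *)
Lemma contact_second_order m (phi : 'rV[R]_k -> 'rV[R]_m) x0 w (z : R -> 'rV[R]_k)
    (g : R -> 'rV[R]_m) (T : 'cV[R]_m) :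
  smooth_on U phi -> U x0 -> (forall v, 'D_v phi x0 = 0 -> v = 0) ->
  {for 0, continuous z} -> z 0 = x0 -> (\forall t \near (0 : R), phi (z t) = g t) ->
  (\forall t \near (0 : R), derivable g t 1) -> derivable (fun t => 'D_1 g t) 0 1 ->
  'D_1 g 0 = 'D_w phi x0 -> (forall v, 'D_v phi x0 *m T = 0) ->
  'D_w (fun x => 'D_w phi x) x0 *m T = 'D_1 (fun t => 'D_1 g t) 0 *m T.
Proof.
move=> sphi Ux0 inj cz z0 phiz dg ddg g1 T0.
have dphi := smooth_differentiable oU sphi Ux0.
have g0 : derivable g 0 1 := nbhs_singleton dg.
have gE : g 0 = phi x0 by rewrite -z0; apply/esym; exact: (nbhs_singleton phiz).
have hz := immersion_first_order dphi inj cz z0.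
have {}hz : forall e, 0 < e -> \forall t \near (0 : R), `|z t - x0 - t *: w| <= e * `|t|.
  have gphi : \forall t \near (0 : R), g t = (phi \o z) t.
    by apply: filterS phiz => t /= ->.
  apply: hz; first exact: near_eq_derivable gphi g0.
  by rewrite -g1; apply/esym/near_eq_derive.
apply/matrixP => i j; rewrite (ord1 i) (ord1 j) {i j}.
have linl : linear (fun v : 'rV[R]_m => (v *m T) 0 0).
  by move=> a u v; rewrite mulmxDl -scalemxAl !mxE.
pose lM := GRing.isLinear.Build _ _ _ _ (fun v : 'rV[R]_m => (v *m T) 0 0) linl.
pose l : {linear 'rV[R]_m -> R} := HB.pack (fun v : 'rV[R]_m => (v *m T) 0 0) lM.
have cl : continuous l := @linear_mx_continuous _ _ _ _ l.
rewrite -[LHS]/(l _) -[RHS]/(l _).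
pose f x := l (phi x); pose c t := l (g t).
have sf : smooth_on U f.
  have h := smooth_mulmx oU sphi (@smooth_cst _ _ U _ T).
  by move/(smooth_mxP oU): h; exact.
have Df x v : U x -> 'D_v f x = l ('D_v phi x).
  move=> Ux; have [_] := is_derive_linear cl (smooth_derivable (v := v) sphi Ux); exact.
have f0 v : 'D_v f x0 = 0 by rewrite Df //= T0 mxE.
have DDf v u : 'D_u (fun x => 'D_v f x) x0 = l ('D_u (fun x => 'D_v phi x) x0).
  have [_ <-] := is_derive_linear cl (smooth_derivable (v := u) (smooth_derive v sphi) Ux0).
  apply: near_eq_derive; near=> y; apply: Df; near: y; exact: open_nbhs_nbhs.
have Dc : \forall t \near (0 : R), derivable c t 1 /\ 'D_1 c t = l ('D_1 g t).
  by apply: filterS dg => t dgt; have [] := is_derive_linear cl dgt.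
have lDc : \forall t \near (0 : R), l ('D_1 g t) = 'D_1 c t by apply: filterS Dc => t [].
have [dDDc DDc] := is_derive_linear cl ddg.
have dDc : derivable (fun t => 'D_1 c t) 0 1 by exact: near_eq_derivable lDc dDDc.
have DD : 'D_1 (fun t => 'D_1 c t) 0 = l ('D_1 (fun t => 'D_1 g t) 0).
  refine (etrans _ DDc); apply: near_eq_derive.
  by apply: filterS lDc => t ->.
refine (etrans _ DD); refine (etrans (esym (DDf w w)) _).
have c1 : 'D_1 c 0 = 0 by have [_ ->] := nbhs_singleton Dc; rewrite g1 /= T0 mxE.
pose q (t : R) := f (t *: w + x0).
have Uq : \forall t \near (0 : R), U (t *: w + x0).
  have cq : (fun t : R => t *: w + x0) @ (0 : R) --> (0 *: w + x0).
    by apply: cvgD; [apply: cvgZl; exact: cvg_id|exact: cvg_cst].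
  by apply: cq; rewrite scale0r add0r; exact: open_nbhs_nbhs.
have dq : \forall t \near (0 : R), derivable q t 1.
  apply: filterS Uq => t Ut; apply/derivable_line; exact: smooth_derivable sf Ut.
have q1E t : 'D_1 q t = 'D_w f (t *: w + x0) by exact: derive_line.
have dDq : derivable (fun t => 'D_1 q t) 0 1.
  rewrite (_ : (fun t => _) = (fun t => 'D_w f (t *: w + x0))); last exact/funext.
  apply/(derivable_line (fun x => 'D_w f x)); rewrite scale0r add0r.
  exact: smooth_derivable (smooth_derive w sf) Ux0.
have q2E : 'D_1 (fun t => 'D_1 q t) 0 = 'D_w (fun x => 'D_w f x) x0.
  rewrite (_ : (fun t => _) = (fun t => 'D_w f (t *: w + x0))); last exact/funext.
  by rewrite (derive_line (fun x => 'D_w f x)) scale0r add0r.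
refine (etrans (esym q2E) _).
refine (@second_order_contact_eq R c q _ dDc dq dDq _ c1 _ _).
- by apply: filterS Dc => t [].
- by rewrite /c gE /q scale0r add0r.
- by rewrite q1E scale0r add0r f0.
move=> e e0; have := flat_difference sf Ux0 f0 hz e0; move: phiz.
apply: filterS2 => t h1 h2 t0; rewrite /c -h1; exact: h2.
Unshelve. all: by end_near. Qed.

End contact.

(** * Ordinary differential equations *)

Lemma antiderivative (R : realType) (f : R -> R) : continuous f ->
  exists F : R -> R, F 0 = 0 /\ forall t : R, `|t| < 1 -> is_derive t 1 F (f t).
Proof.
(* Every [t] with [|t| < 1] is interior to the interval from -2 to 2; the integral from -2 is later
   normalized to vanish at [0]. *)
move=> cf; pose a : R := -2; pose u : R := 2.
have int_f : (@lebesgue_measure R).-integrable `[a, u] (constructive_ereal.EFin \o f).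
  apply: continuous_compact_integrable; first exact: segment_compact.
  exact: continuous_subspaceT.
pose F0 (x : R) : R := (\int[@lebesgue_measure R]_(t in `[a, x]) f t)%R.
have h (t : R) : `|t| < 1 -> is_derive t 1 F0 (f t).
  rewrite ltr_norml => /andP[t1 t2].
  have tu : t < u by rewrite /u; lra.
  have at_ : a < t by rewrite /a; lra.
  have [d e] := continuous_FTC1_closed tu int_f at_ (cf t).
  exact: (DeriveDef d (etrans (esym (derive1E F0 t)) e)).
exists (fun t => F0 t - F0 0); split; first by rewrite subrr.
move=> t t1; have ht := h t t1.
have := is_deriveB ht (is_derive_cst (F0 0) t 1); rewrite subr0; exact.
Qed.

Section Picard.
Variables (R : realType) (N : nat).
Local Notation E := 'rV[R]_N.

Lemma antiderivative_rV (f : R -> E) : continuous f ->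
  exists F : R -> E, F 0 = 0 /\ forall t : R, `|t| < 1 -> is_derive t 1 F (f t).
Proof.
move=> cf.
have h i : exists F : R -> R, F 0 = 0 /\ forall t : R, `|t| < 1 -> is_derive t 1 F (f t 0 i).
  by apply: antiderivative => t; apply: continuous_mx_coord; exact: cf.
have [F hF] := choice h.
exists (fun t => \row_i F i t); split.
  by apply/rowP => i; rewrite !mxE; case: (hF i).
move=> t t1; have dF : derivable (fun t => \row_i F i t : E) t 1.
  apply/derivable_mxP => i j.
  have -> : (fun x => (\row_i F i x : E) i j) = F j by apply/funext => x; rewrite mxE.
  by have [_ /(_ t t1) []] := hF j.
split=> //; apply/rowP => j; rewrite derive_mx // mxE.
have -> : (fun x => (\row_i F i x : E) 0 j) = F j by apply/funext => x; rewrite mxE.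
by have [_ /(_ t t1) []] := hF j.
Qed.

Lemma antiderivative_bound (F f : R -> E) (d M : R) : 0 <= M -> F 0 = 0 ->
  (forall t : R, `|t| <= d -> is_derive t 1 F (f t)) ->
  (forall t : R, `|t| <= d -> `|f t| <= M) ->
  forall t : R, `|t| <= d -> `|F t| <= M * `|t|.
Proof.
move=> M0 F0 dF fM t td; apply: normr_mx_le => [|i j]; first by rewrite mulr_ge0.
have dFij (s : R) : `|s| <= d -> derivable (fun x => F x i j) s 1.
  move=> sd; have [h _] := dF s sd.
  by move: i j; apply/derivable_mxP.
have [|s s01 E] := @MVT_line R R (fun x => F x i j) 0 t.
  move=> s /andP[s0 s1]; rewrite addr0 -[t]mulr1.
  have sd : `|s * t| <= d.
    by rewrite normrM (le_trans _ td) // ler_piMl // ger0_norm.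
  have [h _] := is_derive_scale t (dFij _ sd); rewrite mulr1; move: h.
  by rewrite -[t *: 1]/(t * 1) mulr1.
move: E; rewrite addr0 F0 mxE subr0 addr0 => ->.
have /andP[s0 s1] := s01.
have sd : `|s * t| <= d.
  by rewrite normrM (le_trans _ td) // ler_piMl // ger0_norm.
have [h e] := is_derive_scale t (dFij _ sd).
rewrite -[t *: 1]/(t * 1) mulr1 in e; rewrite e normrZ mulrC ler_wpM2r //.
have [h2 e2] := dF _ sd.
by rewrite derive_mxE // e2 (le_trans (normr_coord_le _ _ _)) // fM.
Qed.

Let geometric_cvgR (u : nat -> R) (c : R) : 0 <= c ->
  (forall n, `|u n.+1 - u n| <= c / 2 ^+ n) ->
  exists l, forall n, `|l - u n| <= 2 * c / 2 ^+ n.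
Proof.
move=> c0 hu.
have cv : cvgn u.
  suff cs : cvgn (series (telescope u)).
    have -> : u = (fun n => u 0%N + series (telescope u) n).
      by apply/funext => n; exact: eq_sum_telescope.
    exact: (is_cvgD (is_cvg_cst _) cs).
  apply: normed_cvg.
  apply: (@series_le_cvg _ _ (geometric c (2^-1))) => [n|n|n|].
  - exact: normr_ge0.
  - by rewrite /geometric /= mulr_ge0 // exprn_ge0 // invr_ge0.
  - by rewrite /geometric /= exprVn; exact: hu.
  - apply: is_cvg_geometric_series; rewrite ger0_norm ?invr_ge0 //.
    by rewrite invf_lt1 // ltr1n.
exists (limn u) => n.
have fin k : `|u (n + k)%N - u n| <= 2 * c / 2 ^+ n - 2 * c / 2 ^+ (n + k).
  elim: k => [|k IH]; first by rewrite addn0 !subrr normr0.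
  rewrite addnS -(subrK (u (n + k)%N) (u _.+1)) -addrA (le_trans (ler_normD _ _)) //.
  apply: le_trans (lerD (hu _) IH) _; rewrite exprSr.
  have : (2 : R) ^+ (n + k) != 0 by rewrite expf_neq0 // pnatr_eq0.
  move: (2 ^+ (n + k)) (2 * c / 2 ^+ n) => a b a0.
  by rewrite le_eqVlt; apply/orP; left; apply/eqP; field.
apply/ler_addgt0Pr => e e0.
move/cvgrPdist_le: cv => /(_ e e0) [n0 _ hn0].
have /= := hn0 (n + n0)%N (leq_addl _ _) => h.
rewrite -(subrK (u (n + n0)%N) (limn u)) -addrA (le_trans (ler_normD _ _)) // [leRHS]addrC.
apply: lerD; first exact: h.
by rewrite (le_trans (fin n0)) // lerBlDr lerDl !mulr_ge0 // invr_ge0 exprn_ge0.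
Qed.

Lemma geometric_cvg (u : nat -> E) (c : R) : 0 <= c ->
  (forall n, `|u n.+1 - u n| <= c / 2 ^+ n) ->
  exists l, forall n, `|l - u n| <= 2 * c / 2 ^+ n.
Proof.
move=> c0 hu.
have h i : exists l, forall n, `|l - u n 0 i| <= 2 * c / 2 ^+ n.
  apply: (geometric_cvgR (u := fun n => u n 0 i)) => // n.
  by apply: le_trans (hu n); have := normr_coord_le (u n.+1 - u n) 0 i; rewrite !mxE.
have [l hl] := choice h; exists (\row_i l i) => n.
apply: normr_mx_le => [|i j]; first by rewrite !mulr_ge0 // invr_ge0 exprn_ge0.
by rewrite (ord1 i) !mxE; exact: hl.
Qed.

(** The Picard iterates are shown to converge pointwise with geometric rate, uniformly in time; this
    makes the limit continuous and a fixed point of the integral operator. *)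
Theorem Picard_Lindelof (F : E -> E) (z0 : E) (r K : R) : 0 < r -> 0 < K ->
  (forall a b, `|a - z0| <= r -> `|b - z0| <= r -> `|F a - F b| <= K * `|a - b|) ->
  exists d, exists z : R -> E, [/\ 0 < d, z 0 = z0 &
     forall t : R, `|t| < d -> `|z t - z0| <= r /\ is_derive t 1 z (F (z t))].
Proof.
move=> r0 K0 lipF.
pose M := `|F z0| + K * r.
have M0 : 0 <= M by rewrite addr_ge0 // mulr_ge0 // ltW.
have FM a : `|a - z0| <= r -> `|F a| <= M.
  move=> ar; rewrite -(subrK (F z0) (F a)) (le_trans (ler_normD _ _)) // addrC lerD2l.
  by apply: le_trans (lipF _ _ ar _) _; rewrite ?subrr ?normr0 ?ler_pM2l // ltW.
have M10 : 0 < M + 1 by rewrite ltr_wpDl.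
(* In turn: times stay below 1, where antiderivatives are available; the iterates stay in the ball,
   as [M * d <= r]; one step halves distances, as [K * d <= 2^-1]. *)
pose d := Num.min 2^-1 (Num.min (r / (M + 1)) (1 / (2 * K))).
have d0 : 0 < d by rewrite !lt_min invr_gt0 ltr0n /= !divr_gt0 // mulr_gt0.
have d1 : d < 1 by rewrite gt_min invf_lt1 // ltr1n.
have dM : M * d <= r.
  have : d <= r / (M + 1) by rewrite !ge_min lexx orbT.
  by rewrite ler_pdivlMr // mulrDr mulr1 mulrC => h; rewrite (le_trans _ h) // lerDl ltW.
have dK : K * d <= 2^-1.
  have : d <= 1 / (2 * K) by rewrite !ge_min lexx !orbT.
  by rewrite ler_pdivlMr ?mulr_gt0 //; move: (d) => d'; lra.
(* [tau] clamps the time to [[-d, d]], which makes all iterates global. *)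
pose tau (t : R) := (`|t + d| - `|t - d|) / 2.
have ctau : continuous tau.
  move=> t; apply: cvgMl; apply: cvgB.
    by apply: cvg_norm; apply: cvgD; [exact: cvg_id|exact: cvg_cst].
  by apply: cvg_norm; apply: cvgB; [exact: cvg_id|exact: cvg_cst].
have taud t : `|tau t| <= d.
  rewrite /tau normrM [X in _ * X]ger0_norm ?invr_ge0 // ler_pdivrMr //.
  apply: (le_trans (ler_dist_dist _ _)).
  have -> : t + d - (t - d) = d * 2 by move: (d) => d'; ring.
  by rewrite ger0_norm // mulr_ge0 // ltW.
have tauE (t : R) : `|t| <= d -> tau t = t.
  rewrite ler_norml => /andP[h1 h2]; rewrite /tau ger0_norm; last by lra.
  by rewrite ler0_norm; last lra; field.
pose good (z : R -> E) := continuous z /\ forall t, `|z t - z0| <= r.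
pose step (z z' : R -> E) := exists G : R -> E,
  [/\ G 0 = 0, forall t : R, `|t| < 1 -> is_derive t 1 G (F (z t)) &
      forall t, z' t = z0 + G (tau t)].
have lt1 (t : R) : `|t| <= d -> `|t| < 1 by move=> h; exact: le_lt_trans d1.
have step_good z z' : good z -> step z z' -> good z'.
  move=> [cz zr] [G [G0 dG z'E]].
  have Gb t : `|G (tau t)| <= r.
    have dG' (s : R) : `|s| <= d -> is_derive s 1 G (F (z s)) by move/lt1; exact: dG.
    have := antiderivative_bound M0 G0 dG' (fun s _ => FM _ (zr s)) (taud t).
    by move=> /le_trans; apply; rewrite (le_trans _ dM) // ler_wpM2l.
  split=> t; last by rewrite z'E addrC addKr.
  rewrite (_ : z' = (fun t => z0 + G (tau t))); last exact/funext.
  apply: cvgD; first exact: cvg_cst.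
  apply: (@continuous_comp _ _ _ tau G); first exact: ctau.
  apply/differentiable_continuous/derivable1_diffP.
  by have [] := dG (tau t) (lt1 _ (taud t)).
have step_ex z : good z -> exists z', step z z'.
  move=> [cz zr].
  have cFz : continuous (fun t => F (z t)).
    move=> t; apply/cvgrPdist_le => e e0.
    have eK : 0 < e / K by rewrite divr_gt0.
    move/cvgrPdist_le : (cz t) => /(_ _ eK); apply: filterS => s.
    by rewrite ler_pdivlMr // mulrC => h; rewrite (le_trans (lipF _ _ _ _)).
  have [G [G0 dG]] := antiderivative_rV cFz.
  by exists (fun t => z0 + G (tau t)), G.
have step_contr z z' y y' c : good z -> good y -> step z z' -> step y y' -> 0 <= c ->
    (forall t, `|z t - y t| <= c) -> forall t, `|z' t - y' t| <= c / 2.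
  move=> [cz zr] [cy yr] [G [G0 dG z'E]] [H [H0 dH y'E]] c0 zy t.
  rewrite z'E y'E opprD addrACA subrr add0r.
  have Kc : 0 <= K * c by rewrite mulr_ge0 // ltW.
  have GH0 : (fun t => G t - H t) 0 = 0 by rewrite /= G0 H0 subrr.
  have dGH (s : R) : `|s| <= d -> is_derive s 1 (fun t => G t - H t) (F (z s) - F (y s)).
    by move=> /lt1 s1; exact: (is_deriveB (dG s s1) (dH s s1)).
  have bGH (s : R) : `|s| <= d -> `|F (z s) - F (y s)| <= K * c.
    by move=> _; rewrite (le_trans (lipF _ _ (zr s) (yr s))) // ler_wpM2l // ltW.
  have := antiderivative_bound Kc GH0 dGH bGH (taud t).
  move=> /le_trans; apply; rewrite mulrAC mulrC ler_wpM2l //.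
  by rewrite (le_trans _ dK) // ler_wpM2l // ltW.
(* Made total so that [choice] gives a map [next]; its value off the good curves is irrelevant. *)
have total z : exists z', good z -> step z z'.
  have [gz|ngz] := pselect (good z); last by exists z.
  by have [z' h] := step_ex z gz; exists z'.
have [next hnext] := choice total.
pose u n := iter n next (fun=> z0).
have good0 : good (fun=> z0).
  by split=> [t|t]; [exact: cvg_cst|rewrite subrr normr0 ltW].
have goodu n : good (u n).
  by elim: n => [//|n IH]; apply: (step_good (u n)) => //; exact: hnext.
have du n t : `|u n.+1 t - u n t| <= r / 2 ^+ n.
  elim: n t => [|n IH] t; first by rewrite expr0 divr1; have [_] := goodu 1%N; exact.
  rewrite exprSr invfM mulrA.
  have rn0 : 0 <= r / 2 ^+ n by rewrite mulr_ge0 ?(ltW r0) // invr_ge0 exprn_ge0.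
  exact: (step_contr _ _ _ _ (r / 2 ^+ n) (goodu n.+1) (goodu n) (hnext _ (goodu n.+1)) (hnext _ (goodu n)) rn0 IH).
have [z hz] : exists z : R -> E, forall t n, `|z t - u n t| <= 2 * r / 2 ^+ n.
  have h t : exists l, forall n, `|l - u n t| <= 2 * r / 2 ^+ n.
    by apply: (geometric_cvg (u := fun n => u n t)) => [|n]; [exact: ltW|exact: du].
  by have [z hz] := choice h; exists z.
have small e : 0 < e -> exists n : nat, 2 * r / 2 ^+ n <= e.
  move=> e0; have [n hn] : exists n : nat, 2 * r / e < n%:R.
    by exists (Num.truncn (2 * r / e)).+1; exact: truncnS_gt.
  exists n; rewrite ler_pdivrMr ?exprn_gt0 // [leRHS]mulrC -ler_pdivrMr //.
  by rewrite (le_trans (ltW hn)) // -natrX ler_nat ltnW // ltn_expl.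
have gz : good z.
  split=> t; last first.
    apply/ler_addgt0Pr => e e0; have [n hn] := small e e0.
    rewrite -(subrK (u n t) (z t)) -addrA (le_trans (ler_normD _ _)) // [leRHS]addrC.
    apply: lerD; first exact: le_trans (hz t n) hn.
    by have [_] := goodu n; exact.
  apply/cvgrPdist_le => e e0; have e3 : 0 < e / 3 by rewrite divr_gt0.
  have [n hn] := small _ e3; have [/(_ t) cu _] := goodu n.
  move/cvgrPdist_le: cu => /(_ _ e3); apply: filterS => s us.
  have tri (a b c : E) : (a - b) + (b - c) = a - c by rewrite addrA subrK.
  have -> : z t - z s = (z t - u n t) + (u n t - u n s) + (u n s - z s).
    by rewrite !tri.
  have h1 := le_trans (hz t n) hn; have h2 := le_trans (hz s n) hn.
  rewrite (distrC (z s)) in h2.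
  rewrite (le_trans (ler_normD _ _)) //.
  apply: (@le_trans _ _ (e / 3 + e / 3 + e / 3)); last by lra.
  by rewrite lerD // (le_trans (ler_normD _ _)) // lerD.
have zfix : next z = z.
  apply/funext => t; apply/eqP; rewrite -subr_eq0 -normr_le0; apply/ler_addgt0Pr => e e0.
  have e2 : 0 < e / 2 by rewrite divr_gt0.
  have [n hn] := small _ e2.
  have rn0 : 0 <= 2 * r / 2 ^+ n by rewrite !mulr_ge0 ?(ltW r0) // invr_ge0 exprn_ge0.
  have h1 := step_contr _ _ _ _ _ gz (goodu n) (hnext _ gz) (hnext _ (goodu n)) rn0 (hz ^~ n) t.
  have h2 := hz t n.+1; rewrite distrC in h2.
  rewrite -(subrK (u n.+1 t) (next z t)) -addrA add0r (le_trans (ler_normD _ _)) //.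
  rewrite (splitr e); apply: lerD.
    apply: le_trans h1 _; apply: le_trans hn; rewrite ler_pdivrMr // ler_peMr //.
    by rewrite ler1n.
  apply: le_trans h2 _; apply: le_trans hn.
  rewrite ler_pM2l ?mulr_gt0 // lef_pV2 ?posrE ?exprn_gt0 // exprSr ler_peMr //.
    by rewrite exprn_ge0.
  by rewrite ler1n.
have [G [G0 dG]] := hnext z gz; rewrite zfix => zE.
exists d, z; split=> //.
  by rewrite zE tauE ?normr0 ?ltW // G0 addr0.
move=> t td; split; first by have [_] := gz; exact.
have t1 := lt1 _ (ltW td).
have := is_deriveD (is_derive_cst z0 t 1) (dG t t1); rewrite add0r.
apply: near_eq_is_derive; near=> s.
rewrite /= zE tauE //; near: s.
have cn : (fun s : R => `|s|) @ t --> `|t| by exact: norm_continuous.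
by apply: filterS (cvgr_lt _ cn _ td) => s; exact: ltW.
Unshelve. all: by end_near. Qed.

End Picard.

Section linear_reparametrization.
Variables (R : realType) (n m : nat) (l : {linear 'rV[R]_n -> 'rV[R]_m}).

Lemma derive_comp_linear (W : normedModType R) (f : 'rV[R]_m -> W) z w :
  'D_w (fun y => f (l y)) z = 'D_(l w) f (l z).
Proof.
rewrite /derive; set p := (fun h => _); set q := (fun h : R => _).
suff -> : p = q by []; apply/funext => h; rewrite /p /q /=.
by rewrite linearP.
Qed.

Lemma derivable_comp_linear (W : normedModType R) (f : 'rV[R]_m -> W) z w :
  derivable f (l z) (l w) -> derivable (fun y => f (l y)) z w.
Proof.
rewrite /derivable; set p := (fun h => _); set q := (fun h : R => _).
suff -> : q = p by []; apply/funext => h; rewrite /p /q /=.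
by rewrite linearP.
Qed.

Lemma Ck_comp_linear (W : normedModType R) k (U : set 'rV[R]_m) (f : 'rV[R]_m -> W) :
  Ck_on k U f -> Ck_on k (l @^-1` U) (fun y => f (l y)).
Proof.
have cl : continuous l := @linear_mx_continuous _ _ _ _ l.
elim: k f => [|k IH] f [cf df].
  split=> // z Uz; apply: (@continuous_comp _ _ _ l f); [exact: cl|exact: cf].
split=> [z Uz|w].
  apply: (@continuous_comp _ _ _ l f); [exact: cl|exact: cf].
have [d1 d2] := df (l w); split=> [z Uz|].
  by apply: derivable_comp_linear; exact: d1.
rewrite (_ : (fun x => _) = (fun y => (fun x => 'D_(l w) f x) (l y))); first exact: (IH _ d2).
by apply/funext => z; exact: derive_comp_linear.
Qed.

End linear_reparametrization.

Lemma smooth_linear (R : realType) (n : nat) (W : normedModType R) (U : set 'rV[R]_n)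
  (l : {linear 'rV[R]_n -> W}) : smooth_on U l.
Proof.
have cl : continuous l := @linear_mx_continuous _ _ _ _ l.
case=> [|k]; first by split=> // x _; exact: cl.
split=> [x _|v]; first exact: cl.
have dl x : differentiable l x := @linear_mx_differentiable _ _ _ _ l x.
split=> [x _|]; first exact/diff_derivable.
rewrite (_ : (fun x => _) = (fun=> l v)); first exact: Ck_cst.
by apply/funext => x; rewrite deriveE // diff_lin.
Qed.

Lemma smooth_locally_lipschitz (R : realType) (n p q : nat) (U : set 'rV[R]_n)
    (f : 'rV[R]_n -> 'M[R]_(p, q)) x0 : open U -> smooth_on U f -> U x0 ->
  exists r, exists K, [/\ 0 < r, 0 < K,
    forall a, `|a - x0| <= r -> U a &
    forall a b, `|a - x0| <= r -> `|b - x0| <= r -> `|f a - f b| <= K * `|a - b|].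
Proof.
move=> oU sf Ux0.
have near0 : \forall y \near x0, U y /\
    forall i, `|'D_(delta_mx 0 i) f y| <= `|'D_(delta_mx 0 i) f x0| + 1.
  near=> y; split; first by near: y; exact: open_nbhs_nbhs.
  near: y; apply: filter_forall => i.
  have := smooth_continuous (smooth_derive (delta_mx 0 i) sf) Ux0.
  move=> /cvgrPdist_le /(_ 1 ltr01); apply: filterS => y h.
  rewrite -(subrK ('D_(delta_mx 0 i) f x0) ('D_(delta_mx 0 i) f y)).
  by rewrite (le_trans (ler_normD _ _)) // addrC lerD2l distrC.
have [r /= r0 hr] := (@nbhs_ballP _ _ _ _).1 near0.
pose K := \sum_i (`|'D_(delta_mx 0 i) f x0| + 1).
have K0 : 0 <= K by apply: sumr_ge0 => i _; rewrite addr_ge0.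
have inb a : `|a - x0| <= r / 2 -> U a /\
    forall i, `|'D_(delta_mx 0 i) f a| <= `|'D_(delta_mx 0 i) f x0| + 1.
  move=> h; apply: hr; rewrite -ball_normE /ball_ /= distrC (le_lt_trans h) //.
  by rewrite ltr_pdivrMr // ltr_pMr // ltr1n.
exists (r / 2), (K + 1); split; [by rewrite divr_gt0|by rewrite ltr_wpDl|by move=> a /inb []|].
move=> a b ha hb; apply: normr_mx_le => [|i j]; first by rewrite mulr_ge0 // addr_ge0.
have seg (t : R) : 0 <= t <= 1 -> `|t *: (a - b) + b - x0| <= r / 2.
  move=> /andP[t0 t1].
  have -> : t *: (a - b) + b - x0 = t *: (a - x0) + (1 - t) *: (b - x0).
    by apply/rowP => j'; rewrite !mxE; ring.
  rewrite (le_trans (ler_normD _ _)) // !normrZ ger0_norm // ger0_norm ?subr_ge0 //.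
  have -> : r / 2 = t * (r / 2) + (1 - t) * (r / 2) by rewrite -mulrDl addrC subrK mul1r.
  by apply: lerD; rewrite ler_wpM2l ?subr_ge0.
have dfab y v : U y -> derivable f y v by exact: smooth_derivable.
have [|t t01 E] := @MVT_line R _ (fun y => f y i j) b (a - b).
  move=> t t01; have [Ut _] := inb _ (seg t t01).
  by move: i j; apply/derivable_mxP; exact: dfab.
have [Ut Dt] := inb _ (seg t t01).
rewrite !mxE; move: E; rewrite subrK => ->; rewrite derive_mxE; last exact: dfab.
apply: le_trans (normr_coord_le _ _ _) _.
rewrite derive_delta; last exact: smooth_differentiable sf Ut.
apply: le_trans (ler_norm_sum _ _ _) _.
apply: (@le_trans _ _ (K * `|a - b|)); last by rewrite ler_wpM2r // lerDl.
rewrite /K mulr_suml; apply: ler_sum => l _; rewrite normrZ mulrC ler_pM //.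
exact: normr_coord_le.
Unshelve. all: by end_near. Qed.

Theorem second_order_ode (R : realType) (m : nat) (U : set 'rV[R]_m)
    (H : 'rV[R]_m -> 'rV[R]_m -> 'rV[R]_m -> 'rV[R]_m) x0 v0 :
  open U -> (forall x, U x -> bilin (H x)) ->
  (forall a b, smooth_on U (fun x => H x a b)) -> U x0 ->
  exists d : R, exists x v : R -> 'rV[R]_m, [/\ 0 < d, x 0 = x0, v 0 = v0 &
    forall t : R, `|t| < d -> [/\ U (x t), is_derive t 1 x (v t) &
      is_derive t 1 v (- H (x t) (v t) (v t))] ].
Proof.
move=> oU bH sH Ux0.
pose pl : {linear 'rV[R]_(m + m) -> 'rV[R]_m} := lsubmx.
pose pr : {linear 'rV[R]_(m + m) -> 'rV[R]_m} := rsubmx.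
pose U' := pl @^-1` U.
have oU' : open U'.
  by apply: open_comp oU => z _; exact: linear_mx_continuous.
have spr : smooth_on U' pr := smooth_linear U' pr.
pose F z := row_mx (pr z) (- H (pl z) (pr z) (pr z)).
have sHz : smooth_on U' (fun z => H (pl z) (pr z) (pr z)).
  apply: (smooth_bilin (H := fun z => H (pl z))) => //.
    by move=> z Uz; exact: bH.
  by move=> a b k; have := @Ck_comp_linear R (m + m) m pl _ k U _ (sH a b k).
have sF : smooth_on U' F.
  apply/(smooth_mxP oU') => i j; rewrite (ord1 i).
  case: (split_ordP j) => j' ->.
    apply: (@smooth_ext _ _ _ oU' _ (fun z => pr z 0 j')) => [z _|].
      by rewrite /F row_mxEl.
    by move/(smooth_mxP oU'): spr; exact.
  apply: (@smooth_ext _ _ _ oU' _ (fun z => (-1) * H (pl z) (pr z) (pr z) 0 j')) => [z _|].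
    by rewrite /F row_mxEr mxE mulN1r.
  apply: smooth_mul => //; first exact: smooth_cst.
  by move/(smooth_mxP oU'): sHz; exact.
have Uz0 : U' (row_mx x0 v0) by rewrite /U' /= row_mxKl.
have [r [K [r0 K0 Ur lip]]] := smooth_locally_lipschitz oU' sF Uz0.
have [d [z [d0 z0 hz]]] := Picard_Lindelof r0 K0 lip.
exists d, (fun t => pl (z t)), (fun t => pr (z t)); split=> //.
- by rewrite z0 /= row_mxKl.
- by rewrite z0 /= row_mxKr.
move=> t td; have [zr [dz ez]] := hz t td; split; first exact: (Ur _ zr).
  have [d1 e1] := is_derive_linear (@linear_mx_continuous _ _ _ _ pl) dz.
  by split=> //; apply: (etrans e1); rewrite ez /F /= row_mxKl.
have [d1 e1] := is_derive_linear (@linear_mx_continuous _ _ _ _ pr) dz.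
by split=> //; apply: (etrans e1); rewrite ez /F /= row_mxKr.
Qed.

(** * Geodesics *)

Lemma is_derive_along (R : realType) (V : normedModType R) (k p q : nat)
    (O : set 'rV[R]_k) (f : 'rV[R]_k -> 'M[R]_(p, q)) (x v : V -> 'rV[R]_k) t u :
  open O -> smooth_on O f -> O (x t) -> differentiable x t -> derivable v t u ->
  is_derive t u (fun s => 'D_(v s) f (x s))
    ('D_('D_u x t) (fun y => 'D_(v t) f y) (x t) + 'D_('D_u v t) f (x t)).
Proof.
move=> oO sf Ot dx dv.
have nO : \forall s \near t, O (x s).
  by apply: (differentiable_continuous dx); exact: open_nbhs_nbhs.
have dvi i : derivable (fun s => v s 0 i) t u by move/derivable_mxP: dv; exact.
have sfi i : smooth_on O (fun y => 'D_(delta_mx 0 i) f y) by exact: smooth_derive.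
have dfi i := smooth_differentiable oO (sfi i) Ot.
have dfx i : differentiable (fun s => 'D_(delta_mx 0 i) f (x s)) t.
  exact: (differentiable_comp dx (dfi i)).
pose F i s := v s 0 i *: 'D_(delta_mx 0 i) f (x s).
have expand a y : O y -> 'D_a f y = \sum_i a 0 i *: 'D_(delta_mx 0 i) f y.
  by move=> Oy; apply: derive_delta; exact: smooth_differentiable sf Oy.
apply: (@near_eq_is_derive _ _ _ (\sum_i F i)).
  near=> s; rewrite fct_sumE expand //; near: s; exact: nO.
have dF i : is_derive t u (F i) ('D_u (fun s => v s 0 i) t *: 'D_(delta_mx 0 i) f (x t)
     + v t 0 i *: 'D_u (fun s => 'D_(delta_mx 0 i) f (x s)) t).
  by apply: is_derive_scale_mx => //; apply: diff_derivable; exact: dfx.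
have dS := @is_derive_sum _ _ _ _ F t u _ dF.
have [dd ee] := dS; split=> //; refine (etrans ee _).
have e1 : 'D_('D_u x t) (fun y => 'D_(v t) f y) (x t) =
    \sum_i v t 0 i *: 'D_u (fun s => 'D_(delta_mx 0 i) f (x s)) t.
  pose H i y := v t 0 i *: 'D_(delta_mx 0 i) f y.
  have dH i : is_derive (x t) ('D_u x t) (H i)
      (v t 0 i *: 'D_('D_u x t) (fun y => 'D_(delta_mx 0 i) f y) (x t)).
    have := is_derive_scale_mx (derivable_cst (v t 0 i) (x t) ('D_u x t))
       (diff_derivable (v := 'D_u x t) (dfi i)).
    by rewrite derive_cst scale0r add0r.
  have dHS := @is_derive_sum _ _ _ _ H (x t) ('D_u x t) _ dH.
  have [_ eS] := dHS.
  have e0 : 'D_('D_u x t) (fun y => 'D_(v t) f y) (x t) = 'D_('D_u x t) (\sum_i H i) (x t).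
    apply: near_eq_derive; near=> y; rewrite fct_sumE; apply: expand.
    by near: y; exact: open_nbhs_nbhs.
  refine (etrans e0 _).
  refine (etrans eS _).
  apply: eq_bigr => i _.
  exact: (f_equal (fun z => v t 0 i *: z) (esym (derive_chain u dx (dfi i)))).
have dvE i : 'D_u (fun s => v s 0 i) t = 'D_u v t 0 i by exact: derive_mxE.
rewrite e1 addrC (expand _ _ Ot) -big_split /=; apply: eq_bigr => i _.
by rewrite dvE.
Unshelve. all: by end_near. Qed.

Section overlaps.
Variables (R : realType) (m : nat) (T : topologicalType).
Implicit Types c d : chart R m T.

Lemma overlapP c d x : overlap c d x <-> cimg c x /\ cdom d (cinv c x).
Proof.
split=> [[y [cy dy] <-]|[cx dx]].
  by split; [exact: cmap_img|rewrite cmapK].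
by exists (cinv c x); [split=> //; exact: cinv_dom|exact: cinvK].
Qed.

Lemma open_overlap c d : open (overlap c d).
Proof.
rewrite openE => x /overlapP[cx dx]; rewrite /interior.
have : \forall y \near x, cimg c y /\ cdom d (cinv c y).
  near=> y; split.
    by near: y; apply: open_nbhs_nbhs; split=> //; exact: cimg_open.
  near: y; apply: (cinv_continuous cx); apply: open_nbhs_nbhs; split=> //.
  exact: cdom_open.
by apply: filterS => y; rewrite -overlapP.
Unshelve. all: by end_near. Qed.

End overlaps.

Section geodesics.
Variables (R : realType) (m : nat) (M : manifold R m) (G : christoffel M).
Hypothesis HG : linear_connection G.

Lemma christoffel_bilin c x : atlas M c -> cimg c x -> bilin (G c x).
Proof. by case: HG => + _ _ => h Mc cx; exact: h. Qed.

Lemma christoffel_smooth c u v : atlas M c -> smooth_on (cimg c) (fun x => G c x u v).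
Proof. by case: HG => _ + _ => h Mc; exact: h. Qed.

(** The curve solves the equation in the chart [c], but [geodesic] asks for it in every chart. In
    [c'] the second derivative of [tau \o x] comes from [is_derive_along], and the transformation
    law of Christoffel symbols is exactly what makes the terms cancel. *)
Lemma geodesic_exists c x0 v0 : atlas M c -> cimg c x0 ->
  exists d : R, exists x v : R -> 'rV[R]_m, [/\ 0 < d, x 0 = x0, v 0 = v0,
    (forall t : R, `|t| < d -> [/\ cimg c (x t), is_derive t 1 x (v t) &
       is_derive t 1 v (- G c (x t) (v t) (v t))])
    & geodesic G [set t : R | `|t| < d] (fun t => cinv c (x t))].
Proof.
move=> Mc cx0.
have [d [x [v [d0 x0E v0E hxv]]]] :=
  @second_order_ode R m (cimg c) (G c) x0 v0 (@cimg_open _ _ _ c)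
   (fun x cx => christoffel_bilin Mc cx) (fun a b => christoffel_smooth a b Mc) cx0.
exists d, x, v; split=> //.
have JE : [set t : R | `|t| < d] = ball (0 : R) d.
  by apply/seteqP; split=> t /=; rewrite -ball_normE /ball_ /= sub0r normrN.
split.
- rewrite JE; exact: ball_open.
- by move=> a b /= ha hb t /andP[at_ tb]; move: ha hb; rewrite !ltr_norml => /andP[? ?] /andP[? ?]; apply/andP; split; [exact: lt_le_trans at_ | exact: le_lt_trans tb _].
- move=> t td; have [ct [dx _] _] := hxv t td.
  apply: (@continuous_comp _ _ _ x (cinv c)); last exact: cinv_continuous.
  by apply/differentiable_continuous/derivable1_diffP.
move=> c' Mc' t td c't y.
pose tau := transition c c'.
have oO : open (overlap c c') := @open_overlap _ _ _ c c'.
have stau : smooth_on (overlap c c') tau := atlas_smooth Mc Mc'.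
have [ct [dxt ext] [dvt evt]] := hxv t td.
have Ot : overlap c c' (x t) by apply/overlapP; split.
have nJ : \forall s \near t, `|s| < d.
  have cn : (fun s : R => `|s|) @ t --> `|t| by exact: norm_continuous.
  exact: (cvgr_lt _ cn _ td).
have cxt : {for t, continuous x} := differentiable_continuous ((derivable1_diffP x t).1 dxt).
have nO : \forall s \near t, overlap c c' (x s).
  by apply: cxt; exact: open_nbhs_nbhs.
have dx1 s : `|s| < d -> differentiable x s.
  by move=> sd; have [_ [h _] _] := hxv s sd; exact: ((derivable1_diffP x s).1 h).
have y1 s : `|s| < d -> overlap c c' (x s) -> is_derive s 1 y ('D_(v s) tau (x s)).
  move=> sd Os; have dtau := smooth_differentiable oO stau Os.
  split.
    apply/derivable1_diffP; exact: (differentiable_comp (dx1 s sd) dtau).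
  have [_ [_ e] _] := hxv s sd.
  have ch := @derive_chain R R _ _ x tau s (1 : R) (dx1 s sd) dtau.
  by refine (etrans ch _); rewrite e.
have y1' : \forall s \near t, 'D_(v s) tau (x s) = derive1 y s.
  near=> s; rewrite derive1E; have [||_ ->] // := y1 s.
    by near: s; exact: nJ.
  by near: s; exact: nO.
have A := is_derive_along oO stau Ot (dx1 t td) dvt.
rewrite ext evt in A.
have [dy2 ey2] := near_eq_is_derive y1' A.
have [dy1 ey1] := y1 t td Ot.
split; [exact: dy1|exact: dy2|].
have E2 := etrans (derive1E (derive1 y) t) ey2.
have E1 := etrans (derive1E y t) ey1.
rewrite E2 E1.
have law := let: And3 _ _ h := HG in h c c' Mc Mc' (x t) Ot (v t) (v t).
have lin := derive_linear (smooth_differentiable oO stau Ot).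
have -> : 'D_(- G c (x t) (v t) (v t)) tau (x t) = - 'D_(G c (x t) (v t) (v t)) tau (x t).
  by have := lin (-1) (G c (x t) (v t) (v t)) 0; rewrite !scaleN1r addr0 derive0 addr0.
move: law; rewrite -/tau -[tau (x t)]/(y t) => ->.
move: ('D_(v t) _ _) => a.
by rewrite opprD addrA subrr add0r addNr.
Unshelve. all: by end_near. Qed.

End geodesics.

(** * Totally geodesic submanifolds *)

Lemma christoffel_sym (R : realType) (m : nat) (M : manifold R m) (G : christoffel M) c x u v :
  torsion_free G -> atlas M c -> cimg c x -> G c x u v = G c x v u.
Proof.
move=> tf Mc cx; have sc (w : 'rV[R]_m) : vector_field c (fun=> w) by exact: smooth_cst.
have := tf c Mc (fun=> u) (fun=> v) (sc u) (sc v) x cx.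
rewrite /covd /lie; have D0 (a b : 'rV[R]_m) : 'D_a (fun=> b) x = 0 :> 'rV[R]_m by exact: derive_cst.
by rewrite !D0 !add0r oppr0 => /eqP; rewrite subr_eq0 => /eqP.
Qed.

Section totally_geodesic_submanifold.
Variables (R : realType) (k m : nat) (M : manifold R m) (G : christoffel M).
Hypotheses (HG : linear_connection G) (tfG : torsion_free G).
Variables (S : manifold R k) (i : S -> M).
Hypotheses (subi : submanifold i) (tgi : totally_geodesic G i).

Lemma local_domP d c x :
  local_dom i d c x <-> cimg d x /\ cdom c (i (cinv d x)).
Proof.
split=> [[q [dq cq] <-]|[dx cx]].
  by split; [exact: cmap_img|rewrite cmapK].
by exists (cinv d x); [split=> //; exact: cinv_dom|exact: cinvK].
Qed.

Lemma open_local_dom d c : open (local_dom i d c).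
Proof.
have [_ ci _] := subi.
rewrite openE => x /local_domP[dx cx]; rewrite /interior.
have nc : nbhs (i (cinv d x)) (cdom c).
  by apply: open_nbhs_nbhs; split=> //; exact: cdom_open.
have : \forall y \near x, cimg d y /\ cdom c (i (cinv d y)).
  near=> y; split.
    by near: y; apply: open_nbhs_nbhs; split=> //; exact: cimg_open.
  near: y; exact: (cinv_continuous dx (ci (cinv d x) _ nc)).
by apply: filterS => y; rewrite -local_domP.
Unshelve. all: by end_near. Qed.

(* The geodesic of initial velocity ['D_w phi x] lies in [S], hence has second
   order contact with [phi] along [w], modulo tangent vectors. *)
Lemma second_fundamental_diag d c x w : atlas S d -> atlas M c -> local_dom i d c x ->
  exists u, 'D_w (fun y => 'D_w (local_rep i d c) y) x +
     G c (local_rep i d c x) ('D_w (local_rep i d c) x) ('D_w (local_rep i d c) x)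
   = 'D_u (local_rep i d c) x.
Proof.
move=> Sd Mc Ox; set phi := local_rep i d c.
have [inji ci /(_ d c Sd Mc)[sphi imm]] := subi.
have oO : open (local_dom i d c) := @open_local_dom d c.
have /local_domP[dx cx] := Ox.
pose q := cinv d x.
have cphi : cimg c (phi x) by exact: cmap_img.
have [e [xi [v [e0 xi0 v0 hxv geo]]]] := geodesic_exists HG ('D_w phi x) Mc cphi.
have J0 : `|0 : R| < e by rewrite normr0.
have g0 : cinv c (xi 0) = i q by rewrite xi0 /phi /local_rep cmapK.
have cmg (t : R) : `|t| < e -> cmap c (cinv c (xi t)) = xi t.
  by move=> te; have [h _ _] := hxv t te; exact: cinvK.
have nJ : \forall t \near (0 : R), `|t| < e.
  have cn : (fun s : R => `|s|) @ (0 : R) --> `|0 : R| by exact: norm_continuous.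
  exact: (cvgr_lt _ cn _ J0).
have [ct0 [dxi0 exi0] [dv0 ev0]] := hxv 0 J0.
have D0 : 'D_1 (cmap c \o (fun t => cinv c (xi t))) 0 = 'D_w phi x.
  have n : \forall t \near (0 : R), xi t = (cmap c \o (fun t => cinv c (xi t))) t.
    by apply: filterS nJ => t te /=; rewrite cmg.
  refine (etrans (esym (near_eq_derive _ n)) _).
  by rewrite exi0 v0.
have [connS tg] := tgi.
have [|h [ch ih]] := tg _ _ geo 0 q J0 g0.
  exists c; split=> //; first by rewrite g0.
  exists d; first by split=> //; exact: cinv_dom.
  exists w; rewrite -[RHS]/(derive1 (cmap c \o (fun t => cinv c (xi t))) 0).
  rewrite (cinvK dx); exact: (esym (etrans (derive1E _ _) D0)).
have h0 : h 0 = q by apply: inji; rewrite (ih 0 J0).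
have dq : cdom d q by exact: cinv_dom.
have cmq : cmap d q = x by exact: cinvK.
pose z t := cmap d (h t).
have z0 : z 0 = x by rewrite /z h0.
have cz : {for 0, continuous z}.
  apply: (@continuous_comp _ _ _ h (cmap d)); first exact: (ch 0 J0).
  by rewrite h0; exact: cmap_continuous.
have nd : \forall t \near (0 : R), cdom d (h t).
  apply: (ch 0 J0); rewrite h0; apply: open_nbhs_nbhs; split=> //; exact: cdom_open.
have phiz : \forall t \near (0 : R), phi (z t) = xi t.
  near=> t; have te : `|t| < e by near: t; exact: nJ.
  have dh : cdom d (h t) by near: t; exact: nd.
  by rewrite /phi /local_rep /z cmapK // ih // cmg.
have dxi : \forall t \near (0 : R), derivable xi t 1.
  by apply: filterS nJ => t te; have [_ [h1 _] _] := hxv t te.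
have vxi : \forall t \near (0 : R), v t = 'D_1 xi t.
  by apply: filterS nJ => t te; have [_ [_ ->] _] := hxv t te.
have [ddxi eddxi] := near_eq_is_derive vxi (DeriveDef dv0 ev0).
have Dxi0 : 'D_1 xi 0 = 'D_w phi x by rewrite exi0 v0.
have dphi := smooth_differentiable oO sphi Ox.
pose J := jacobian phi x.
have DJ a : 'D_a phi x = a *m J by exact: deriveEjacobian.
pose B := 'D_w (fun y => 'D_w phi y) x + G c (phi x) ('D_w phi x) ('D_w phi x).
rewrite -/B; suff /submxP[u uE] : (B <= J)%MS.
  by exists u; rewrite DJ.
(* A vector is tangent when every column of [cokermx J] kills it. Each column is a linear form [T]
   to which the contact lemma applies; the geodesic equation replaces the acceleration by minus the
   Christoffel term. *)
rewrite submxE; apply/eqP/matrixP => a b; rewrite (ord1 a) [RHS]mxE.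
pose T := col b (cokermx J).
have T0 a' : 'D_a' phi x *m T = 0.
  by rewrite DJ /T colE -mulmxA (mulmxA J) mulmx_coker mul0mx mulmx0.
have := contact_second_order oO sphi Ox (imm x Ox) cz z0 phiz dxi ddxi Dxi0 T0.
rewrite eddxi xi0 v0 => E.
have : (B *m T) 0 0 = 0.
  by rewrite /B mulmxDl E mulNmx addNr mxE.
by rewrite /T colE mulmxA -colE mxE.
Unshelve. all: by end_near. Qed.

(** Polarization of the diagonal case: the left side is bilinear in [v] and [w], and symmetric by
    the symmetry of second derivatives and the absence of torsion. *)
Lemma second_fundamental d c x v w : atlas S d -> atlas M c -> local_dom i d c x ->
  exists u, 'D_v (fun y => 'D_w (local_rep i d c) y) x +
     G c (local_rep i d c x) ('D_v (local_rep i d c) x) ('D_w (local_rep i d c) x)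
   = 'D_u (local_rep i d c) x.
Proof.
move=> Sd Mc Ox.
have [inji ci /(_ d c Sd Mc)[sphi imm]] := subi.
have oO : open (local_dom i d c) := @open_local_dom d c.
have /local_domP[dx cx] := Ox.
have cphi : cimg c (local_rep i d c x) by exact: cmap_img.
have diag u := second_fundamental_diag u Sd Mc Ox.
move: (local_dom i d c) (local_rep i d c) Ox sphi imm cphi diag oO.
move=> O phi Ox sphi _ cphi diag oO.
have bG := christoffel_bilin HG Mc cphi.
have dphi := smooth_differentiable oO sphi Ox.
have Dlin (f : 'rV[R]_k -> 'rV[R]_m) y : differentiable f y ->
    forall p q, 'D_(p + q) f y = 'D_p f y + 'D_q f y.
  by move=> df p q; have := derive_linear df 1 p q; rewrite !scale1r.
have sD p : smooth_on O (fun y => 'D_p phi y) by exact: smooth_derive.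
have DD p q r : 'D_p (fun y => 'D_(q + r) phi y) x =
    'D_p (fun y => 'D_q phi y) x + 'D_p (fun y => 'D_r phi y) x.
  have n : \forall y \near x, 'D_(q + r) phi y = ((fun y => 'D_q phi y) + (fun y => 'D_r phi y)) y.
    near=> y; apply: Dlin; apply: (smooth_differentiable oO sphi).
    by near: y; exact: open_nbhs_nbhs.
  refine (etrans (near_eq_derive _ n) _); apply: deriveD.
    exact: smooth_derivable (sD q) Ox.
  exact: smooth_derivable (sD r) Ox.
pose B p q := 'D_p (fun y => 'D_q phi y) x + G c (phi x) ('D_p phi x) ('D_q phi x).
have BDr p q r : B p (q + r) = B p q + B p r.
  have e1 := f_equal (G c (phi x) ('D_p phi x)) (Dlin phi x dphi q r).
  have e2 := etrans e1 (bilinDr _ _ _ bG).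
  exact: (etrans (f_equal2 +%R (DD p q r) e2) (addrACA _ _ _ _)).
have BC p q : B p q = B q p.
  have e1 := christoffel_sym ('D_p phi x) ('D_q phi x) tfG Mc cphi.
  exact: (f_equal2 +%R (smooth_schwarz oO p q sphi Ox) e1).
have diagB u : exists a, B u u = 'D_a phi x := diag u.
suff : exists a, B v w = 'D_a phi x by exact.
have [a ha] := diagB (v + w); have [b hb] := diagB v; have [e he] := diagB w.
have DJ p : 'D_p phi x = p *m jacobian phi x by exact: deriveEjacobian.
clearbody B.
have -> : B v w = 2^-1 *: (B (v + w) (v + w) - B v v - B w w).
  rewrite BDr !(BC (v + w)) !BDr (BC w v); move: (B v v) (B v w) (B w w) => p q r.
  by apply/rowP => l; rewrite !mxE; field.
exists (2^-1 *: (a - b - e)).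
by rewrite ha hb he !DJ -scalemxAl !mulmxBl.
Unshelve. all: by end_near. Qed.

End totally_geodesic_submanifold.

(** * Limits of matrix-valued functions *)

Section matrix_limits.
Variables (R : realType) (T : Type) (F : set_system T).
Context {FF : Filter F}.

Lemma cvg_mx p q (f : T -> 'M[R]_(p, q)) (l : 'M[R]_(p, q)) :
  (forall i j, (fun t => f t i j) @ F --> l i j) -> f @ F --> l.
Proof.
move=> h; apply/cvgrPdist_le => e e0; near=> t.
apply: normr_mx_le => [|i j]; first exact: ltW.
rewrite !mxE; move: i j; near: t.
apply: filter_forall => i; apply: filter_forall => j.
by move/cvgrPdist_le: (h i j); apply.
Unshelve. all: by end_near. Qed.

Lemma cvg_mx_coord p q (f : T -> 'M[R]_(p, q)) (l : 'M[R]_(p, q)) i j :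
  f @ F --> l -> (fun t => f t i j) @ F --> l i j.
Proof. by move=> h; exact: (cvg_comp _ _ h (@coord_continuous _ _ _ i j l)). Qed.

Lemma cvg_sum_ord n (f : 'I_n -> T -> R) (l : 'I_n -> R) :
  (forall i, f i @ F --> l i) -> (fun t => \sum_i f i t) @ F --> \sum_i l i.
Proof.
move=> h; elim: (index_enum _) => [|i s IH].
  rewrite big_nil (_ : (fun _ => _) = (fun=> 0)); first exact: cvg_cst.
  by apply/funext => t; rewrite big_nil.
rewrite big_cons (_ : (fun _ => _) = (fun t => f i t + \sum_(j <- s) f j t)).
  exact: cvgD.
by apply/funext => t; rewrite big_cons.
Qed.

Lemma cvg_mulmx p q r (f : T -> 'M[R]_(p, q)) (g : T -> 'M[R]_(q, r))
   (a : 'M[R]_(p, q)) (b : 'M[R]_(q, r)) :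
  f @ F --> a -> g @ F --> b -> (fun t => f t *m g t) @ F --> a *m b.
Proof.
move=> fa gb; apply: cvg_mx => i j.
rewrite mxE (_ : (fun _ => _) = (fun t => \sum_k f t i k * g t k j)); last first.
  by apply/funext => t; rewrite mxE.
by apply: cvg_sum_ord => k; apply: cvgM; exact: cvg_mx_coord.
Qed.

Lemma norm_mulmx_le p q r (A : 'M[R]_(p, q)) (B : 'M[R]_(q, r)) :
  `|A *m B| <= q%:R * `|A| * `|B|.
Proof.
apply: normr_mx_le => [|i j]; first by rewrite !mulr_ge0.
rewrite mxE (le_trans (ler_norm_sum _ _ _)) //.
apply: (@le_trans _ _ (\sum_(k < q) (`|A| * `|B|))).
  by apply: ler_sum => k _; rewrite normrM ler_pM // normr_coord_le.
by rewrite sumr_const card_ord -mulrA mulr_natl.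
Qed.

(* [C = b M^-1] without inverting [M]. *)
Lemma cvg_solution k (C b : T -> 'rV[R]_k) (N : T -> 'M[R]_k) (b0 : 'rV[R]_k) :
  (\forall t \near F, C t *m N t = b t) -> N @ F --> (1%:M : 'M[R]_k) -> b @ F --> b0 ->
  C @ F --> b0.
Proof.
move=> CN N1 bb; apply/cvgrPdist_le => e e0.
have b10 : 0 < `|b0| + 1 by rewrite ltr_wpDl.
have e20 : 0 < e / 2 by rewrite divr_gt0.
(* With [h <= 2^-1] the solution has norm at most [2 * (|b0| + 1)]; the second bound then puts [C t]
   within [e / 2] of [b t]. *)
pose h := Num.min 2^-1 (e / (4 * (`|b0| + 1))).
have h0 : 0 < h by rewrite lt_min invr_gt0 ltr0n /= divr_gt0 // mulr_gt0.
have h1 : h <= 2^-1 by rewrite ge_min lexx.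
have h2 : 4 * h * (`|b0| + 1) <= e.
  have : h <= e / (4 * (`|b0| + 1)) by rewrite ge_min lexx orbT.
  by rewrite ler_pdivlMr ?mulr_gt0 // mulrCA mulrA.
have hk : 0 < h / (k%:R + 1) by rewrite divr_gt0 // ltr_wpDl.
move/cvgrPdist_le: N1 => N1; move/cvgrPdist_le: bb => bb.
near=> t.
have E : C t *m N t = b t by near: t; exact: CN.
have n1 : `|1%:M - N t| <= h / (k%:R + 1) by near: t; exact: N1.
have n2 : `|b0 - b t| <= e / 2 by near: t; exact: bb.
have n3 : `|b0 - b t| <= 1 by near: t; exact: bb.
move: (C t) (N t) (b t) E n1 n2 n3 => c n d E n1 n2 n3.
have D1 : `|c - d| <= h * `|c|.
  rewrite -E -[X in X - _]mulmx1 -mulmxBr (le_trans (norm_mulmx_le _ _)) //.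
  rewrite mulrAC [leRHS]mulrC [leLHS]mulrC ler_wpM2l //.
  apply: (@le_trans _ _ (k%:R * (h / (k%:R + 1)))); first by rewrite ler_wpM2l.
  rewrite mulrCA ler_piMr ?(ltW h0) // ler_pdivrMr ?ltr_wpDl // mul1r.
  by rewrite lerDl.
have D2 : `|c| <= `|c - d| + `|d| by rewrite -[X in `|X| <= _](subrK d) ler_normD.
have D3 : `|d| <= `|b0| + 1.
  rewrite -[d](subrK b0) (le_trans (ler_normD _ _)) // addrC lerD2l.
  by rewrite distrC.
have D4 : `|b0 - c| <= `|b0 - d| + `|c - d|.
  by rewrite -[b0](subrK d) -addrA (le_trans (ler_normD _ _)) // subrK (distrC d).
move: (`|c|) (`|c - d|) (`|d|) (`|b0 - c|) (`|b0 - d|) (`|b0|) D1 D2 D3 D4 n2 h2 (normr_ge0 (c - d)) => x y z p q r.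
move: (h) h0 h1 => a a0 a1 D1 D2 D3 D4 n2 h2 y0.
have : a * y <= 2^-1 * y by rewrite ler_wpM2r.
have : a * x <= a * (y + z) by rewrite ler_wpM2l // ltW.
have : a * z <= a * (r + 1) by rewrite ler_wpM2l // ltW.
rewrite mulrDr; lra.
Unshelve. all: by end_near. Qed.

End matrix_limits.

(** The coordinate formula for [R(a,b)w] with Christoffel symbols [H]; [curvature_tensor] relates it
    to [curvature]. *)
Definition riemann (R : realType) (m : nat)
  (H : 'rV[R]_m -> 'rV[R]_m -> 'rV[R]_m -> 'rV[R]_m) y a b w : 'rV[R]_m :=
  'D_a (fun z => H z b w) y - 'D_b (fun z => H z a w) y
  + H y a (H y b w) - H y b (H y a w).

Lemma derivable_cvg (R : realType) (V W : normedModType R) (f : V -> W) x v :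
  derivable f x v -> (fun h : R => h^-1 *: (f (h *: v + x) - f x)) @ 0^' --> 'D_v f x.
Proof. by []. Qed.

(** * Curvature along an immersion without second fundamental form *)

Section curvature_along.
Variables (R : realType) (k m : nat) (U : set 'rV[R]_m) (O : set 'rV[R]_k).
Variables (H : 'rV[R]_m -> 'rV[R]_m -> 'rV[R]_m -> 'rV[R]_m) (phi : 'rV[R]_k -> 'rV[R]_m).
Hypotheses (oU : open U) (oO : open O) (bH : forall y, U y -> bilin (H y))
  (sH : forall a b, smooth_on U (fun y => H y a b))
  (sphi : smooth_on O phi) (phiU : forall x, O x -> U (phi x)).
Variables (x0 : 'rV[R]_k) (Ox0 : O x0).
Hypothesis imm : forall v, 'D_v phi x0 = 0 -> v = 0.
Let B v w x := 'D_v (fun y => 'D_w phi y) x + H (phi x) ('D_v phi x) ('D_w phi x).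
Hypothesis BP : forall x v w, O x -> exists u, B v w x = 'D_u phi x.
Variable T : 'cV[R]_m.
Hypothesis T0 : forall v, 'D_v phi x0 *m T = 0.

Let sD v : smooth_on O (fun y => 'D_v phi y). Proof. exact: smooth_derive. Qed.
Let dphi x : O x -> differentiable phi x. Proof. exact: (smooth_differentiable oO sphi). Qed.

Let is_derive_B u v w : is_derive x0 u (fun x => B v w x)
  ('D_u (fun x => 'D_v (fun y => 'D_w phi y) x) x0 +
   ('D_('D_u phi x0) (fun z => H z ('D_v phi x0) ('D_w phi x0)) (phi x0)
    + H (phi x0) ('D_u (fun y => 'D_v phi y) x0) ('D_w phi x0)
    + H (phi x0) ('D_v phi x0) ('D_u (fun y => 'D_w phi y) x0))).
Proof.
have d1 : derivable (fun x => 'D_v (fun y => 'D_w phi y) x) x0 u.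
  exact: smooth_derivable (smooth_derive v (sD w)) Ox0.
have bn : \forall y \near x0, bilin (H (phi y)).
  near=> y; apply/bH/phiU; near: y; exact: open_nbhs_nbhs.
have dHab a b : differentiable (fun z => H z a b) (phi x0).
  exact: (smooth_differentiable oU (sH a b) (phiU Ox0)).
have dH a b : derivable (fun y => H (phi y) a b) x0 u.
  by apply: diff_derivable; exact: (differentiable_comp (dphi Ox0) (dHab a b)).
have A := is_derive_bilin bn dH (smooth_derivable (sD v) Ox0) (smooth_derivable (sD w) Ox0).
have e1 : 'D_u (fun y => H (phi y) ('D_v phi x0) ('D_w phi x0)) x0 =
   'D_('D_u phi x0) (fun z => H z ('D_v phi x0) ('D_w phi x0)) (phi x0).
  exact: (derive_chain u (dphi Ox0) (dHab _ _)).
rewrite -e1; exact: (is_deriveD (DeriveDef d1 erefl) A).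
Unshelve. all: by end_near. Qed.

Let J y : 'M[R]_(k, m) := \matrix_i 'D_(delta_mx 0 i) phi y.

Let DJ y v : O y -> 'D_v phi y = v *m J y.
Proof.
move=> Oy; rewrite (derive_delta _ (dphi Oy)) mulmx_sum_row.
by apply: eq_bigr => i _; rewrite rowK.
Qed.

Let sJ : smooth_on O J.
Proof.
apply/(smooth_mxP oO) => i j.
apply: (@smooth_ext _ _ _ oO _ (fun y => 'D_(delta_mx 0 i) phi y 0 j)) => [y _|].
  by rewrite mxE.
by move/(smooth_mxP oO) : (sD (delta_mx 0 i)); exact.
Qed.

Let along (u : 'rV[R]_k) : (fun h : R => h *: u + x0) @ 0^' --> x0.
Proof.
have h : (fun h : R => h *: u + x0) @ (0 : R) --> (0 : R) *: u + x0.
  by apply: cvgD; [apply: cvgZl; exact: cvg_id|exact: cvg_cst].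
rewrite scale0r add0r in h; by apply: cvg_trans h; apply: cvg_app; exact: cvg_within.
Qed.

(* Write [B v w] as ['D_C phi].  The coefficient [C] is only known to be
   continuous at [x0]; this is enough, since it multiplies [J T], which
   vanishes there. *)
Let normal_derivative u v w :
  'D_u (fun x => B v w x) x0 *m T = - (H (phi x0) ('D_u phi x0) (B v w x0) *m T).
Proof.
have [dB _] := is_derive_B u v w.
have tot y : exists c, O y -> B v w y = c *m J y.
  have [Oy|nO] := pselect (O y); last by exists 0.
  by have [c hc] := BP v w Oy; exists c => _; rewrite -DJ.
have [C hC] := choice tot.
have fJ : row_free (J x0).
  by apply: inj_row_free => c; rewrite -DJ //; exact: imm.
pose P := pinvmx (J x0); have JP : J x0 *m P = 1%:M by exact: mulmxVp.
have c0 := along u.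
have nO : \forall h \near (0 : R)^', O (h *: u + x0) by apply: c0; exact: open_nbhs_nbhs.
have cJ : (fun h : R => J (h *: u + x0)) @ 0^' --> J x0.
  exact: (cvg_comp _ _ c0 (smooth_continuous sJ Ox0)).
have cB : (fun h : R => B v w (h *: u + x0)) @ 0^' --> B v w x0.
  have cc : {for (0 : R), continuous (fun h : R => B v w (h *: u + x0))}.
    apply/differentiable_continuous/derivable1_diffP/derivable_line.
    by rewrite scale0r add0r.
  rewrite /prop_for /continuous_at scale0r add0r in cc.
  by apply: cvg_trans cc; apply: cvg_app; exact: cvg_within.
have C0 : B v w x0 *m P = C x0 by rewrite hC // -mulmxA JP mulmx1.
have cC : (fun h : R => C (h *: u + x0)) @ 0^' --> C x0.
  apply: (@cvg_solution _ _ _ _ _ _ (fun h => B v w (h *: u + x0) *m P)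
     (fun h => J (h *: u + x0) *m P)).
  - by apply: filterS nO => h Oh; rewrite hC // mulmxA.
  - by rewrite -JP; apply: cvg_mulmx => //; exact: cvg_cst.
  - by rewrite -C0; apply: cvg_mulmx => //; exact: cvg_cst.
have JT0 : J x0 *m T = 0.
  apply/row_matrixP => i; rewrite row_mul rowK T0 row0.
  by [].
have B0 : B v w x0 *m T = 0 by rewrite hC // -mulmxA JT0 mulmx0.
have lT p : continuous (mulmxr T : {linear 'M[R]_(p, m) -> 'M[R]_(p, 1)}).
  exact: (@linear_mx_continuous _ _ _ _ (mulmxr T)).
have [dBT eBT] := is_derive_linear (lT 1%N) dB.
have dJ : derivable J x0 u by exact: smooth_derivable sJ Ox0.
have [dJT eJT] := is_derive_linear (lT k) dJ.
have L1 : (fun h : R => h^-1 *: (B v w (h *: u + x0) *m T - B v w x0 *m T)) @ 0^' -->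
    'D_u (fun x => B v w x) x0 *m T.
  have h := derivable_cvg dBT; rewrite eBT in h; exact: h.
have L2 : (fun h : R => h^-1 *: (B v w (h *: u + x0) *m T - B v w x0 *m T)) @ 0^' -->
    C x0 *m ('D_u J x0 *m T).
  have h2 : (fun h : R => h^-1 *: (J (h *: u + x0) *m T - J x0 *m T)) @ 0^' --> 'D_u J x0 *m T.
    have h := derivable_cvg dJT; rewrite eJT in h; exact: h.
  refine (cvg_trans _ (cvg_mulmx cC h2)); apply: near_eq_cvg.
  apply: filterS nO => h Oh.
  by rewrite B0 JT0 !subr0 -scalemxAr hC // mulmxA.
have -> : 'D_u (fun x => B v w x) x0 *m T = C x0 *m ('D_u J x0 *m T).
  exact: (cvg_unique _ L1 L2).
pose c := C x0; rewrite -/c.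
have lc : continuous (mulmx c : {linear 'M[R]_(k, m) -> 'M[R]_(1, m)}).
  exact: (@linear_mx_continuous _ _ _ _ (mulmx c)).
have [dcJ ecJ] := is_derive_linear lc dJ.
have ec : 'D_u (fun y => 'D_c phi y) x0 = c *m 'D_u J x0.
  refine (etrans _ ecJ); apply: near_eq_derive; near=> y; apply: DJ.
  near: y; exact: open_nbhs_nbhs.
have Dc : 'D_c phi x0 = B v w x0 by rewrite DJ // hC.
(* With the coefficient frozen at [c = C x0], the vector [B u c] is again tangent, and ['D_c phi x0]
   is [B v w x0]; this turns [c *m 'D_u J x0 *m T] into the Christoffel term. *)
have [a ha] := BP u c Ox0.
have : B u c x0 *m T = 0 by rewrite ha T0.
by rewrite /B ec Dc mulmxDl -mulmxA => /eqP; rewrite addr_eq0 => /eqP.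
Unshelve. all: by end_near. Qed.

Hypothesis Hsym : forall y a b, U y -> H y a b = H y b a.

(** [normal_derivative] says that the covariant derivative of [B v w] along [u] is killed by [T].
    Exchanging [u] and [v] and subtracting, all terms with second or third derivatives of [phi]
    cancel, and the curvature is left. *)
Theorem riemann_along u v w :
  riemann H (phi x0) ('D_u phi x0) ('D_v phi x0) ('D_w phi x0) *m T = 0.
Proof.
have [_ e1] := is_derive_B u v w; have [_ e2] := is_derive_B v u w.
have n1 := normal_derivative u v w; have n2 := normal_derivative v u w.
rewrite e1 in n1; rewrite e2 in n2.
have Up := phiU Ox0; have bp := bH Up.
have s1 : 'D_v (fun x => 'D_u (fun y => 'D_w phi y) x) x0 = 'D_u (fun x => 'D_v (fun y => 'D_w phi y) x) x0.
  exact: (smooth_schwarz oO v u (sD w) Ox0).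
have s2 : 'D_v (fun y => 'D_u phi y) x0 = 'D_u (fun y => 'D_v phi y) x0.
  exact: (smooth_schwarz oO v u sphi Ox0).
rewrite /B (bilinDr _ _ _ bp) in n1; rewrite /B (bilinDr _ _ _ bp) in n2.
rewrite s1 s2 in n2; rewrite /riemann.
move: n1 n2.
move: ('D_u (fun x => 'D_v (fun y => 'D_w phi y) x) x0) ('D_u (fun y => 'D_v phi y) x0).
move: ('D_u (fun y => 'D_w phi y) x0) ('D_v (fun y => 'D_w phi y) x0) => uw vw uvw uv.
move: ('D_u phi x0) ('D_v phi x0) ('D_w phi x0) => pu pv pw.
move: ('D_pu _ _) ('D_pv _ _) => a b.
move: (H (phi x0) uv pw) (H (phi x0) pv uw) (H (phi x0) pu vw) (H _ pu (H _ _ _)) (H _ pv (H _ _ _)).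
move=> h1 h2 h3 h4 h5 n1 n2.
have e : (a - b + h4 - h5) = ((uvw + (a + h1 + h2)) + (h3 + h4)) - ((uvw + (b + h1 + h3)) + (h2 + h5)).
  by apply/rowP => j; rewrite !mxE; ring.
by rewrite e mulmxBl mulmxDl n1 addNr mulmxDl n2 addNr subr0.
Qed.

End curvature_along.

Section riemann_stable.
Variables (R : realType) (m : nat) (M : manifold R m) (G : christoffel M).
Hypotheses (HG : linear_connection G) (tfG : torsion_free G).

(** [tangent_space] allows any chart of [S] at [q]; this brings all tangent vectors to one chart
    [d]. *)
Lemma tangent_chart k (S : manifold R k) (i : S -> M) d d' c q w : submanifold i ->
  atlas S d -> atlas S d' -> atlas M c -> cdom d q -> cdom d' q -> cdom c (i q) ->
  'D_w (local_rep i d' c) (cmap d' q) =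
  'D_('D_w (transition d' d) (cmap d' q)) (local_rep i d c) (cmap d q).
Proof.
move=> subi Sd Sd' Mc dq d'q cq.
have [_ _ sm] := subi; have [sphi _] := sm d c Sd Mc.
have oO := @open_local_dom _ _ _ M S i subi d c.
have Oq : local_dom i d c (cmap d q) by exists q.
have Ox : overlap d' d (cmap d' q) by exists q.
have ov := @open_overlap _ _ _ d' d.
have st := atlas_smooth Sd' Sd.
have tq : transition d' d (cmap d' q) = cmap d q by rewrite /transition cmapK.
have n : \forall x \near cmap d' q,
    local_rep i d' c x = (local_rep i d c \o transition d' d) x.
  have nO : \forall x \near cmap d' q, overlap d' d x by exact: open_nbhs_nbhs.
  apply: filterS nO => x /overlapP[_ dx].
  by rewrite /= /local_rep /transition cmapK.
refine (etrans (near_eq_derive _ n) _); rewrite -tq; apply: derive_chain.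
  exact: (smooth_differentiable ov st Ox).
by rewrite tq; exact: (smooth_differentiable oO sphi Oq).
Qed.

Lemma riemann_stable k (S : manifold R k) (i : S -> M) c q (V : 'M[R]_m) (T : 'cV[R]_m) :
  submanifold i -> totally_geodesic G i -> atlas M c -> cdom c (i q) ->
  tangent_space i q c = [set u | (u <= V)%MS] ->
  (forall u : 'rV[R]_m, (u <= V)%MS -> u *m T = 0) ->
  forall u v w : 'rV[R]_m, (u <= V)%MS -> (v <= V)%MS -> (w <= V)%MS ->
  riemann (G c) (cmap c (i q)) u v w *m T = 0.
Proof.
move=> subi tgi Mc cq TV VT u v w uV vV wV.
have [d Sd dq] := atlas_cover q.
have [_ _ sm] := subi; have [sphi imm] := sm d c Sd Mc.
have Oq : local_dom i d c (cmap d q) by exists q.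
have lift (u' : 'rV[R]_m) : (u' <= V)%MS -> exists a, u' = 'D_a (local_rep i d c) (cmap d q).
  move=> u'V; have : tangent_space i q c u' by rewrite TV.
  move=> [d' [Sd' d'q] [a aE]]; exists ('D_a (transition d' d) (cmap d' q)).
  by rewrite -aE; exact: tangent_chart.
have [a ->] := lift u uV; have [b ->] := lift v vV; have [e ->] := lift w wV.
have -> : cmap c (i q) = local_rep i d c (cmap d q) by rewrite /local_rep cmapK.
apply: (riemann_along (U := cimg c) (O := local_dom i d c)) => //.
- exact: cimg_open.
- exact: (open_local_dom subi).
- by move=> y cy; exact: christoffel_bilin.
- by move=> a' b'; exact: christoffel_smooth.
- by move=> x /local_domP[_ cx]; exact: cmap_img.
- exact: imm.
- by move=> x v' w' Ox; exact: (second_fundamental HG tfG subi tgi v' w' Sd Mc Ox).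
- move=> v'; apply: VT.
  have : tangent_space i q c ('D_v' (local_rep i d c) (cmap d q)).
    by exists d => //; exists v'.
  by rewrite TV.
Qed.

End riemann_stable.

(** * Covariant derivatives and curvature in one chart *)

Section chart_calculus.
Variables (R : realType) (m : nat) (M : manifold R m) (G : christoffel M).
Hypotheses (HG : linear_connection G).
Variables (c : chart R m M) (Mc : atlas M c).
Local Notation E := 'rV[R]_m.
Local Notation U := (cimg c).
Local Notation vf := (vector_field c).

Let oU : open U. Proof. exact: cimg_open. Qed.
Let bG x : U x -> bilin (G c x). Proof. exact: christoffel_bilin. Qed.
Let sG a b : smooth_on U (fun x => G c x a b). Proof. exact: christoffel_smooth. Qed.

Lemma vf_cst u : vf (fun=> u).
Proof. exact: smooth_cst. Qed.

Lemma vf_derivable X v x : vf X -> U x -> derivable X x v.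
Proof. by move=> vX Ux; exact: smooth_derivable vX Ux. Qed.

Lemma vf_covd X Y : vf X -> vf Y -> vf (covd G c X Y).
Proof.
move=> vX vY; apply: smooth_add => //; last exact: smooth_bilin.
apply: (@smooth_ext _ _ _ oU _ (fun x => \sum_i X x 0 i *: 'D_(delta_mx 0 i) Y x)) => [x Ux|].
  by rewrite [RHS]derive_delta //; exact: smooth_differentiable vY Ux.
apply: smooth_sum => // i _; apply: smooth_scale => //; last exact: smooth_derive.
by move/(smooth_mxP oU) : vX; exact.
Qed.

Lemma is_derive_covd X Y x u : vf X -> vf Y -> U x ->
  is_derive x u (covd G c X Y)
   ('D_u (fun z => 'D_(X x) Y z) x + 'D_('D_u X x) Y x +
    ('D_u (fun z => G c z (X x) (Y x)) x + G c x ('D_u X x) (Y x)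
      + G c x (X x) ('D_u Y x))).
Proof.
move=> vX vY Ux.
have A := @is_derive_along _ _ _ _ _ _ Y id X x u oU vY Ux (@ex_diff _ _ _ _ _ _ _ (is_diff_id x)) (vf_derivable vX Ux).
rewrite derive_id in A.
have bn : \forall y \near x, bilin (G c y).
  near=> y; apply: bG; near: y; exact: open_nbhs_nbhs.
have dG a b : derivable (fun z => G c z a b) x u by exact: smooth_derivable (sG a b) Ux.
have B := is_derive_bilin bn dG (vf_derivable vX Ux) (vf_derivable vY Ux).
exact: (is_deriveD A B).
Unshelve. all: by end_near. Qed.

Lemma curvature_tensor X Y Z x : vf X -> vf Y -> vf Z -> U x ->
  curvature G c X Y Z x = riemann (G c) x (X x) (Y x) (Z x).
Proof.
move=> vX vY vZ Ux.
have [_ e1] := is_derive_covd (X x) vY vZ Ux; have [_ e2] := is_derive_covd (Y x) vX vZ Ux.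
have dZ := smooth_differentiable oU vZ Ux.
have sch : 'D_(Y x) (fun z => 'D_(X x) Z z) x = 'D_(X x) (fun z => 'D_(Y x) Z z) x.
  exact: (smooth_schwarz oU (Y x) (X x) vZ Ux).
have eL : 'D_(lie X Y x) Z x = 'D_('D_(X x) Y x) Z x - 'D_('D_(Y x) X x) Z x.
  have e3 : lie X Y x = (-1) *: 'D_(Y x) X x + 'D_(X x) Y x.
    by rewrite /lie scaleN1r addrC.
  refine (etrans (f_equal (fun v => 'D_v Z x) e3) (etrans (derive_linear dZ _ _ _) _)).
  by rewrite [X in X + _ = _]scaleN1r [LHS]addrC.
have eG : G c x (lie X Y x) (Z x) = G c x ('D_(X x) Y x) (Z x) - G c x ('D_(Y x) X x) (Z x).
  refine (etrans (bilinDl _ _ _ (bG Ux)) _); apply: (f_equal (+%R _)).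
  have e3 : - 'D_(Y x) X x = (-1) *: 'D_(Y x) X x by rewrite scaleN1r.
  refine (etrans (f_equal (fun v => G c x v (Z x)) e3) _).
  by refine (etrans (bilinZl _ _ _ (bG Ux)) _); exact: scaleN1r.
rewrite /curvature /riemann.
have -> : covd G c X (covd G c Y Z) x = 'D_(X x) (covd G c Y Z) x + G c x (X x) (covd G c Y Z x) by [].
have -> : covd G c Y (covd G c X Z) x = 'D_(Y x) (covd G c X Z) x + G c x (Y x) (covd G c X Z x) by [].
have -> : covd G c (lie X Y) Z x = 'D_(lie X Y x) Z x + G c x (lie X Y x) (Z x) by [].
rewrite e1 e2 eL eG sch.
have eYZ : G c x (X x) (covd G c Y Z x) = G c x (X x) ('D_(Y x) Z x) + G c x (X x) (G c x (Y x) (Z x)).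
  exact: (bilinDr _ _ _ (bG Ux)).
have eXZ : G c x (Y x) (covd G c X Z x) = G c x (Y x) ('D_(X x) Z x) + G c x (Y x) (G c x (X x) (Z x)).
  exact: (bilinDr _ _ _ (bG Ux)).
rewrite eYZ eXZ.
move: ('D_(X x) (fun z => 'D_(Y x) Z z) x) ('D_('D_(X x) Y x) Z x) ('D_('D_(Y x) X x) Z x) => a1 a2 a3.
move: ('D_(X x) (fun z => G c z (Y x) (Z x)) x) ('D_(Y x) (fun z => G c z (X x) (Z x)) x) => a4 a5.
move: (G c x ('D_(X x) Y x) (Z x)) (G c x ('D_(Y x) X x) (Z x)) (G c x (Y x) ('D_(X x) Z x)) => a6 a7 a8.
move: (G c x (X x) ('D_(Y x) Z x)) (G c x (X x) (G c x (Y x) (Z x))) (G c x (Y x) (G c x (X x) (Z x))) => a9 b1 b2.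
by apply/rowP => j; rewrite !mxE; ring.
Qed.

End chart_calculus.

(** * Curvature identities *)

Section curvature_identities.
Variables (R : realType) (m : nat) (M : manifold R m) (G : christoffel M).
Variables (om A : mx_field M).
Hypotheses (HG : linear_connection G) (tfG : torsion_free G)
  (parom : parallel_form G om) (parA : parallel_endo G A).
Hypothesis som : forall c, atlas M c -> smooth_on (cimg c) (om c).
Hypothesis sA : forall c, atlas M c -> smooth_on (cimg c) (A c).
Variables (c : chart R m M) (Mc : atlas M c).
Local Notation E := 'rV[R]_m.
Local Notation U := (cimg c).
Local Notation Rm := (riemann (G c)).

Let oU : open U. Proof. exact: cimg_open. Qed.
Let bG x : U x -> bilin (G c x). Proof. exact: christoffel_bilin. Qed.
Let sG a b : smooth_on U (fun x => G c x a b). Proof. exact: christoffel_smooth. Qed.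

Let linD (a a' b b' e e' f f' : E) :
  (a + a') - (b + b') + (e + e') - (f + f') = (a - b + e - f) + (a' - b' + e' - f').
Proof. by apply/rowP => j; rewrite !mxE; ring. Qed.
Let linZ k (a b e f : E) :
  k *: a - k *: b + k *: e - k *: f = k *: (a - b + e - f).
Proof. by apply/rowP => j; rewrite !mxE; ring. Qed.
Let lin3 (a b d a' b' d' : E) :
  (a - b + a' - b') + (b - d + b' - d') + (d - a + d' - a') = 0.
Proof. by apply/rowP => j; rewrite !mxE; ring. Qed.

Lemma riemannN x u v w : Rm x u v w = - Rm x v u w.
Proof.
have gen (a b d e : E) : a - b + d - e = - (b - a + e - d).
  by apply/rowP => j; rewrite !mxE; ring.
exact: gen.
Qed.

Lemma riemannDl x u u' v w : U x -> Rm x (u + u') v w = Rm x u v w + Rm x u' v w.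
Proof.
move=> Ux; have b := bG Ux.
have e1 : 'D_(u + u') (fun z => G c z v w) x = 'D_u (fun z => G c z v w) x + 'D_u' (fun z => G c z v w) x.
  have := derive_linear (smooth_differentiable oU (sG v w) Ux) 1 u u'.
  by rewrite !scale1r.
have e2 : 'D_v (fun z => G c z (u + u') w) x = 'D_v (fun z => G c z u w) x + 'D_v (fun z => G c z u' w) x.
  have n : \forall z \near x, G c z (u + u') w = ((fun z => G c z u w) + (fun z => G c z u' w)) z.
    near=> z; apply: bilinDl; apply: bG; near: z; exact: open_nbhs_nbhs.
  refine (etrans (near_eq_derive _ n) _); apply: deriveD; exact: smooth_derivable (sG _ _) Ux.
have e3 : G c x (u + u') (G c x v w) = G c x u (G c x v w) + G c x u' (G c x v w) := bilinDl _ _ _ b.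
have e4 : G c x v (G c x (u + u') w) = G c x v (G c x u w) + G c x v (G c x u' w).
  by rewrite (bilinDl _ _ _ b) (bilinDr _ _ _ b).
rewrite /riemann e1 e2 e3 e4.
exact: linD.
Unshelve. all: by end_near. Qed.

Lemma riemannZl x k u v w : U x -> Rm x (k *: u) v w = k *: Rm x u v w.
Proof.
move=> Ux; have b := bG Ux.
have e1 : 'D_(k *: u) (fun z => G c z v w) x = k *: 'D_u (fun z => G c z v w) x.
  by have [_] := is_derive_scale k (smooth_derivable (v := u) (sG v w) Ux).
have e2 : 'D_v (fun z => G c z (k *: u) w) x = k *: 'D_v (fun z => G c z u w) x.
  have n : \forall z \near x, G c z (k *: u) w = (k \*: (fun z => G c z u w)) z.
    near=> z; apply: bilinZl; apply: bG; near: z; exact: open_nbhs_nbhs.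
  refine (etrans (near_eq_derive _ n) _); apply: deriveZ; exact: smooth_derivable (sG _ _) Ux.
have e3 : G c x (k *: u) (G c x v w) = k *: G c x u (G c x v w) := bilinZl _ _ _ b.
have e4 : G c x v (G c x (k *: u) w) = k *: G c x v (G c x u w).
  by rewrite (bilinZl _ _ _ b) (bilinZr _ _ _ b).
rewrite /riemann e1 e2 e3 e4.
exact: linZ.
Unshelve. all: by end_near. Qed.

Lemma riemannDr x u v w w' : U x -> Rm x u v (w + w') = Rm x u v w + Rm x u v w'.
Proof.
move=> Ux; have b := bG Ux.
have e2 p q : 'D_p (fun z => G c z q (w + w')) x = 'D_p (fun z => G c z q w) x + 'D_p (fun z => G c z q w') x.
  have n : \forall z \near x, G c z q (w + w') = ((fun z => G c z q w) + (fun z => G c z q w')) z.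
    near=> z; apply: bilinDr; apply: bG; near: z; exact: open_nbhs_nbhs.
  refine (etrans (near_eq_derive _ n) _); apply: deriveD; exact: smooth_derivable (sG _ _) Ux.
have e4 p q : G c x p (G c x q (w + w')) = G c x p (G c x q w) + G c x p (G c x q w').
  by rewrite !(bilinDr _ _ _ b).
rewrite /riemann (e2 u v) (e2 v u) (e4 u v) (e4 v u).
exact: linD.
Unshelve. all: by end_near. Qed.

Lemma riemannZr x k u v w : U x -> Rm x u v (k *: w) = k *: Rm x u v w.
Proof.
move=> Ux; have b := bG Ux.
have e2 p q : 'D_p (fun z => G c z q (k *: w)) x = k *: 'D_p (fun z => G c z q w) x.
  have n : \forall z \near x, G c z q (k *: w) = (k \*: (fun z => G c z q w)) z.
    near=> z; apply: bilinZr; apply: bG; near: z; exact: open_nbhs_nbhs.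
  refine (etrans (near_eq_derive _ n) _); apply: deriveZ; exact: smooth_derivable (sG _ _) Ux.
have e4 p q : G c x p (G c x q (k *: w)) = k *: G c x p (G c x q w).
  by rewrite !(bilinZr _ _ _ b).
rewrite /riemann (e2 u v) (e2 v u) (e4 u v) (e4 v u).
exact: linZ.
Unshelve. all: by end_near. Qed.

Lemma riemann_Bianchi x u v w : U x -> Rm x u v w + Rm x v w u + Rm x w u v = 0.
Proof.
move=> Ux.
have Gs a b z : U z -> G c z a b = G c z b a by exact: christoffel_sym.
have Ds p a b : 'D_p (fun z => G c z a b) x = 'D_p (fun z => G c z b a) x.
  apply: near_eq_derive; near=> z; apply: Gs; near: z; exact: open_nbhs_nbhs.
rewrite /riemann (Ds v u w) (Ds w v u) (Ds u w v).
rewrite (Gs v w x Ux) (Gs w u x Ux) (Gs v u x Ux).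
exact: lin3.
Unshelve. all: by end_near. Qed.

(* Coordinate fields commute, so the bracket term of the curvature vanishes. *)
Lemma curvature_coord u v Z x : vector_field c Z -> U x ->
  curvature G c (fun=> u) (fun=> v) Z x =
  covd G c (fun=> u) (covd G c (fun=> v) Z) x - covd G c (fun=> v) (covd G c (fun=> u) Z) x.
Proof.
move=> vZ Ux; rewrite /curvature.
have l0 : lie (fun=> u) (fun=> v) x = 0 :> E.
  have D0 (a b : E) : 'D_a (fun=> b) x = 0 :> E by exact: derive_cst.
  by rewrite /lie !D0 subrr.
have -> : covd G c (lie (fun=> u) (fun=> v)) Z x = 0.
  by rewrite /covd l0 derive0 (bilin0l _ (bG Ux)) addr0.
by rewrite subr0.
Qed.

(** The derivatives along [u] and [v] of the function [bil (om c y) z t] commute. Expanding both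
    orders with [parallel_form], the products of two first derivatives agree and the curvature terms
    remain. *)
Lemma riemann_sp x u v z t : U x ->
  bil (om c x) (Rm x u v z) t + bil (om c x) z (Rm x u v t) = 0.
Proof.
move=> Ux; have vc w : vector_field c (fun=> w) by exact: vf_cst.
have vcov a b : vector_field c (covd G c (fun=> a) (fun=> b)) by exact: vf_covd.
pose f y := bil (om c y) z t.
have sf : smooth_on U f by apply: smooth_bil => //; [exact: som|exact: smooth_cst|exact: smooth_cst].
have Df a y : U y -> 'D_a f y = bil (om c y) (covd G c (fun=> a) (fun=> z) y) t
    + bil (om c y) z (covd G c (fun=> a) (fun=> t) y).
  by move=> Uy; exact: (parom Mc (vc a) (vc z) (vc t) Uy).
have Dfn a : {near x, (fun y => 'D_a f y) =1 (fun y => bil (om c y) (covd G c (fun=> a) (fun=> z) y) t)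
    + (fun y => bil (om c y) z (covd G c (fun=> a) (fun=> t) y))}.
  near=> y; apply: Df; near: y; exact: open_nbhs_nbhs.
have DDf b a : 'D_b (fun y => 'D_a f y) x =
    (bil (om c x) (covd G c (fun=> b) (covd G c (fun=> a) (fun=> z)) x) t +
     bil (om c x) (covd G c (fun=> a) (fun=> z) x) (covd G c (fun=> b) (fun=> t) x)) +
    (bil (om c x) (covd G c (fun=> b) (fun=> z) x) (covd G c (fun=> a) (fun=> t) x) +
     bil (om c x) z (covd G c (fun=> b) (covd G c (fun=> a) (fun=> t)) x)).
  refine (etrans (near_eq_derive _ (Dfn a)) _).
  refine (etrans (deriveD _ _) _).
  - apply: (smooth_derivable _ Ux); apply: smooth_bil => //; first exact: som.
      exact: vcov.
    exact: smooth_cst.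
  - apply: (smooth_derivable _ Ux); apply: smooth_bil => //; first exact: som.
      exact: smooth_cst.
    exact: vcov.
  exact: (f_equal2 +%R (parom Mc (vc b) (vcov a z) (vc t) Ux) (parom Mc (vc b) (vc z) (vcov a t) Ux)).
have sch : 'D_u (fun y => 'D_v f y) x = 'D_v (fun y => 'D_u f y) x.
  exact: (smooth_schwarzR oU u v sf Ux).
rewrite (DDf u v) (DDf v u) in sch.
have eR w : Rm x u v w = covd G c (fun=> u) (covd G c (fun=> v) (fun=> w)) x
    - covd G c (fun=> v) (covd G c (fun=> u) (fun=> w)) x.
  by rewrite -(curvature_coord u v (vc w) Ux) curvature_tensor.
rewrite !eR bilBl bilBr.
have gen (a1 a2 a3 a4 b1 b4 : R) : a1 + a2 + (a3 + a4) = b1 + a3 + (a2 + b4) ->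
  a1 - b1 + (a4 - b4) = 0 by lra.
exact: (gen _ _ _ _ _ _ sch).
Unshelve. all: by end_near. Qed.

Lemma covd_ext X Y Y' x : U x -> (forall y, U y -> Y y = Y' y) ->
  covd G c X Y x = covd G c X Y' x.
Proof.
move=> Ux YY'; have n : \forall y \near x, Y y = Y' y.
  near=> y; apply: YY'; near: y; exact: open_nbhs_nbhs.
exact: (f_equal2 +%R (near_eq_derive _ n) (f_equal (G c x (X x)) (YY' x Ux))).
Unshelve. all: by end_near. Qed.

Lemma covdB X Y Y' x : vector_field c Y -> vector_field c Y' -> U x ->
  covd G c X (fun y => Y y - Y' y) x = covd G c X Y x - covd G c X Y' x.
Proof.
move=> vY vY' Ux.
have e1 : 'D_(X x) (fun y => Y y - Y' y) x = 'D_(X x) Y x - 'D_(X x) Y' x.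
  by apply: deriveB; [exact: vf_derivable vY Ux|exact: vf_derivable vY' Ux].
have e2 : G c x (X x) (Y x - Y' x) = G c x (X x) (Y x) - G c x (X x) (Y' x).
  refine (etrans (bilinDr _ _ _ (bG Ux)) _); apply: (f_equal (+%R _)).
  have e3 : - Y' x = (-1) *: Y' x by rewrite scaleN1r.
  refine (etrans (f_equal (G c x (X x)) e3) _).
  by refine (etrans (bilinZr _ _ _ (bG Ux)) _); exact: scaleN1r.
rewrite /covd e1 e2.
have gen (a b d e : E) : a - b + (d - e) = a + d - (b + e).
  by apply/rowP => j; rewrite !mxE; ring.
exact: gen.
Qed.

Lemma riemann_commute x u v z : U x -> Rm x u v (z *m A c x) = Rm x u v z *m A c x.
Proof.
move=> Ux; have vc w : vector_field c (fun=> w) by exact: vf_cst.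
have vcov a b : vector_field c (covd G c (fun=> a) (fun=> b)) by exact: vf_covd.
have vZ : vector_field c (fun y => z *m A c y).
  by apply: smooth_mulmx => //; [exact: smooth_cst|exact: sA].
have e1 a b : covd G c (fun=> a) (covd G c (fun=> b) (fun y => z *m A c y)) x =
    covd G c (fun=> a) (covd G c (fun=> b) (fun=> z)) x *m A c x.
  refine (etrans (covd_ext (Y' := fun y => covd G c (fun=> b) (fun=> z) y *m A c y) _ Ux _) _).
    by move=> y Uy; exact: (parA Mc (vc b) (vc z) Uy).
  exact: (parA Mc (vc a) (vcov b z) Ux).
have eR Z : vector_field c Z -> Rm x u v (Z x) = covd G c (fun=> u) (covd G c (fun=> v) Z) x
    - covd G c (fun=> v) (covd G c (fun=> u) Z) x.
  by move=> vZ'; rewrite -(curvature_coord u v vZ' Ux) curvature_tensor.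
refine (etrans (eR _ vZ) _); rewrite (e1 u v) (e1 v u) (eR _ (vc z)).
by rewrite mulmxBl.
Qed.

Lemma vf_riemann u v w : vector_field c (fun x => Rm x u v w).
Proof.
have vc a : vector_field c (fun=> a) by exact: vf_cst.
have vcov a b : vector_field c (covd G c (fun=> a) (fun=> b)) by exact: vf_covd.
apply: (@smooth_ext _ _ _ oU _ (fun x => covd G c (fun=> u) (covd G c (fun=> v) (fun=> w)) x
   + (-1) *: covd G c (fun=> v) (covd G c (fun=> u) (fun=> w)) x)) => [x Ux|].
  by rewrite scaleN1r -(curvature_coord u v (vc w) Ux) curvature_tensor.
apply: smooth_add => //; first exact: vf_covd.
by apply: smooth_scale => //; [exact: smooth_cst|exact: vf_covd].
Qed.

Definition covd_curvature W X Y Z x :=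
  covd G c W (curvature G c X Y Z) x - curvature G c (covd G c W X) Y Z x
  - curvature G c X (covd G c W Y) Z x - curvature G c X Y (covd G c W Z) x.

(** For coordinate fields the curvature is a commutator of covariant derivatives, so the triple
    products cancel as in the Jacobi identity. The terms with a differentiated field cancel in
    pairs, because [G c x a b] is symmetric in [a] and [b]. *)
Lemma second_Bianchi u v w z x : U x ->
  covd_curvature (fun=> u) (fun=> v) (fun=> w) (fun=> z) x +
  covd_curvature (fun=> v) (fun=> w) (fun=> u) (fun=> z) x +
  covd_curvature (fun=> w) (fun=> u) (fun=> v) (fun=> z) x = 0.
Proof.
move=> Ux; have vc a : vector_field c (fun=> a) by exact: vf_cst.
pose N a Z := covd G c (fun=> a) Z.
have vN a Z : vector_field c Z -> vector_field c (N a Z) by move=> vZ; exact: vf_covd.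
have e1 a b d : covd G c (fun=> a) (curvature G c (fun=> b) (fun=> d) (fun=> z)) x =
    N a (N b (N d (fun=> z))) x - N a (N d (N b (fun=> z))) x.
  refine (etrans (covd_ext (Y' := fun y => N b (N d (fun=> z)) y - N d (N b (fun=> z)) y) _ Ux _) _).
    by move=> y Uy; exact: curvature_coord.
  by apply: covdB => //; apply: (vN _ _ (vN _ _ (vc z))).
have e2 a b d : curvature G c (fun=> b) (fun=> d) (covd G c (fun=> a) (fun=> z)) x =
    N b (N d (N a (fun=> z))) x - N d (N b (N a (fun=> z))) x.
  by apply: curvature_coord => //; exact: (vN _ _ (vc z)).
have e3 a b : N a (fun=> b) x = G c x a b.
  have D0 : 'D_a (fun=> b) x = 0 :> E by exact: derive_cst.
  exact: (etrans (f_equal (+%R^~ _) D0) (add0r _)).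
have e4 a b d : curvature G c (covd G c (fun=> a) (fun=> b)) (fun=> d) (fun=> z) x =
    Rm x (G c x a b) d z.
  by rewrite curvature_tensor //; [rewrite -/(N a _) e3|exact: (vN _ _ (vc b))].
have e5 a b d : curvature G c (fun=> b) (covd G c (fun=> a) (fun=> d)) (fun=> z) x =
    - Rm x (G c x a d) b z.
  rewrite curvature_tensor //; last exact: (vN _ _ (vc d)).
  by rewrite -/(N a _) e3 riemannN.
rewrite /covd_curvature !e1 !e2 !e4 !e5.
have Gs a b : G c x a b = G c x b a by exact: christoffel_sym.
rewrite (Gs v u) (Gs w u) (Gs w v).
have gen (a1 a2 a3 a4 a5 a6 r1 r2 r3 : E) :
  (a1 - a2 - r1 - - r2 - (a3 - a4)) + (a3 - a5 - r3 - - r1 - (a6 - a2)) +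
  (a6 - a4 - r2 - - r3 - (a1 - a5)) = 0.
  by apply/rowP => j; rewrite !mxE; ring.
exact: gen.
Qed.

End curvature_identities.

(** * The curvature at a point *)

(** The vector-valued form of [model_curvature]: pairing with [B] gives back the latter. *)
Definition kmod (R : realType) (m : nat) (B A : 'M[R]_m) (x y z : 'rV[R]_m) : 'rV[R]_m :=
  (2 * bil B x y) *: (z *m A) + bil B x z *: (y *m A) - bil B y z *: (x *m A)
  + bil B x (z *m A) *: y - bil B y (z *m A) *: x.

Section pointwise.
Variables (R : realType) (m : nat) (B A : 'M[R]_m) (lambda : R).
Hypothesis alt : forall u, bil B u u = 0.
Hypothesis ndg : nondegenerate_on B 1%:M.
Hypothesis AA : A *m A = lambda%:M.
Hypothesis Asp : forall u v, bil B (u *m A) v + bil B u (v *m A) = 0.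
Hypothesis rkA : (3 <= \rank A)%N.
Hypothesis dimm : (5 <= m)%N.
Variable Rm : 'rV[R]_m -> 'rV[R]_m -> 'rV[R]_m -> 'rV[R]_m.
Hypotheses (RDl : forall a b y z, Rm (a + b) y z = Rm a y z + Rm b y z)
  (RZl : forall k a y z, Rm (k *: a) y z = k *: Rm a y z)
  (RDr : forall x y a b, Rm x y (a + b) = Rm x y a + Rm x y b)
  (RZr : forall k x y a, Rm x y (k *: a) = k *: Rm x y a)
  (RN : forall x y z, Rm x y z = - Rm y x z)
  (RB : forall x y z, Rm x y z + Rm y z x + Rm z x y = 0)
  (Rsp : forall x y z t, bil B (Rm x y z) t + bil B z (Rm x y t) = 0)
  (RA : forall x y z, Rm x y (z *m A) = Rm x y z *m A).
Hypothesis Rst : forall (V : 'M[R]_m) (T : 'cV[R]_m),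
  nondegenerate_on B V -> stablemx V A ->
  (forall u : 'rV[R]_m, (u <= V)%MS -> u *m T = 0) ->
  forall u v w : 'rV[R]_m, (u <= V)%MS -> (v <= V)%MS -> (w <= V)%MS ->
  Rm u v w *m T = 0.

Let f (u : 'rV[R]_m) := u *m A.
Let wC := bil_skew alt.
Let wA a b : bil B (f a) b = - bil B a (f b).
Proof. by have := Asp a b; rewrite /f; lra. Qed.
Let ff a : f (f a) = lambda *: a.
Proof. by rewrite /f -mulmxA AA mul_mx_scalar. Qed.
Let fD a b : f (a + b) = f a + f b. Proof. exact: mulmxDl. Qed.
Let fZ k a : f (k *: a) = k *: f a. Proof. by rewrite /f scalemxAl. Qed.

(** The span of [X], [f X], [Y], [f Y] is symplectic, being an orthogonal sum of two planes on which
    [B] is nonzero, and [A]-stable since [f (f a) = lambda *: a]. The form [bil B u T] in [u],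
    encoded by the column [T'], vanishes on it. *)
Let stable4 (X Y T : 'rV[R]_m) : Aorth (bil B) f X Y -> bil B X (f X) != 0 ->
  bil B Y (f Y) != 0 -> Aorth (bil B) f X T -> Aorth (bil B) f Y T ->
  bil B (Rm X Y X) T = 0 /\ bil B (Rm X (f X) X) T = 0.
Proof.
move=> XY gX gY XT YT.
pose V : 'M[R]_m := ((X + f X) + (Y + f Y))%MS.
have XV : (X <= V)%MS by rewrite (submx_trans _ (addsmxSl _ _)) // addsmxSl.
have fXV : (f X <= V)%MS by rewrite (submx_trans _ (addsmxSl _ _)) // addsmxSr.
have YV : (Y <= V)%MS by rewrite (submx_trans _ (addsmxSr _ _)) // addsmxSl.
have fYV : (f Y <= V)%MS by rewrite (submx_trans _ (addsmxSr _ _)) // addsmxSr.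
have dec (u : 'rV[R]_m) : (u <= V)%MS ->
    exists a b d e, u = a *: X + b *: f X + (d *: Y + e *: f Y).
  move=> /sub_addsmxP[[p q] /= ->].
  have /sub_addsmxP[[p1 p2] /= ->] : (p *m (X + f X)%MS <= X + f X)%MS by exact: submxMl.
  have /sub_addsmxP[[q1 q2] /= ->] : (q *m (Y + f Y)%MS <= Y + f Y)%MS by exact: submxMl.
  exists (p1 0 0), (p2 0 0), (q1 0 0), (q2 0 0).
  by rewrite -!mul_scalar_mx -!mx11_scalar.
have [XY1 XY2] := XY.
have [YX1 YX2] := AorthC wC wA XY.
have [XfY1 XfY2] := AorthAr (@bilZl _ _ B) wC ff wA XY.
have [YfX1 YfX2] := AorthAr (@bilZl _ _ B) wC ff wA (AorthC wC wA XY).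
have ndgV : nondegenerate_on B V.
  move=> u /dec[a [b [d [e ->]]]] h.
  have := h X XV; have := h (f X) fXV; have := h Y YV; have := h (f Y) fYV.
  rewrite !(bilDl, bilZl) XfY1 XfY2 YfX1 YfX2 XY1 XY2 YX1 YX2 !alt.
  rewrite (wA X X) (wA Y Y) !(mulr0, addr0, add0r).
  move=> /eqP; rewrite mulf_eq0 (negPf gY) orbF => /eqP ->.
  move=> /eqP; rewrite mulrN oppr_eq0 mulf_eq0 (negPf gY) orbF => /eqP ->.
  move=> /eqP; rewrite mulf_eq0 (negPf gX) orbF => /eqP ->.
  move=> /eqP; rewrite mulrN oppr_eq0 mulf_eq0 (negPf gX) orbF => /eqP ->.
  by rewrite !scale0r !addr0.
have stV : stablemx V A.
  apply/row_subP => i; rewrite row_mul.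
  have [a [b [d [e ->]]]] := dec _ (row_sub i V).
  rewrite -[_ *m A]/(f _) !fD !fZ !ff.
  by rewrite !addmx_sub ?scalemx_sub.
pose T' : 'cV[R]_m := B *m T^T.
have T'E (u : 'rV[R]_m) : u *m T' = (bil B u T)%:M.
  by rewrite /T' mulmxA [LHS]mx11_scalar.
have [XT1 XT2] := XT; have [YT1 YT2] := YT.
have VT' (u : 'rV[R]_m) : (u <= V)%MS -> u *m T' = 0.
  move=> /dec[a [b [d [e ->]]]].
  by rewrite T'E !(bilDl, bilZl) XT1 XT2 YT1 YT2 !mulr0 !addr0; apply/matrixP => i j; rewrite !mxE mul0rn.
have st (a b d : 'rV[R]_m) : (a <= V)%MS -> (b <= V)%MS -> (d <= V)%MS -> bil B (Rm a b d) T = 0.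
  move=> aV bV dV; have := @Rst V T' ndgV stV VT' a b d aV bV dV.
  by rewrite T'E => /matrixP /(_ 0 0); rewrite !mxE.
by split; apply: st.
Qed.

Lemma riemann_kmod : exists k, forall x y z, Rm x y z = k *: kmod B A x y z.
Proof.
pose D x y z t := bil B (Rm x y z) t.
have HD : Acurvature (bil B) f D.
  rewrite /D; split=> [a b y z t|k a y z t|x y a b t|k x y a t|x y z t|x y z t|x y z t|x y z t|X Y T].
  - by rewrite RDl bilDl.
  - by rewrite RZl bilZl.
  - by rewrite RDr bilDl.
  - by rewrite RZr bilZl.
  - by rewrite RN -scaleN1r bilZl mulN1r.
  - by have := Rsp x y z t; rewrite (wC z); lra.
  - by rewrite -!bilDl RB -(scale0r 0) bilZl mul0r.
  - by rewrite /f RA -/(f _) wA.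
  - exact: stable4.
have [k hk] := Acurvature_model (@bilDl _ _ B) (@bilZl _ _ B) wC fD fZ ff wA
  (exists_nonnull alt ndg Asp rkA) (exists_third_nonnull alt ndg AA Asp rkA dimm) HD.
exists k => x y z; apply/eqP; rewrite -subr_eq0; apply/eqP; apply: ndg => [|t _].
  exact: submx1.
rewrite bilBl bilZl; apply/eqP; rewrite subr_eq0; apply/eqP.
rewrite -[LHS]/(D x y z t) hk; congr (_ * _).
rewrite /model_curvature /kmod !(bilBl, bilDl, bilZl) -!/(f _) !wA.
by ring.
Qed.

Let orthT := Aorth (bil B) f.

(* For [Q] and [u] orthogonal to the plane of [P] and [P A], and [u] to that
   of [Q] and [Q A], the relation at [u], [P], [P A], [Q] has the single
   surviving term [alpha u *: kmod P (P A) Q]. *)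
Lemma kmod_Schur (alpha : 'rV[R]_m -> R) :
  (forall a b, alpha (a + b) = alpha a + alpha b) ->
  (forall u v w z, alpha u *: kmod B A v w z + alpha v *: kmod B A w u z
     + alpha w *: kmod B A u v z = 0) ->
  forall u, alpha u = 0.
Proof.
move=> aD h.
have X0 X : orthT X 0 by split; rewrite -(scale0r 0) bilZr mul0r.
have [X gX] := exists_nonnull alt ndg Asp rkA.
have third := exists_third_nonnull alt ndg AA Asp rkA dimm.
have [Y [gY XY _]] := third X 0 gX (or_introl erefl) (X0 X).
have [Z [gZ XZ YZ]] := third X Y gX (or_intror gY) XY.
have key P Q u : bil B P (f P) != 0 -> bil B Q (f Q) != 0 -> orthT P Q ->
    orthT P u -> orthT Q u -> alpha u = 0.
  move=> gP gQ PQ Pu Qu.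
  have [PQ1 PQ2] := PQ; have [QP1 QP2] := AorthC wC wA PQ.
  have [PfQ1 PfQ2] := AorthAr (@bilZl _ _ B) wC ff wA PQ.
  have [Pu1 Pu2] := Pu; have [uP1 uP2] := AorthC wC wA Pu.
  have [uQ1 uQ2] := AorthC wC wA Qu.
  have [ufQ1 ufQ2] := AorthAr (@bilZl _ _ B) wC ff wA (AorthC wC wA Qu).
  have [ufP1 _] := AorthAr (@bilZl _ _ B) wC ff wA (AorthC wC wA Pu).
  have := h u P (P *m A) Q; rewrite /kmod -!/(f _).
  rewrite PQ1 PQ2 PfQ1 PfQ2 uP1 Pu2 uQ1 ufQ1 !mulr0 !scale0r !subr0 !addr0 !scaler0 !addr0.
  rewrite scalerA => /eqP; rewrite scaler_eq0 => /orP[|/eqP fQ0].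
    by rewrite !mulf_eq0 pnatr_eq0 /= (negPf gP) !orbF => /eqP.
  by move: gQ; rewrite fQ0 -(scale0r 0) bilZr mul0r eqxx.
move=> u; pose p P T := Aproj (bil B) f P T.
have pP P T : bil B P (f P) != 0 -> orthT P (T - p P T).
  by move=> gP; apply: Aproj_orth => //; [exact: bilDl|exact: bilZl].
have pQ P Q T : orthT P Q -> orthT Q (p P T).
  move=> PQ; exact: (AorthC wC wA (Aproj_orthr (@bilDl _ _ B) (@bilZl _ _ B) wC ff wA T PQ)).
(* Each of the three components of [u] is orthogonal to two of the vectors [X], [Y], [Z], to which
   [key] is applied. *)
have -> : u = p X u + (u - p X u) by rewrite addrC subrK.
rewrite aD (key Y Z (p X u)) // ?add0r; try exact: pQ.
have := pP X u gX; move: (u - p X u) => r Xr.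
have -> : r = p Y r + (r - p Y r) by rewrite addrC subrK.
have YX := AorthC wC wA XY.
rewrite aD (key X Z (p Y r)) // ?add0r; try exact: pQ.
apply: (key X Y) => //; last exact: pP.
apply: AorthBr => //; [exact: bilDl|exact: bilZl|exact: pQ].
Qed.

(** Provides the denominator through which the scalar factor is recovered; the value is the product
    of [g] at two orthogonal nonnull vectors. *)
Lemma kmod_neq0 : exists X Y t, bil B (kmod B A X Y X) t != 0.
Proof.
have X0 X : orthT X 0 by split; rewrite -(scale0r 0) bilZr mul0r.
have [X gX] := exists_nonnull alt ndg Asp rkA.
have third := exists_third_nonnull alt ndg AA Asp rkA dimm.
have [Y [gY XY _]] := third X 0 gX (or_introl erefl) (X0 X).
exists X, Y, (f Y); have [XY1 _] := XY; have [YX1 YX2] := AorthC wC wA XY.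
have [YfX _] := AorthAr (@bilZl _ _ B) wC ff wA (AorthC wC wA XY).
rewrite /kmod -!/(f _) XY1 YX1 YfX alt !mulr0 !scale0r !subr0 !add0r bilZl.
by rewrite mulf_neq0.
Qed.

Lemma bil_delta u i : bil B u (delta_mx 0 i) = (u *m B) 0 i.
Proof. by rewrite /bil trmx_delta -colE mxE. Qed.

(* [A] is conjugate to [- A^T] by [B]. *)
Lemma tr_sp0 : \tr A = 0.
Proof.
have uB : B \in unitmx.
  rewrite -row_free_unit; apply: inj_row_free => u uB0; apply: ndg => [|v _].
    exact: submx1.
  by rewrite /bil uB0 mul0mx mxE.
have AB : A *m B = - (B *m A^T).
  apply/matrixP => i j.
  have : bil B (delta_mx 0 i) (delta_mx 0 j *m A) = (B *m A^T) i j.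
    by rewrite /bil trmx_mul trmx_delta !mulmxA -colE mxE -mulmxA -rowE mxE.
  have := Asp (delta_mx 0 i) (delta_mx 0 j).
  rewrite bil_delta -mulmxA -rowE !mxE => /eqP; rewrite addr_eq0 => /eqP -> ->.
  by [].
have : \tr A = - \tr A.
  rewrite -{1}[A](mulmxK uB) AB mulNmx raddfN /= mxtrace_mulC mulmxA mulVmx // mul1mx.
  by rewrite mxtrace_tr.
by move=> ?; lra.
Qed.

Lemma sum_bil_delta u (a : 'rV[R]_m) : \sum_i bil B u (delta_mx 0 i) * a 0 i = bil B u a.
Proof. by rewrite [RHS]mxE; apply: eq_bigr => i _; rewrite bil_delta !mxE. Qed.

(** In the order of the terms of [kmod], the coefficient is [2 + 0 + 1 + m - 1]; the zero comes from
    the trace of [A]. *)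
Lemma trace_kmod (u v : 'rV[R]_m) :
  \tr (lin1_mx (fun x => kmod B A u x v)) = (m%:R + 2) * bil B u (v *m A).
Proof.
have -> : \tr (lin1_mx (fun x => kmod B A u x v)) =
    \sum_i (2 * (bil B u (delta_mx 0 i) * (v *m A) 0 i) + bil B u v * A i i
    + (bil B v (delta_mx 0 i) * (u *m A) 0 i) + bil B u (v *m A)
    + bil B (v *m A) (delta_mx 0 i) * u 0 i).
  apply: eq_bigr => i _; rewrite mxE /kmod.
  rewrite (wC (delta_mx 0 i) v) (wC (delta_mx 0 i) (v *m A)) -rowE !mxE !eqxx /=.
  by ring.
rewrite !big_split /= -!mulr_sumr !sum_bil_delta -/(\tr A) tr_sp0.
rewrite sumr_const card_ord -mulr_natr (wC (v *m A)) (wC v (u *m A)) -!/(f _) wA.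
by ring.
Qed.

End pointwise.

(** * Constancy of the scalar factor *)

Section schur.
Variables (R : realType) (m : nat) (M : manifold R m) (G : christoffel M).
Variables (om A : mx_field M) (lambda : R).
Hypotheses (HG : linear_connection G) (tfG : torsion_free G)
  (parom : parallel_form G om) (parA : parallel_endo G A).
Hypothesis som : forall c, atlas M c -> smooth_on (cimg c) (om c).
Hypothesis sA : forall c, atlas M c -> smooth_on (cimg c) (A c).
Variables (c : chart R m M) (Mc : atlas M c).
Local Notation E := 'rV[R]_m.
Local Notation U := (cimg c).
Local Notation vf := (vector_field c).
Local Notation K x := (kmod (om c x) (A c x)).
Hypothesis alt : forall x, U x -> forall u, bil (om c x) u u = 0.
Hypothesis ndg : forall x, U x -> nondegenerate_on (om c x) 1%:M.
Hypothesis AA : forall x, U x -> A c x *m A c x = lambda%:M.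
Hypothesis Asp : forall x, U x -> forall u v,
  bil (om c x) (u *m A c x) v + bil (om c x) u (v *m A c x) = 0.
Hypothesis rkA : forall x, U x -> (3 <= \rank (A c x))%N.
Hypothesis dimm : (5 <= m)%N.
Variable kappa : E -> R.
Hypothesis kE : forall x, U x -> forall u v w,
  riemann (G c) x u v w = kappa x *: K x u v w.

Let oU : open U. Proof. exact: cimg_open. Qed.
Let bG x : U x -> bilin (G c x). Proof. exact: christoffel_bilin. Qed.

Let vfA Z : vf Z -> vf (fun z => Z z *m A c z).
Proof. by move=> vZ; apply: smooth_mulmx => //; exact: sA. Qed.

Definition bil_scale P Q S z : E := bil (om c z) (P z) (Q z) *: S z.

Lemma vf_bil_scale P Q S : vf P -> vf Q -> vf S -> vf (bil_scale P Q S).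
Proof.
move=> vP vQ vS; apply: smooth_scale => //.
by apply: smooth_bil => //; exact: som.
Qed.

Lemma covd_scale W (f : E -> R) Y x : derivable f x (W x) -> vf Y -> U x ->
  covd G c W (fun z => f z *: Y z) x = 'D_(W x) f x *: Y x + f x *: covd G c W Y x.
Proof.
move=> df vY Ux.
have [_ e] := is_derive_scale_mx df (vf_derivable (v := W x) vY Ux).
have e2 := bilinZr (f x) (W x) (Y x) (bG Ux).
rewrite /covd; refine (etrans (f_equal2 +%R e e2) _).
by rewrite scalerDr addrA.
Qed.

Lemma covd_bil_scale W P Q S x : vf W -> vf P -> vf Q -> vf S -> U x ->
  covd G c W (bil_scale P Q S) x =
  bil_scale (covd G c W P) Q S x + bil_scale P (covd G c W Q) S x +
  bil_scale P Q (covd G c W S) x.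
Proof.
move=> vW vP vQ vS Ux.
have sb : smooth_on U (fun z => bil (om c z) (P z) (Q z)).
  by apply: smooth_bil => //; exact: som.
refine (etrans (covd_scale (smooth_derivable (v := W x) sb Ux) vS Ux) _).
rewrite (parom Mc vW vP vQ Ux).
exact: (f_equal (+%R^~ _) (scalerDl _ _ _)).
Qed.

Lemma covdD X Y Y' x : vf Y -> vf Y' -> U x ->
  covd G c X (fun y => Y y + Y' y) x = covd G c X Y x + covd G c X Y' x.
Proof.
move=> vY vY' Ux.
have e1 : 'D_(X x) (fun y => Y y + Y' y) x = 'D_(X x) Y x + 'D_(X x) Y' x.
  by apply: deriveD; [exact: vf_derivable vY Ux|exact: vf_derivable vY' Ux].
have e2 := bilinDr (X x) (Y x) (Y' x) (bG Ux).
rewrite /covd; refine (etrans (f_equal2 +%R e1 e2) _).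
exact: addrACA.
Qed.

Lemma vf_sub Y Y' : vf Y -> vf Y' -> vf (fun y => Y y - Y' y).
Proof.
move=> vY vY'; apply: (@smooth_ext _ _ _ oU _ (fun y => Y y + (-1) *: Y' y)) => [y _|].
  by rewrite scaleN1r.
apply: smooth_add => //; apply: smooth_scale => //; exact: smooth_cst.
Qed.

(** [kmod] as a signed sum of [bil_scale] terms, the factor 2 being split into two equal ones, so
    that a single Leibniz rule covers all of them. *)
Let kfield X Y Z z := bil_scale X Y (fun z => Z z *m A c z) z +
  bil_scale X Y (fun z => Z z *m A c z) z + bil_scale X Z (fun z => Y z *m A c z) z
  - bil_scale Y Z (fun z => X z *m A c z) z + bil_scale X (fun z => Z z *m A c z) Y z
  - bil_scale Y (fun z => Z z *m A c z) X z.

Let kfieldE X Y Z z : K z (X z) (Y z) (Z z) = kfield X Y Z z.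
Proof. by rewrite /kfield /bil_scale -scalerDl -mulr2n -mulr_natl. Qed.

Let vf_kfield X Y Z : vf X -> vf Y -> vf Z -> vf (kfield X Y Z).
Proof.
move=> vX vY vZ; have vAX := vfA vX; have vAY := vfA vY; have vAZ := vfA vZ.
apply: vf_sub; last exact: vf_bil_scale.
apply: smooth_add => //; last exact: vf_bil_scale.
apply: vf_sub; last exact: vf_bil_scale.
apply: smooth_add => //; last exact: vf_bil_scale.
apply: smooth_add => //; exact: vf_bil_scale.
Qed.

Lemma vf_kmod X Y Z : vf X -> vf Y -> vf Z -> vf (fun z => K z (X z) (Y z) (Z z)).
Proof.
move=> vX vY vZ; apply: (@smooth_ext _ _ _ oU _ (kfield X Y Z)).
  by move=> y _; rewrite kfieldE.
exact: vf_kfield.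
Qed.

Lemma covd_kmod W X Y Z x : vf W -> vf X -> vf Y -> vf Z -> U x ->
  covd G c W (fun z => K z (X z) (Y z) (Z z)) x =
  K x (covd G c W X x) (Y x) (Z x) + K x (X x) (covd G c W Y x) (Z x) +
  K x (X x) (Y x) (covd G c W Z x).
Proof.
move=> vW vX vY vZ Ux; have vAX := vfA vX; have vAY := vfA vY; have vAZ := vfA vZ.
have vT P Q S : vf P -> vf Q -> vf S -> vf (bil_scale P Q S) by exact: vf_bil_scale.
refine (etrans (covd_ext G _ Ux (Y' := kfield X Y Z) _) _); first by move=> y _; exact: kfieldE.
have v2 := smooth_add oU (vT _ _ _ vX vY vAZ) (vT _ _ _ vX vY vAZ).
have v3 := smooth_add oU v2 (vT _ _ _ vX vZ vAY).
have v4 := vf_sub v3 (vT _ _ _ vY vZ vAX).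
have v5 := smooth_add oU v4 (vT _ _ _ vX vAZ vY).
refine (etrans (covdB HG Mc _ v5 (vT _ _ _ vY vAZ vX) Ux) _).
refine (etrans (f_equal (+%R^~ _) (covdD _ v4 (vT _ _ _ vX vAZ vY) Ux)) _).
rewrite (covdB HG Mc _ v3 (vT _ _ _ vY vZ vAX) Ux).
rewrite (covdD _ v2 (vT _ _ _ vX vZ vAY) Ux).
rewrite (covdD _ (vT _ _ _ vX vY vAZ) (vT _ _ _ vX vY vAZ) Ux).
rewrite !covd_bil_scale // /bil_scale /kmod.
rewrite (parA Mc vW vX Ux) (parA Mc vW vY Ux) (parA Mc vW vZ Ux).
set DX := covd G c W X x; set DY := covd G c W Y x; set DZ := covd G c W Z x.
move: (bil (om c x)) DX DY DZ => b DX DY DZ.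
by apply/rowP => j; rewrite !mxE; ring.
Qed.

(** [kappa] comes from a pointwise choice. With [X], [Y], [t] fixed so that the denominator [D] is
    nonzero at [x], it is near [x] the quotient of the smooth functions [N] and [D]. Additivity of
    its derivative is read off from the product rule for [kappa * D = N]. *)
Lemma kappa_derivable_linear x : U x ->
  (forall v, derivable kappa x v) /\
  (forall u v, 'D_(u + v) kappa x = 'D_u kappa x + 'D_v kappa x).
Proof.
move=> Ux.
have [X [Y [t Kt]]] := kmod_neq0 (alt Ux) (ndg Ux) (AA Ux) (Asp Ux) (rkA Ux) dimm.
have vc a : vf (fun=> a) by exact: vf_cst.
pose D z := bil (om c z) (K z X Y X) t; pose N z := bil (om c z) (riemann (G c) z X Y X) t.
have sD : smooth_on U D.
  by apply: smooth_bil => //; [exact: som|exact: (vf_kmod (vc X) (vc Y) (vc X))|exact: smooth_cst].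
have sN : smooth_on U N.
  by apply: smooth_bil => //; [exact: som|exact: (vf_riemann HG Mc X Y X)|exact: smooth_cst].
have Dx : D x != 0 by [].
have cD : D @ x --> D x by exact: smooth_continuous sD Ux.
have nD : \forall z \near x, D z != 0.
  exact: (cvgr_neq0 (D x)) cD Dx.
have NE z : U z -> N z = kappa z * D z by move=> Uz; rewrite /N kE // bilZl.
have nk : {near x, N * (fun z => (D z)^-1) =1 kappa}.
  near=> z; have Uz : U z by near: z; exact: open_nbhs_nbhs.
  refine (etrans (f_equal ( *%R^~ _) (NE z Uz)) _); apply: mulfK.
  near: z; exact: nD.
have dk v : derivable kappa x v.
  apply: (near_eq_derivable nk); apply: derivableM; first exact: smooth_derivable sN Ux.
  by apply: derivableV => //; exact: smooth_derivable sD Ux.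
have nN : {near x, kappa * D =1 N}.
  near=> z; apply/esym/NE; near: z; exact: open_nbhs_nbhs.
have DE v : 'D_v N x = kappa x * 'D_v D x + D x * 'D_v kappa x.
  rewrite -(near_eq_derive _ nN); apply: deriveM => //; exact: smooth_derivable sD Ux.
have lin (f : E -> R) u v : smooth_on U f -> 'D_(u + v) f x = 'D_u f x + 'D_v f x.
  move=> sf; have := derive_linear (smooth_differentiableR oU sf Ux) 1 u v.
  by rewrite !scale1r.
split=> // u v; apply: (mulfI Dx).
have gen (a b p q r s s' : R) : b * (p + q) + a * r = (b * p + a * s) + (b * q + a * s') ->
  a * r = a * (s + s') by lra.
have := DE (u + v); rewrite (lin N _ _ sN) (lin D _ _ sD) (DE u) (DE v) => /esym.
exact: gen.
Unshelve. all: by end_near. Qed.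

(** The model is parallel because [om] and [A] are, so only the derivative of the factor
    survives. *)
Lemma covd_curvature_kmod W X Y Z x : vf W -> vf X -> vf Y -> vf Z -> U x ->
  covd_curvature G c W X Y Z x = 'D_(W x) kappa x *: K x (X x) (Y x) (Z x).
Proof.
move=> vW vX vY vZ Ux; have vC P Q : vf P -> vf Q -> vf (covd G c P Q) by exact: vf_covd.
have cE P Q S z : vf P -> vf Q -> vf S -> U z ->
    curvature G c P Q S z = kappa z *: K z (P z) (Q z) (S z).
  by move=> vP vQ vS Uz; rewrite curvature_tensor // kE.
rewrite /covd_curvature !cE //; try exact: vC.
refine (etrans (f_equal (fun v => v - _ - _ - _) (covd_ext G _ Ux (Y' := fun z => kappa z *: K z (X z) (Y z) (Z z)) _)) _).
  by move=> z Uz; exact: cE.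
have [dk _] := kappa_derivable_linear Ux.
rewrite (covd_scale (dk (W x)) (vf_kmod vX vY vZ) Ux) covd_kmod //.
have gen (k : R) (a b d e : E) : a + k *: (b + d + e) - k *: b - k *: d - k *: e = a.
  by apply/rowP => j; rewrite !mxE; ring.
exact: gen.
Qed.

Lemma derive_kappa0 x u : U x -> 'D_u kappa x = 0.
Proof.
move=> Ux; have vc a : vf (fun=> a) by exact: vf_cst.
have [_ kD] := kappa_derivable_linear Ux.
apply: (kmod_Schur (alt Ux) (ndg Ux) (AA Ux) (Asp Ux) (rkA Ux) dimm kD) => a b d z.
have := second_Bianchi HG tfG Mc a b d z Ux.
by rewrite !covd_curvature_kmod.
Qed.

Lemma ricci_kappa x u v : U x ->
  ricci G c x u v = (kappa x * (m%:R + 2)) * bil (om c x) u (v *m A c x).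
Proof.
move=> Ux; have vc a : vf (fun=> a) by exact: vf_cst.
have e : (fun w : E => curvature G c (fun=> u) (fun=> w) (fun=> v) x) =
    (fun w => kappa x *: K x u w v).
  by apply/funext => w; rewrite curvature_tensor // kE.
have lZ (f : E -> E) k : lin1_mx (fun w => k *: f w) = k *: lin1_mx f.
  by apply/matrixP => i j; rewrite !mxE.
rewrite /ricci e lZ mxtraceZ -mulrA; congr (_ * _).
exact: (trace_kmod (alt Ux) (ndg Ux) (Asp Ux)).
Qed.

End schur.

Theorem theorem3p1 (R : realType) (n : nat) (M : manifold R (2 * n))
  (omega : mx_field M) (nabla : christoffel M) (A : mx_field M) (lambda : R)
  (dim_ge8 : (8 <= 2 * n)%N)
  (omega_symplectic : symplectic_form omega)
  (nabla_symplectic : symplectic_connection omega nabla)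
  (A_smooth : endo_field A)
  (A_parallel : parallel_endo nabla A)
  (A_square : forall c, atlas M c -> forall x, cimg c x ->
     A c x *m A c x = lambda%:M)
  (A_sp : forall c, atlas M c -> forall x, cimg c x -> forall u v,
     bil (omega c x) (u *m A c x) v + bil (omega c x) u (v *m A c x) = 0)
  (A_rank : forall c, atlas M c -> forall x, cimg c x -> (3 <= \rank (A c x))%N)
  (A_geodesic : forall c, atlas M c -> forall y : M, cdom c y ->
     forall V : 'M[R]_(2 * n),
     nondegenerate_on (omega c (cmap c y)) V ->
     stablemx V (A c (cmap c y)) ->
     exists (k : nat) (S : manifold R k) (i : S -> M),
       [/\ submanifold i, totally_geodesic nabla i
         & exists2 q, i q = y
                    & tangent_space i q c = [set u | (u <= V)%MS]]) :
  locally_symmetric nabla /\ ricci_type omega nabla.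
Proof.
have [[som _] alt ndg _] := omega_symplectic.
have [HG tfG parom] := nabla_symplectic.
have [sA _] := A_smooth.
have dimm : (5 <= 2 * n)%N by exact: leq_trans dim_ge8.
have pt c x : atlas M c -> cimg c x -> exists k, forall u v w,
    riemann (nabla c) x u v w = k *: kmod (omega c x) (A c x) u v w.
  move=> Mc Ux; apply: (riemann_kmod (alt c Mc x Ux) (ndg c Mc x Ux) (A_square c Mc x Ux)
    (A_sp c Mc x Ux) (A_rank c Mc x Ux) dimm).
  - move=> a b y z; exact: riemannDl.
  - move=> k a y z; exact: riemannZl.
  - move=> u v a b; exact: riemannDr.
  - move=> k u v a; exact: riemannZr.
  - move=> u v w; exact: riemannN.
  - move=> u v w; exact: riemann_Bianchi.
  - move=> u v z t; exact: (riemann_sp HG parom som Mc).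
  - move=> u v z; exact: (riemann_commute HG A_parallel sA Mc).
  move=> V T ndV stV VT.
  have dy := cinv_dom Ux; have xE := cinvK Ux.
  have := A_geodesic c Mc _ dy V; rewrite xE => /(_ ndV stV).
  move=> [k [S [i [subi tgi [q iq TV]]]]] u v w uV vV wV.
  have cq : cdom c (i q) by rewrite iq.
  have := riemann_stable HG tfG subi tgi Mc cq TV VT uV vV wV.
  by rewrite iq xE.
have [kappa kE] : exists kappa : chart R (2 * n) M -> 'rV[R]_(2 * n) -> R,
    forall c, atlas M c -> forall x, cimg c x -> forall u v w,
    riemann (nabla c) x u v w = kappa c x *: kmod (omega c x) (A c x) u v w.
  (* Indexing by pairs of a chart and a point allows one use of [choice]; the factor is set to 0 off
     the chart images. *)
  pose P (p : chart R (2 * n) M * 'rV[R]_(2 * n)) k := atlas M p.1 -> cimg p.1 p.2 ->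
    forall u v w, riemann (nabla p.1) p.2 u v w =
      k *: kmod (omega p.1 p.2) (A p.1 p.2) u v w.
  have [|f fE] := choice (P := P).
    move=> [c x]; have [[Mc Ux]|h] := pselect (atlas M c /\ cimg c x).
      by have [k hk] := pt c x Mc Ux; exists k.
    by exists 0 => Mc Ux; case: h.
  by exists (fun c x => f (c, x)) => c Mc x Ux; exact: (fE (c, x)).
split.
  move=> c Mc W X Y Z vW vX vY vZ x Ux.
  refine (etrans (covd_curvature_kmod HG parom A_parallel som sA Mc (alt c Mc) (ndg c Mc)
    (A_square c Mc) (A_sp c Mc) (A_rank c Mc) dimm (kE c Mc) vW vX vY vZ Ux) _).
  by rewrite (derive_kappa0 HG tfG parom A_parallel som sA Mc (alt c Mc) (ndg c Mc)
    (A_square c Mc) (A_sp c Mc) (A_rank c Mc) dimm (kE c Mc)) ?scale0r.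
exists (fun c x => (kappa c x * ((2 * n)%:R + 2)) *: A c x) => [c Mc x Ux u v|].
  rewrite -scalemxAr bilZr; apply/esym.
  exact: (ricci_kappa HG Mc (alt c Mc) (ndg c Mc) (A_sp c Mc) (kE c Mc)).
move=> c Mc X Y Z vX vY vZ x Ux /=.
rewrite curvature_tensor // kE // /kmod -!scalemxAr !bilZr.
have n0 : (2 * n)%:R + 2 != 0 :> R by rewrite -natrD pnatr_eq0 addnC.
move: ((2 * n)%:R + 2) n0 => d d0.
apply/rowP => j; rewrite !mxE; field; exact: d0.
Qed.
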